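(* Let $1<p<\infty$ and let $(\nu_\varepsilon)_{\varepsilon>0}$ be a family of radial measurable functions $\nu_\varepsilon:\mathbb{R}^d\setminus\{0\}\to[0,\infty)$. For a function $u$ consider the relation $$(\ast)\qquad\lim_{\varepsilon\to0}\int_{\mathbb{R}^d}\int_{\mathbb{R}^d}|u(x)-u(y)|^p\nu_\varepsilon(x-y)\,dy\,dx=K_{d,p}\int_{\mathbb{R}^d}|\nabla u(x)|^p\,dx .$$ The following are equivalent. (i) The family $(\nu_\varepsilon)_\varepsilon$ satisfies $$\lim_{\varepsilon\to0}\int_{\mathbb{R}^d}(1\wedge|h|^p)\nu_\varepsilon(h)\,dh=1\quad\text{and, for all }\delta>0,\quad\lim_{\varepsilon\to0}\int_{|h|>\delta}\nu_\varepsilon(h)\,dh=0 .$$ (ii) The relation $(\ast)$ holds for all $u\in W^{1,p}(\mathbb{R}^d)$. (iii) The relation $(\ast)$ holds for all $u\in C_c^\infty(\mathbb{R}^d)$. (iv) There exists $u\in C_c^\infty(\mathbb{R}^d)\setminus\{0\}$ such that the relation $(\ast)$ holds for each $u_\tau(x)=\tau^du(\tau x)$, $\tau>0$.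
   Context: $a\wedge b=\min(a,b)$. The constant is $K_{d,p}=\frac{1}{|\mathbb{S}^{d-1}|}\int_{\mathbb{S}^{d-1}}|w_d|^p\,d\sigma_{d-1}(w)=\frac{\Gamma(\frac d2)\Gamma(\frac{p+1}2)}{\Gamma(\frac{d+p}2)\Gamma(\frac12)}$, where $\sigma_{d-1}$ is the surface measure on the unit sphere. *)

(* Defs.v *)
From HB Require Import structures.
From mathcomp Require Import all_boot all_order all_algebra.
From mathcomp Require Import all_classical all_reals all_analysis.
From mathcomp Require Import measurable_realfun.

Set Implicit Arguments.
Unset Strict Implicit.
Unset Printing Implicit Defensive.

Import Order.TTheory GRing.Theory Num.Theory.
Import numFieldNormedType.Exports.

Local Open Scope classical_set_scope.
Local Open Scope ring_scope.

(* The sigma-algebra on R^n generated by the coordinates, i.e., the Borel one. *)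
Definition rV_display : measure_display -> measure_display.
Proof. exact. Qed.

Section measurable_rV.
Context {R : realType}.
Variable n : nat.

Let coords : 'I_n -> 'rV[R]_n -> measurableTypeR R := fun i x => x ord0 i.

Let rV_set0 : g_sigma_preimage coords set0.
Proof. exact: sigma_algebra0. Qed.

Let rV_setC A : g_sigma_preimage coords A -> g_sigma_preimage coords (~` A).
Proof. exact: sigma_algebraC. Qed.

Let rV_bigcup (F : (set 'rV[R]_n)^nat) :
  (forall i, g_sigma_preimage coords (F i)) ->
  g_sigma_preimage coords (\bigcup_i (F i)).
Proof. exact: sigma_algebra_bigcup. Qed.

HB.instance Definition _ :=
  @isMeasurable.Build (rV_display default_measure_display)
    'rV[R]_n (g_sigma_preimage coords) rV_set0 rV_setC rV_bigcup.

Lemma measurable_coord (i : 'I_n) :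
  measurable_fun [set: 'rV[R]_n] (fun x : 'rV[R]_n => x ord0 i).
Proof.
move=> _ Y mY; rewrite setTI; apply: sub_sigma_algebra => /=.
rewrite -bigcup_seq/=; exists i => /=; first by rewrite mem_index_enum.
by exists Y => //; rewrite setTI.
Qed.

Lemma measurable_fun_rVP d (T : measurableType d) (f : T -> 'rV[R]_n) :
  (forall i, measurable_fun [set: T] (fun x => f x ord0 i)) ->
  measurable_fun [set: T] f.
Proof.
move=> mf; have sub : g_sigma_preimage (fun i => coords i \o f) `<=` measurable.
  apply: smallest_sub; first exact: sigma_algebra_measurable.
  rewrite -bigcup_seq; apply: bigcup_sub => i _ _ [B mB <-]; exact: mf.
by move=> _ A mA; apply: sub; rewrite g_sigma_preimage_comp; exists A.
Qed.

End measurable_rV.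

Section lebesgue_rV.
Context {R : realType}.
Implicit Types n : nat.

Definition cons_rV n (xv : measurableTypeR R * 'rV[R]_n) : 'rV[R]_n.+1 :=
  \row_i (if unlift ord0 i is Some j then xv.2 ord0 j else xv.1).

Lemma cons_rV0 n xv : @cons_rV n xv ord0 ord0 = xv.1.
Proof. by rewrite mxE unlift_none. Qed.

Lemma cons_rVS n xv j : @cons_rV n xv ord0 (lift ord0 j) = xv.2 ord0 j.
Proof. by rewrite mxE liftK. Qed.

Lemma measurable_cons_rV n : measurable_fun [set: _] (@cons_rV n).
Proof.
apply: measurable_fun_rVP => i; have [j ->|->] := unliftP ord0 i; last first.
  by under eq_fun do rewrite cons_rV0; exact: measurable_fst.
under eq_fun do rewrite cons_rVS.
by apply: (measurableT_comp (measurable_coord j)); exact: measurable_snd.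
Qed.

Definition uncons_rV n (x : 'rV[R]_n.+1) : measurableTypeR R * 'rV[R]_n :=
  (x ord0 ord0, \row_j x ord0 (lift ord0 j)).

Lemma cons_rVK n : cancel (@cons_rV n) (@uncons_rV n).
Proof.
move=> [x v]; congr pair; first exact: cons_rV0.
by apply/rowP => j; rewrite mxE cons_rVS.
Qed.

Lemma uncons_rVK n : cancel (@uncons_rV n) (@cons_rV n).
Proof.
move=> x; apply/rowP => i; have [j ->|->] := unliftP ord0 i.
  by rewrite cons_rVS mxE.
by rewrite cons_rV0.
Qed.

Lemma measurable_uncons_rV n : measurable_fun [set: _] (@uncons_rV n).
Proof.
apply/measurable_fun_pairP; split; first exact: measurable_coord.
apply: measurable_fun_rVP => j; under eq_fun do rewrite mxE.
exact: measurable_coord.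
Qed.

Section step.
Variables (n : nat) (m : {sigma_finite_measure set 'rV[R]_n -> \bar R}).

Let lm : {sigma_finite_measure set (measurableTypeR R) -> \bar R} :=
  lebesgue_measure.

Definition lebesgue_cons := pushforward (lm \x m)%E (@cons_rV n).


Let mcons := @measurable_cons_rV n.

Let lebesgue_cons0 : lebesgue_cons set0 = 0%E.
Proof. exact: measure0. Qed.

Let lebesgue_cons_ge0 A : (0 <= lebesgue_cons A)%E.
Proof. exact: measure_ge0. Qed.

Let lebesgue_cons_sigma_additive : semi_sigma_additive lebesgue_cons.
Proof. exact: measure_semi_sigma_additive. Qed.

HB.instance Definition _ := isMeasure.Build _ _ _ lebesgue_cons
  lebesgue_cons0 lebesgue_cons_ge0 lebesgue_cons_sigma_additive.

Let lebesgue_cons_sigma_finite : sigma_finite [set: 'rV[R]_n.+1] lebesgue_cons.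
Proof.
have /sigma_finiteP[F [TF ndF Foo]] := sigma_finiteT lm.
have /sigma_finiteP[G [TG ndG Goo]] := sigma_finiteT m.
pose FG k := F k `*` G k.
have FGT : setT = \bigcup_k FG k.
  rewrite -setXTT TF TG predeqE => -[x y]; split.
    move=> [/= [i _ Fix] [k _ Gky]]; exists (maxn i k) => //; split.
    - by move: x Fix; exact/subsetPset/ndF/leq_maxl.
    - by move: y Gky; exact/subsetPset/ndG/leq_maxr.
  by move=> [i _ []/= ? ?]; split; exists i.
have mFG k : measurable (FG k) /\ ((lm \x m) (FG k) < +oo)%E.
  have [? ?] := Foo k; have [? ?] := Goo k; split; first exact: measurableX.
  by rewrite product_measure1E// lte_mul_pinfty// ge0_fin_numE.
exists (fun k => @uncons_rV n @^-1` FG k).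
  by rewrite -preimage_bigcup -FGT preimage_setT.
move=> k; have [mFk Fk] := mFG k; split.
  by rewrite -[X in measurable X]setTI; exact: measurable_uncons_rV.
rewrite /lebesgue_cons /pushforward -comp_preimage.
by rewrite (_ : _ \o _ = id)//; apply/funext => x /=; rewrite cons_rVK.
Qed.

HB.instance Definition _ := Measure_isSigmaFinite.Build _ _ _ lebesgue_cons
  lebesgue_cons_sigma_finite.

End step.

Fixpoint lebesgue_rV n : {sigma_finite_measure set 'rV[R]_n -> \bar R} :=
  if n is n'.+1 then lebesgue_cons (lebesgue_rV n') else \d_(0 : 'rV[R]_0).

Lemma measurable_box n (A : 'I_n -> set (measurableTypeR R)) :
  (forall i, measurable (A i)) ->
  measurable [set x : 'rV[R]_n | forall i, A i (x ord0 i)].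
Proof.
move=> mA.
have -> : [set x : 'rV[R]_n | forall i, A i (x ord0 i)] =
    \bigcap_(i in [set: 'I_n]) [set x | A i (x ord0 i)].
  by apply/seteqP; split => x /= Ax i; [move=> _; exact: Ax|exact: Ax].
apply: fin_bigcap_measurable => [|i _]; first exact: finite_finset.
by rewrite -[X in measurable X]setTI; exact: (measurable_coord i _ (mA i)).
Qed.

Lemma lebesgue_rV_box n (A : 'I_n -> set (measurableTypeR R)) :
  (forall i, measurable (A i)) ->
  lebesgue_rV n [set x : 'rV[R]_n | forall i, A i (x ord0 i)] =
  (\prod_(i < n) lebesgue_measure (A i))%E.
Proof.
elim: n A => [|n IH] A mA.
  rewrite big_ord0 /= diracE.
  have -> : 0 \in [set x : 'rV[R]_0 | forall i, A i (x ord0 i)] = true.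
    by apply/mem_set => /= -[].
  by [].
rewrite big_ord_recl /= -IH//.
transitivity ((lebesgue_measure \x lebesgue_rV n)%E
    (A ord0 `*` [set x : 'rV[R]_n | forall i, A (lift ord0 i) (x ord0 i)])).
  congr product_measure1; apply/seteqP; split => -[x v] /=.
    move=> Axv; split; first by have := Axv ord0; rewrite cons_rV0.
    by move=> i; have := Axv (lift ord0 i); rewrite cons_rVS.
  move=> [Ax Av] i; have [j ->|->] := unliftP ord0 i.
    by rewrite cons_rVS; exact: Av.
  by rewrite cons_rV0.
rewrite product_measure1E//.
by apply: (@measurable_box n (fun i => A (lift ord0 i))) => i; exact: mA.
Qed.

End lebesgue_rV.

Section euclidean.
Context {R : realType}.
Variable n : nat.
Implicit Type x : 'rV[R]_n.

Definition enorm x : R := Num.sqrt (\sum_(i < n) x ord0 i ^+ 2).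

Lemma measurable_enorm : measurable_fun [set: _] enorm.
Proof.
apply: (measurableT_comp (f := @Num.sqrt R)).
  by apply: continuous_measurable_fun; exact: sqrt_continuous.
apply: measurable_sum => i; apply: measurable_funX; exact: measurable_coord.
Qed.

End euclidean.

Section surface_measure.
Context {R : realType}.
Variable n : nat.
Implicit Type x : 'rV[R]_n.

Definition sphere : set 'rV[R]_n := [set x | enorm x = 1].

Definition punctured_ball : set 'rV[R]_n := [set x | 0 < enorm x <= 1].

Lemma measurable_punctured_ball : measurable punctured_ball.
Proof.
rewrite (_ : punctured_ball = setT `&` @enorm R n @^-1` `]0, 1]).
  by apply: measurable_enorm => //; exact: measurable_itv.
by rewrite setTI; apply/seteqP; split => x /=; rewrite in_itv.
Qed.

Definition normalize x : 'rV[R]_n := (enorm x)^-1 *: x.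

Lemma measurable_normalize : measurable_fun [set: _] normalize.
Proof.
apply: measurable_fun_rVP => i; under eq_fun do rewrite mxE.
apply: measurable_funM; last exact: measurable_coord.
rewrite (_ : (fun x => (enorm x)^-1) = (fun r : R => r `^ (-1)) \o @enorm R n).
  by apply: (measurableT_comp _ (@measurable_enorm R n)); exact: measurable_powR.
by apply/funext => x /=; rewrite powR_inv1// sqrtr_ge0.
Qed.

(* The surface measure of a part A of the unit sphere is n times the volume of
   the cone {x | 0 < |x| <= 1, x / |x| \in A} over A. As a measure on R^n it
   is carried by the sphere; for n = 1 it is the counting measure on {-1, 1}. *)
Definition surface_measure (A : set 'rV[R]_n) : \bar R :=
  (n%:R%:E * lebesgue_rV n (normalize @^-1` A `&` punctured_ball))%E.

Let surface_measure0 : surface_measure set0 = 0%E.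
Proof. by rewrite /surface_measure preimage_set0 set0I measure0 mule0. Qed.

Let mN A : measurable A -> measurable (normalize @^-1` A `&` punctured_ball).
Proof.
move=> mA; apply: measurableI; last exact: measurable_punctured_ball.
by rewrite -[X in measurable X]setTI; exact: measurable_normalize.
Qed.

Let surface_measure_ge0 A : (0 <= surface_measure A)%E.
Proof. by rewrite /surface_measure mule_ge0 ?lee_fin. Qed.

Let surface_measure_sigma_additive : semi_sigma_additive surface_measure.
Proof.
move=> F mF tF mUF.
have mN' := measurable_normalize.
exact: (@measure_semi_sigma_additive _ _ _ (mscale n%:R%:nng
  (pushforward (mrestr (lebesgue_rV n) measurable_punctured_ball)
    normalize)) F).
Qed.

HB.instance Definition _ := isMeasure.Build _ _ _ surface_measure
  surface_measure0 surface_measure_ge0 surface_measure_sigma_additive.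

End surface_measure.
Arguments sphere {R n}.

Section sphere_constant.
Context {R : realType}.

(* K_{d,p} for d = n.+1: the mean of |w_d|^p over the unit sphere of R^d *)
Definition sphere_constant n (p : R) : R :=
  fine (\int[@surface_measure R n.+1]_(w in sphere) (`|w ord0 ord_max| `^ p)%:E)
  / fine (@surface_measure R n.+1 sphere).

End sphere_constant.

Section function_spaces.
Context {R : realType}.
Variable d : nat.
Local Notation Rd := 'rV[R]_d.
Local Notation leb := (@lebesgue_rV R d).
Implicit Types (u phi : Rd -> R) (G : Rd -> Rd) (p : R) (i : 'I_d).

Definition partial i u : Rd -> R := 'D_(delta_mx ord0 i) u.

Definition grad u : Rd -> Rd := fun x => \row_i partial i u x.

Definition smooth u := forall s : seq 'I_d,
  let v := foldr partial u s in
  continuous v /\ forall i x, derivable v x (delta_mx ord0 i).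

Definition Cc_infty u := smooth u /\ compact (closure [set x | u x != 0]).

(* G is a weak gradient of u with components in L^p, hence unique a.e. *)
Definition Lp_weak_gradient p u G := forall i,
  (fun x => G x ord0 i) \in Lfun leb p%:E /\
  forall phi, Cc_infty phi ->
    (\int[leb]_x (u x * partial i phi x)%:E =
     - \int[leb]_x (G x ord0 i * phi x)%:E)%E.

Definition W1p p u := u \in Lfun leb p%:E /\ exists G, Lp_weak_gradient p u G.

Definition radial (k : Rd -> R) :=
  forall x y, x != 0 -> y != 0 -> enorm x = enorm y -> k x = k y.

End function_spaces.

Section nonlocal_energies.
Context {R : realType}.
Variable n : nat.
Local Notation d := n.+1.
Local Notation Rd := 'rV[R]_d.
Local Notation leb := (@lebesgue_rV R d).
Implicit Types (u : Rd -> R) (nu : R -> Rd -> R) (p : R).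

(* The value k 0 is irrelevant for p != 0: its factor vanishes when x = y. *)
Definition nonlocal_energy p (k : Rd -> R) u : \bar R :=
  (\int[leb]_x \int[leb]_y (`|u x - u y| `^ p * k (x - y))%:E)%E.

Definition gradient_energy p (G : Rd -> Rd) : \bar R :=
  (\int[leb]_x (enorm (G x) `^ p)%:E)%E.

(* G is meant to be the (classical or weak) gradient of u *)
Definition energy_limit p nu u (G : Rd -> Rd) :=
  nonlocal_energy p (nu e) u @[e --> 0^'+] -->
    ((sphere_constant n p)%:E * gradient_energy p G)%E.

Definition concentrates p nu :=
  (\int[leb]_h (Num.min 1 (enorm h `^ p) * nu e h)%:E)%E
    @[e --> 0^'+] --> 1%E /\
  forall delta : R, 0 < delta ->
    (\int[leb]_(h in [set h : Rd | (delta < enorm h)%R]) (nu e h)%:E)%E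
      @[e --> 0^'+] --> 0%E.

Definition rescale u (tau : R) : Rd -> R :=
  fun x => tau ^+ d * u (tau *: x).

End nonlocal_energies.

(* Main.v *)
Require Import Defs.
From mathcomp Require Import all_boot all_order all_algebra.
From mathcomp Require Import all_classical all_reals all_analysis.
From mathcomp Require Import measurable_realfun.
From mathcomp Require Import ring lra.

(** Write F(h) for the integral of |u(x) - u(x-h)|^p over x ([diff_energy]) and
    S(h) for the integral of |h . G(x)|^p, where G is the gradient of u
    ([slope_energy]). Since nu is radial, it is a profile kappa of |h| off the
    origin, and by Tonelli the nonlocal energy is the integral of kappa(|h|) F(h)
    over h ([double_integral_diff]). So everything is about how F compares with S
    and how a radial weight integrates S.

    Radial integration: reflections preserve Lebesgue measure, so the integral of
    kappa(|h|) |a . h|^p depends on a only through |a|. Exchanging the roles of h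
    and of a second radial variable identifies its value, the sphere constant K
    being obtained from the profile r^-p on the unit ball; hence the integral of
    kappa(|h|) S(h) is K |grad u|_p^p times the integral of kappa(|h|) |h|^p
    ([slope_energy_profile]). No polar coordinates are involved.

    Comparison of F and S, for u in W^(1,p): F <= S everywhere
    ([diff_energy_le]), and S(h) <= F(h) + eta |h|^p for small h
    ([slope_energy_small]). Both come from a duality formula: the integral of
    |g|^p is the supremum over test functions phi of the integral of
    p g phi - (p-1) |phi|^q ([pairing_sup]); against a test function, increments of u
    become increments of phi, to which the mean value theorem and Taylor's
    formula apply. Uniformity in the direction of h is compactness of the sphere.

    If nu concentrates, split the profile at a small radius: the far part of the
    energy vanishes because F is bounded, and on the near part F is S up to
    eta |h|^p. Thus the energies tend to L = K |grad u|_p^p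
    ([concentration_limit]), which is (i) => (ii). Smooth compactly supported
    functions are Sobolev functions, (ii) => (iii), and a bump function together
    with its dilates is a case of (iii), (iii) => (iv).

    For (iv) => (i), scaling turns the hypothesis for u_tau into: the integral of
    kappa(|h|) F(tau h) tends to tau^p L for every tau > 0. Let S_d and T_d be the
    integral of kappa(|h|) |h|^p over |h| <= d and of kappa(|h|) over |h| > d.
    The case tau = 1 bounds both, because F(h) >= c min(1, |h|^p) when u is a
    nonzero test function ([diff_energy_coercive]). The upper bound
    tau^p L S_d + C T_d of the energy, divided by tau^p with tau large, gives
    liminf S_d >= 1. With tau d = rho small the lower bound
    tau^p (L - eta) S_d + c rho^p T_d of the energy leaves no room for T_d
    and forces S_d -> 1 and T_d -> 0 ([concentration_converse]). *)

Set Implicit Arguments.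
Unset Strict Implicit.
Unset Printing Implicit Defensive.

Import Order.TTheory GRing.Theory Num.Theory.
Import numFieldNormedType.Exports.

Local Open Scope classical_set_scope.
Local Open Scope ring_scope.

(** * Lebesgue measure under translations and additive maps *)

Section translation.
Context {R : realType}.

Lemma lebesgue_measure_shift (a : R) (A : set R) : measurable A ->
  lebesgue_measure ((fun x : measurableTypeR R => x + a) @^-1` A) =
  lebesgue_measure A.
Proof.
move=> mA.
have ms : measurable_fun setT ((fun x => x + a) : measurableTypeR R -> measurableTypeR R).
  by apply: measurable_funD.
apply/esym.
apply: (@lebesgue_measure_unique R (pushforward (@lebesgue_measure R) (fun x : measurableTypeR R => x + a : measurableTypeR R))) => //.
move=> _ [[u v]] _ <- /=; rewrite /pushforward.
have -> : (fun x : measurableTypeR R => x + a) @^-1` `]u, v]%classic =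
    `]u - a, v - a]%classic.
  by apply/seteqP; split => x /=; rewrite !in_itv/= ltrBlDr lerBrDr.
rewrite !lebesgue_measure_itv/= !lte_fin ltrD2r; case: ifP => // _.
by rewrite -!EFinB; congr EFin; ring.
Qed.

Lemma measurable_addrV n (a : 'rV[R]_n) :
  measurable_fun setT (fun x : 'rV[R]_n => x + a).
Proof.
apply: measurable_fun_rVP => i; under eq_fun do rewrite mxE.
by apply: measurable_funD => //; exact: measurable_coord.
Qed.

(** Induction on the dimension: the measure on R^(n+1) is a product, and
    product measures are determined by their values on rectangles. *)
Lemma lebesgue_rV_shift n (a : 'rV[R]_n) (A : set 'rV[R]_n) : measurable A ->
  lebesgue_rV n ((fun x => x + a) @^-1` A) = lebesgue_rV n A.
Proof.
elim: n a A => [a A _|n IH a A mA].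
  by congr (lebesgue_rV _ _); apply/seteqP; split => x /=; rewrite !thinmx0.
pose lm : {sigma_finite_measure set (measurableTypeR R) -> \bar R} :=
  lebesgue_measure.
pose b : 'rV[R]_n := \row_j a ord0 (lift ord0 j).
pose s (z : measurableTypeR R * 'rV[R]_n) : measurableTypeR R * 'rV[R]_n :=
  (z.1 + a ord0 ord0, z.2 + b).
have ms : measurable_fun setT s.
  apply/measurable_fun_pairP; split.
    by apply: measurable_funD => //; exact: measurable_fst.
  by apply: (measurableT_comp (measurable_addrV b)); exact: measurable_snd.
have sE C : measurable C -> (lm \x lebesgue_rV n)%E C = (lm \x lebesgue_rV n)%E (s @^-1` C).
  move=> mC.
  apply: (@product_measure_unique _ _ _ _ _ lm (lebesgue_rV n)
    (pushforward (lm \x lebesgue_rV n)%E s)) => // X Y mX mY.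
  rewrite /= /pushforward.
  have -> : s @^-1` (X `*` Y) = ((fun x => x + a ord0 ord0) @^-1` X) `*`
     ((fun x => x + b) @^-1` Y) by apply/seteqP; split.
  have mX' : measurable ((fun x : measurableTypeR R => x + a ord0 ord0) @^-1` X).
    by rewrite -[X in measurable X]setTI; apply: measurable_funD.
  have mY' : measurable ((fun x => x + b) @^-1` Y).
    by rewrite -[X in measurable X]setTI; exact: measurable_addrV.
  rewrite product_measure1E//= IH//.
  by rewrite /lm lebesgue_measure_shift.
rewrite /= /lebesgue_cons /pushforward.
have mcA : measurable (cons_rV (n := n) @^-1` A).
  by rewrite -[X in measurable X]setTI; exact: measurable_cons_rV.
rewrite [RHS]sE//; congr (_ _); apply/seteqP; split => -[x v] /=; rewrite /s/=.
  by congr (A _); apply/rowP => i; rewrite !mxE; case: unliftP => [j|] -> //=; rewrite !mxE.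
by congr (A _); apply/rowP => i; rewrite !mxE; case: unliftP => [j|] -> //=; rewrite !mxE.
Qed.

End translation.

Section preserving.
Context {R : realType} {n : nat}.
Local Notation Rn := 'rV[R]_n.
Local Notation leb := (@lebesgue_rV R n).

(** Stated on preimages, the form that a change of variables in an integral
    uses. *)
Definition preserves_leb (T : Rn -> Rn) :=
  measurable_fun setT T /\
  forall A, measurable A -> leb (T @^-1` A) = leb A.

Lemma preserves_leb_shift a : preserves_leb (fun x => x + a).
Proof.
split; [exact: measurable_addrV | exact: lebesgue_rV_shift].
Qed.

Lemma ge0_integral_preserves T (f : Rn -> \bar R) : preserves_leb T ->
  measurable_fun setT f -> (forall x, 0 <= f x)%E ->
  (\int[leb]_x f (T x) = \int[leb]_x f x)%E.
Proof.
move=> [mT pT] mf f0.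
have := @ge0_integral_pushforward _ _ _ _ R T mT leb setT f measurableT mf (fun x _ => f0 x).
rewrite preimage_setT => <-.
by apply: eq_measure_integral => A mA _; exact: pT.
Qed.

Lemma integrable_preserves T (f : Rn -> \bar R) : preserves_leb T ->
  leb.-integrable setT f -> leb.-integrable setT (f \o T).
Proof.
move=> pT /integrableP[mf foo]; apply/integrableP; split.
  by apply: measurableT_comp => //; exact: pT.1.
rewrite /= (ge0_integral_preserves (f := abse \o f))//.
- exact: measurableT_comp.
- by move=> x /=.
Qed.

Lemma integral_preserves T (f : Rn -> \bar R) : preserves_leb T ->
  leb.-integrable setT f ->
  (\int[leb]_x f (T x) = \int[leb]_x f x)%E.
Proof.
move=> pT fi; have [mT eT] := pT.
have /integrableP[mf _] := fi.
have := @integral_pushforward _ _ _ _ R T mT leb setT f mf.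
rewrite preimage_setT => /(_ (integrable_preserves pT fi) measurableT) <-.
by apply: eq_measure_integral => A mA _; exact: eT.
Qed.

Lemma integral_indic_shift (A : set Rn) a : measurable A ->
  (\int[leb]_x (\1_A (x + a))%:E = leb A)%E.
Proof.
move=> mA.
have mA' : measurable_fun setT (fun y : Rn => (\1_A y : R)%:E).
  exact/measurable_EFinP/measurable_indic.
have := ge0_integral_preserves (preserves_leb_shift a) mA'.
rewrite /= => ->; last by move=> x; rewrite lee_fin.
by rewrite integral_indic// setIT.
Qed.

Lemma measurable_oppV : measurable_fun setT (fun x : Rn => - x).
Proof.
apply: measurable_fun_rVP => i; under eq_fun do rewrite mxE.
by apply: measurableT_comp => //; exact: measurable_coord.
Qed.

(** The uniqueness argument for Haar measure: integrate
    1_A(T x) 1_B(y - T x) over x and y in both orders, shifting x by a preimage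
    of y. Applied to a ball [B] it shows that an invertible additive map
    multiplies volumes by a constant, with no determinant involved. *)
Lemma lebesgue_additive_map (T S : Rn -> Rn) (A B : set Rn) :
  {morph T : x y / x + y} -> cancel S T -> measurable_fun setT T ->
  measurable A -> measurable B ->
  (leb (T @^-1` A) * leb B =
   leb A * leb (T @^-1` ((fun x => (- x)%R) @^-1` B)))%E.
Proof.
move=> TD ST mT mA mB.
have T0 : T 0 = 0 by apply: (addrI (T 0)); rewrite -TD !addr0.
have TN x : T (- x) = - T x by apply: (addrI (T x)); rewrite -TD !subrr T0.
have mTA : measurable (T @^-1` A) by rewrite -[X in measurable X]setTI; exact: mT.
have mNB : measurable ((fun x : Rn => - x) @^-1` B).
  by rewrite -[X in measurable X]setTI; exact: measurable_oppV.
have mTNB : measurable (T @^-1` ((fun x => - x) @^-1` B)).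
  by rewrite -[X in measurable X]setTI; exact: mT.
have m1 : measurable_fun setT (fun z : Rn * Rn => T z.1).
  by apply: measurableT_comp => //.
have m2 : measurable_fun setT (fun z : Rn * Rn => z.2 - T z.1).
  apply: measurable_fun_rVP => i; under eq_fun do rewrite !mxE.
  apply: measurable_funB; apply: (measurableT_comp (measurable_coord i)) => //.
have m3 : measurable_fun setT (fun z : Rn * Rn => T z.1 + z.2).
  apply: measurable_fun_rVP => i; under eq_fun do rewrite !mxE.
  apply: measurable_funD; apply: (measurableT_comp (measurable_coord i)) => //.
have m4 : measurable_fun setT (fun z : Rn * Rn => - T z.1).
  apply: measurable_fun_rVP => i; under eq_fun do rewrite !mxE.
  by apply: measurableT_comp => //; apply: (measurableT_comp (measurable_coord i)) => //.
pose f (z : Rn * Rn) : \bar R := (\1_A (T z.1) * \1_B (z.2 - T z.1))%:E.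
pose g (z : Rn * Rn) : \bar R := (\1_A (T z.1 + z.2) * \1_B (- T z.1))%:E.
have mf : measurable_fun setT f.
  apply/measurable_EFinP; apply: measurable_funM.
    by apply: (measurableT_comp (measurable_indic mA)).
  by apply: (measurableT_comp (measurable_indic mB)).
have mg : measurable_fun setT g.
  apply/measurable_EFinP; apply: measurable_funM.
    by apply: (measurableT_comp (measurable_indic mA)).
  by apply: (measurableT_comp (measurable_indic mB)).
have f0 z : (0 <= f z)%E by rewrite lee_fin mulr_ge0.
have g0 z : (0 <= g z)%E by rewrite lee_fin mulr_ge0.
transitivity (\int[leb]_x \int[leb]_y f (x, y))%E.
  have inner x : (\int[leb]_y f (x, y) = (\1_A (T x))%:E * leb B)%E.
    rewrite /f/=; under eq_integral do rewrite EFinM.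
    rewrite ge0_integralZl//; last first.
      apply/measurable_EFinP; apply: (measurableT_comp (measurable_indic mB)).
      exact: measurable_addrV.
    by rewrite integral_indic_shift.
  under eq_integral do rewrite inner.
  rewrite ge0_integralZr//; last first.
    by apply/measurable_EFinP; apply: (measurableT_comp (measurable_indic mA)).
  by rewrite integral_indic// setIT.
rewrite fubini_tonelli//.
transitivity (\int[leb]_y \int[leb]_x g (x, y))%E.
  apply: eq_integral => y _.
  rewrite -(ge0_integral_preserves (T := fun x => x + S y) (f := fun x => f (x, y)))//.
  + apply: eq_integral => x _.
    by rewrite /f /g /= TD ST opprD addrCA subrr addr0.
  + exact: preserves_leb_shift.
  + exact: measurableT_comp.
rewrite -fubini_tonelli//.
transitivity (\int[leb]_x (leb A * (\1_B (- T x))%:E))%E.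
  apply: eq_integral => x _; rewrite /g/=.
  under eq_integral do rewrite EFinM.
  rewrite ge0_integralZr//; last first.
    apply/measurable_EFinP; apply: (measurableT_comp (measurable_indic mA)).
    rewrite (_ : +%R (T x) = +%R^~ (T x)); first exact: measurable_addrV.
    by apply/funext => y /=; rewrite addrC.
  under eq_integral do rewrite addrC.
  by rewrite integral_indic_shift.
rewrite ge0_integralZl//; last first.
  apply/measurable_EFinP; apply: (measurableT_comp (measurable_indic mB)).
  by apply: (measurableT_comp measurable_oppV).
by rewrite integral_indic// setIT.
Qed.

End preserving.

(** * Euclidean inner product and reflections *)

Section dot.
Context {R : realType} {n : nat}.
Local Notation Rn := 'rV[R]_n.
Implicit Types x y v : Rn.

Definition dot x y : R := \sum_i x ord0 i * y ord0 i.

Lemma dotC x y : dot x y = dot y x.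
Proof. by apply: eq_bigr => i _; rewrite mulrC. Qed.

Lemma dotDl x y z : dot (x + y) z = dot x z + dot y z.
Proof. by rewrite -big_split; apply: eq_bigr => i _; rewrite mxE mulrDl. Qed.

Lemma dotZl a x z : dot (a *: x) z = a * dot x z.
Proof. by rewrite /dot mulr_sumr; apply: eq_bigr => i _; rewrite mxE mulrA. Qed.

Lemma dotZr a x z : dot x (a *: z) = a * dot x z.
Proof. by rewrite dotC dotZl dotC. Qed.

Lemma dotDr x y z : dot x (y + z) = dot x y + dot x z.
Proof. by rewrite dotC dotDl !(dotC x). Qed.

Lemma dotNr x y : dot x (- y) = - dot x y.
Proof. by rewrite -scaleN1r dotZr mulN1r. Qed.

Lemma dotBr x y z : dot x (y - z) = dot x y - dot x z.
Proof. by rewrite dotDr dotNr. Qed.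

Lemma dotBl x y z : dot (x - y) z = dot x z - dot y z.
Proof. by rewrite dotC dotBr !(dotC z). Qed.

Lemma dot_delta x i : dot x (delta_mx ord0 i) = x ord0 i.
Proof.
rewrite /dot (bigD1 i)//= big1 ?addr0; first by rewrite mxE !eqxx mulr1.
by move=> j ji; rewrite mxE (negbTE ji) andbF mulr0.
Qed.

Lemma dot_ge0 x : 0 <= dot x x.
Proof. by apply: sumr_ge0 => i _; rewrite -expr2 sqr_ge0. Qed.

Lemma enorm_dot x : enorm x = Num.sqrt (dot x x).
Proof. by congr Num.sqrt; apply: eq_bigr => i _; rewrite expr2. Qed.

Lemma sqr_enorm x : enorm x ^+ 2 = dot x x.
Proof. by rewrite enorm_dot sqr_sqrtr// dot_ge0. Qed.

Lemma enorm_ge0 x : 0 <= enorm x.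
Proof. exact: sqrtr_ge0. Qed.

Lemma dot_eq0 x : (dot x x == 0) = (x == 0).
Proof.
apply/eqP/eqP => [|->]; last by rewrite /dot big1// => i _; rewrite mxE mul0r.
move=> /eqP; rewrite psumr_eq0; last by move=> i _; rewrite -expr2 sqr_ge0.
move=> /allP x0; apply/rowP => i; rewrite mxE.
by have := x0 i (mem_index_enum _) => /=; rewrite -expr2 sqrf_eq0 => /eqP.
Qed.

Lemma enorm_eq0 x : (enorm x == 0) = (x == 0).
Proof. by rewrite -sqrf_eq0 sqr_enorm dot_eq0. Qed.

Lemma enorm_gt0 x : (0 < enorm x) = (x != 0).
Proof. by rewrite lt0r enorm_eq0 enorm_ge0 andbT. Qed.

Lemma enorm0 : enorm (0 : Rn) = 0.
Proof. by apply/eqP; rewrite enorm_eq0. Qed.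

Lemma enormZ a x : enorm (a *: x) = `|a| * enorm x.
Proof.
by rewrite !enorm_dot dotZl dotZr mulrA -expr2 sqrtrM ?sqr_ge0// sqrtr_sqr.
Qed.

Lemma enormN x : enorm (- x) = enorm x.
Proof. by rewrite -scaleN1r enormZ normrN1 mul1r. Qed.

Lemma enorm_delta i : enorm (delta_mx ord0 i : Rn) = 1.
Proof. by rewrite enorm_dot dot_delta mxE !eqxx sqrtr1. Qed.

Lemma le_coord_enorm x i : `|x ord0 i| <= enorm x.
Proof.
rewrite -sqrtr_sqr ler_wsqrtr// (bigD1 i)//= lerDl.
by apply: sumr_ge0 => j _; rewrite sqr_ge0.
Qed.

Lemma norm_le_enorm x : `|x| <= enorm x.
Proof.
rewrite -[`|x|]/(mx_norm x) mx_normrE; apply: bigmax_le => [|[i j] _ /=].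
  exact: enorm_ge0.
by rewrite (ord1 i) le_coord_enorm.
Qed.

Lemma le_coord_norm x i : `|x ord0 i| <= `|x|.
Proof.
rewrite -[`|x|]/(mx_norm x) mx_normrE.
exact: (@le_bigmax _ _ _ _ (fun ij : 'I_1 * 'I_n => `|x ij.1 ij.2|) (ord0, i)).
Qed.

Lemma enorm_le_norm x : enorm x <= n%:R * `|x|.
Proof.
rewrite enorm_dot -[leRHS]ger0_norm ?mulr_ge0// -sqrtr_sqr ler_wsqrtr//.
rewrite exprMn; apply: (@le_trans _ _ (\sum_(i < n) `|x| ^+ 2)).
  apply: ler_sum => i _; rewrite -expr2 -real_normK ?num_real//.
  by rewrite lerXn2r ?nnegrE// le_coord_norm.
rewrite sumr_const card_ord -[leLHS]mulr_natl; apply: ler_wpM2r; first exact: sqr_ge0.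
by rewrite -natrX ler_nat expnS expn1; case: (n) => // m; rewrite leq_pmulr.
Qed.

Lemma dot_le x y : `|dot x y| <= enorm x * enorm y.
Proof.
rewrite -[leRHS]ger0_norm ?mulr_ge0 ?enorm_ge0// -ler_sqr ?nnegrE//.
rewrite !real_normK ?num_real// exprMn !sqr_enorm.
have [->|y0] := eqVneq y 0.
  by rewrite -(scale0r (0 : Rn)) !dotZr !mul0r mulr0 expr0n.
have yy : 0 < dot y y by rewrite lt0r dot_eq0 y0 dot_ge0.
have := dot_ge0 (dot y y *: x - dot x y *: y).
rewrite !(dotBl, dotBr, dotZl, dotZr) (dotC y x) => h.
rewrite -(ler_pM2l yy); lra.
Qed.

Lemma measurable_dot a : measurable_fun setT (dot a).
Proof.
apply: measurable_sum => i; apply: measurable_funM => //.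
exact: measurable_coord.
Qed.

Lemma measurable_dot2 d (T : measurableType d) (f g : T -> Rn) :
  measurable_fun setT f -> measurable_fun setT g ->
  measurable_fun setT (fun t => dot (f t) (g t)).
Proof.
move=> mf mg; apply: measurable_sum => i; apply: measurable_funM.
  by apply: (measurableT_comp (measurable_coord i)).
by apply: (measurableT_comp (measurable_coord i)).
Qed.

Lemma measurable_addV d (T : measurableType d) (f g : T -> Rn) :
  measurable_fun setT f -> measurable_fun setT g ->
  measurable_fun setT (fun t => f t + g t).
Proof.
move=> mf mg; apply: measurable_fun_rVP => i; under eq_fun do rewrite mxE.
apply: measurable_funD; first by apply: (measurableT_comp (measurable_coord i)).
by apply: (measurableT_comp (measurable_coord i)).
Qed.

Lemma measurable_subV d (T : measurableType d) (f g : T -> Rn) :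
  measurable_fun setT f -> measurable_fun setT g ->
  measurable_fun setT (fun t => f t - g t).
Proof.
move=> mf mg; apply: measurable_addV => //.
exact: (measurableT_comp measurable_oppV).
Qed.

Lemma measurable_scaleV d (T : measurableType d) (f : T -> R) (g : T -> Rn) :
  measurable_fun setT f -> measurable_fun setT g ->
  measurable_fun setT (fun t => f t *: g t).
Proof.
move=> mf mg; apply: measurable_fun_rVP => i; under eq_fun do rewrite mxE.
apply: measurable_funM => //.
by apply: (measurableT_comp (measurable_coord i)).
Qed.

Definition reflect_along v x := x - (2 * dot x v / dot v v) *: v.

Lemma reflectD v : {morph reflect_along v : x y / x + y}.
Proof.
move=> x y; rewrite /reflect_along dotDl mulrDr mulrDl scalerDl.
by rewrite opprD addrACA.
Qed.

Lemma reflectK v : v != 0 -> cancel (reflect_along v) (reflect_along v).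
Proof.
rewrite -dot_eq0 => v0 x; rewrite /reflect_along dotBl dotZl -addrA -opprD -scalerDl.
set c := (X in X *: v); have -> : c = 0 by rewrite /c; field.
by rewrite scale0r subr0.
Qed.

Lemma dot_reflect v x y : dot (reflect_along v x) y = dot x (reflect_along v y).
Proof.
rewrite dotBl dotBr dotZl dotZr (dotC v y) (dotC x v); congr (_ - _).
by ring.
Qed.

Lemma enorm_reflect v x : v != 0 -> enorm (reflect_along v x) = enorm x.
Proof. by move=> v0; rewrite !enorm_dot dot_reflect reflectK. Qed.

Lemma measurable_reflect v : measurable_fun setT (reflect_along v).
Proof.
apply: measurable_subV => //; apply: measurable_scaleV => //.
apply: measurable_funM => //; apply: measurable_funM => //.
by under eq_fun do rewrite dotC; exact: measurable_dot.
Qed.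

(** Any vector is carried to any other of the same norm by a reflection, so
    reflections alone give the rotational symmetry of radial integrals. *)
Lemma reflect_swap a b : a != b -> enorm a = enorm b ->
  reflect_along (a - b) a = b.
Proof.
move=> ab eab; have : dot a a = dot b b by rewrite -!sqr_enorm eab.
move=> dab; rewrite /reflect_along.
have d0 : dot (a - b) (a - b) != 0 by rewrite dot_eq0 subr_eq0.
have -> : 2 * dot a (a - b) = dot (a - b) (a - b).
  by rewrite !(dotBr, dotBl) (dotC b a) -dab; ring.
by rewrite divff// scale1r opprB addrCA subrr addr0.
Qed.

End dot.

(** * Balls, isometries and dilations *)

(** Lets a positive finite volume be cancelled between possibly infinite
    quantities. *)
Lemma mule_finI (R : realType) (x y b : \bar R) : (0 < b)%E -> (b < +oo)%E ->
  (x * b = y * b)%E -> x = y.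
Proof.
case: b => [r| |]//; rewrite lte_fin => r0 _ e.
have K z : (z * r%:E * r^-1%:E = z)%E.
  by rewrite -muleA -EFinM divff ?gt_eqF// mule1.
by rewrite -(K x) e K.
Qed.

Section balls.
Context {R : realType} {n : nat}.
Local Notation Rn := 'rV[R]_n.
Local Notation leb := (@lebesgue_rV R n).
Implicit Types x y v : Rn.

Lemma cube_measure (x : Rn) (r : R) : 0 < r ->
  measurable [set y : Rn | forall i, y ord0 i \in `]x ord0 i - r, x ord0 i + r[] /\
  leb [set y : Rn | forall i, y ord0 i \in `]x ord0 i - r, x ord0 i + r[] =
    ((2 * r) ^+ n)%:E.
Proof.
move=> r0.
pose A (i : 'I_n) : set (measurableTypeR R) := `]x ord0 i - r, x ord0 i + r[%classic.
split; first by apply: (@measurable_box R n A) => i; exact: measurable_itv.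
rewrite (@lebesgue_rV_box R n A); last by move=> i; exact: measurable_itv.
under eq_bigr => i _.
  rewrite /A lebesgue_measure_itv/= lte_fin ifT; last lra.
  rewrite -EFinB (_ : _ - _ = 2 * r); last ring.
  over.
by rewrite -(big_morph EFin (@EFinM R) (erefl 1%E)) prodr_const card_ord.
Qed.

Lemma measurable_eball r : measurable [set x : Rn | enorm x <= r].
Proof.
rewrite (_ : [set x : Rn | _] = @enorm R n @^-1` `]-oo, r]); last first.
  by apply/seteqP; split => x /=; rewrite in_itv.
by rewrite -[X in measurable X]setTI; exact: measurable_enorm.
Qed.

Lemma measurable_setenorm (P : set (measurableTypeR R)) : measurable P ->
  measurable [set x : Rn | P (enorm x)].
Proof.
by move=> mP; rewrite -[X in measurable X]setTI; exact: measurable_enorm.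
Qed.

Lemma eball_fin r : (leb [set x : Rn | (enorm x <= r)%R] < +oo)%E.
Proof.
have r0 : 0 < `|r| + 1 by rewrite ltr_wpDl.
have [mC eC] := cube_measure 0 r0.
apply: (@le_lt_trans _ _ (((2 * (`|r| + 1)) ^+ n)%:E)); last exact: ltry.
rewrite -eC; apply: le_measure; rewrite ?inE//; first exact: measurable_eball.
move=> x /= xr i; rewrite in_itv/= mxE sub0r add0r -ltr_norml.
by rewrite (le_lt_trans (le_coord_enorm x i))// (le_lt_trans xr)// (le_lt_trans (ler_norm _))// ltrDl.
Qed.

Lemma eball_pos r : 0 < r -> (0 < leb [set x : Rn | (enorm x <= r)%R])%E.
Proof.
move=> r0; have s0 : 0 < r / n.+1%:R by rewrite divr_gt0.
have [mC eC] := cube_measure 0 s0.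
apply: (@lt_le_trans _ _ (((2 * (r / n.+1%:R)) ^+ n)%:E)).
  by rewrite lte_fin exprn_gt0// mulr_gt0.
rewrite -eC; apply: le_measure; rewrite ?inE//; first exact: measurable_eball.
move=> x /= xr; rewrite (le_trans (enorm_le_norm x))//.
apply: (@le_trans _ _ (n%:R * (r / n.+1%:R))).
  rewrite ler_wpM2l// -[`|x|]/(mx_norm x) mx_normrE; apply: bigmax_le.
    exact: ltW.
  move=> [i j] _ /=; rewrite (ord1 i); have := xr j.
  by rewrite in_itv/= mxE sub0r add0r -ltr_norml => /ltW.
rewrite mulrCA; apply: ler_piMr; first exact: ltW.
by rewrite ler_pdivrMr// mul1r ler_nat.
Qed.

(** The constant supplied by [lebesgue_additive_map] is 1, as seen on the unit
    ball, which an isometry preserves. *)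
Lemma preserves_leb_isometry (T S : Rn -> Rn) :
  {morph T : x y / x + y} -> cancel S T -> measurable_fun setT T ->
  (forall x, enorm (T x) = enorm x) -> preserves_leb T.
Proof.
move=> TD ST mT eT; split => // A mA.
have := lebesgue_additive_map TD ST mT mA (measurable_eball 1).
have -> : T @^-1` ((fun x => - x) @^-1` [set x | enorm x <= 1]) =
    [set x | enorm x <= 1].
  by apply/seteqP; split => x /=; rewrite enormN eT.
set b := leb [set x : Rn | (enorm x <= 1)%R]; have b0 : (0 < b)%E by apply: eball_pos.
have boo : (b < +oo)%E by exact: eball_fin.
exact: mule_finI.
Qed.

Lemma preserves_leb_opp : preserves_leb (fun x : Rn => - x).
Proof.
apply: (@preserves_leb_isometry _ (fun x => - x)).
- by move=> x y; rewrite opprD.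
- exact: opprK.
- exact: measurable_oppV.
- exact: enormN.
Qed.

Lemma preserves_leb_reflect v : v != 0 -> preserves_leb (reflect_along v).
Proof.
move=> v0; apply: (@preserves_leb_isometry _ (reflect_along v)).
- exact: reflectD.
- exact: reflectK.
- exact: measurable_reflect.
- by move=> x; exact: enorm_reflect.
Qed.

Lemma ge0_integral_sub (f : Rn -> \bar R) x : measurable_fun setT f ->
  (forall y, 0 <= f y)%E ->
  (\int[leb]_y f (x - y)%R = \int[leb]_y f y)%E.
Proof.
move=> mf f0.
have mx : measurable_fun setT (fun y => f (y + x)).
  by apply: measurableT_comp => //; exact: measurable_addrV.
have := ge0_integral_preserves preserves_leb_opp mx (fun y => f0 _).
rewrite (ge0_integral_preserves (preserves_leb_shift x) mf f0) => <-.
by apply: eq_integral => y _; rewrite addrC.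
Qed.

(** The constant is the ratio of the volumes of two balls. Both
    sides of the limit for a rescaled function carry it, and it cancels there. *)
Lemma lebesgue_dilation tau : 0 < tau -> exists2 c : R, 0 < c &
  forall f : Rn -> \bar R, measurable_fun setT f -> (forall x, 0 <= f x)%E ->
  (\int[leb]_x f (tau *: x) = c%:E * \int[leb]_x f x)%E.
Proof.
move=> t0; pose T x : Rn := tau *: x.
have mT : measurable_fun setT T by apply: measurable_scaleV.
have TD : {morph T : x y / x + y} by move=> x y; rewrite /T scalerDr.
have ST : cancel (fun x => tau^-1 *: x) T.
  by move=> x; rewrite /T scalerA divff ?scale1r ?gt_eqF.
pose b r := leb [set x : Rn | (enorm x <= r)%R].
have bfin r : b r \is a fin_num by rewrite ge0_fin_numE// eball_fin.
have TA A : measurable A -> leb (T @^-1` A) = ((fine (b tau^-1) / fine (b 1))%:E * leb A)%E.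
  move=> mA; have := lebesgue_additive_map TD ST mT mA (measurable_eball 1).
  have -> : T @^-1` ((fun x => - x) @^-1` [set x | enorm x <= 1]) =
      [set x | enorm x <= tau^-1].
    by apply/seteqP; split => x /=;
      rewrite enormN enormZ gtr0_norm// -ler_pdivlMl// mulr1.
  have b1 : 0 < fine (b 1) by rewrite fine_gt0// eball_pos//= eball_fin.
  rewrite -/(b 1) -/(b tau^-1).
  move=> e; apply: (@mule_finI _ _ _ (b 1)); rewrite ?eball_pos ?eball_fin//.
  rewrite e -[b 1]fineK// -[b tau^-1]fineK// muleAC -EFinM.
  by rewrite divfK ?gt_eqF// muleC.
have c0 : 0 < fine (b tau^-1) / fine (b 1).
  rewrite divr_gt0// fine_gt0//.
    by rewrite eball_fin andbT eball_pos// invr_gt0.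
  by rewrite eball_fin andbT eball_pos.
exists (fine (b tau^-1) / fine (b 1)) => // f mf f0.
have := @ge0_integral_pushforward _ _ _ _ R T mT leb setT f measurableT mf (fun x _ => f0 x).
rewrite preimage_setT => <-.
have -> : (\int[pushforward leb T]_(y in setT) f y =
   \int[mscale (NngNum (ltW c0)) leb]_(y in setT) f y)%E.
  by apply: eq_measure_integral => A mA _; rewrite /= /pushforward TA.
by rewrite ge0_integral_mscale.
Qed.

Lemma ball_rVP (x y : Rn) (r : R) : 0 < r ->
  ball x r y <-> forall i, y ord0 i \in `]x ord0 i - r, x ord0 i + r[.
Proof.
move=> r0; rewrite -ball_normE/=; split => [xy i|h].
  have := le_lt_trans (le_coord_norm (x - y) i) xy.
  rewrite !mxE in_itv/= ltr_norml => /andP[a b].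
  by apply/andP; split; lra.
rewrite -[`|_|]/(mx_norm (x - y)) mx_normrE; apply/bigmax_ltP; split => //.
move=> [i j] _ /=; rewrite (ord1 i) !mxE; have := h j.
by rewrite in_itv/= ltr_norml => /andP[a b]; apply/andP; split; lra.
Qed.

Lemma measurable_ball_rV (x : Rn) (r : R) : 0 < r -> measurable (ball x r).
Proof.
move=> r0; have [mC _] := cube_measure x r0.
rewrite (_ : ball x r = [set y : Rn | forall i, y ord0 i \in `]x ord0 i - r, x ord0 i + r[])//.
by apply/seteqP; split => y /=; rewrite ball_rVP.
Qed.

(** An open set is the countable union of the balls with rational centre and
    radius 1/k that it contains. *)
Lemma measurable_open_rV (U : set Rn) : open U -> measurable U.
Proof.
move=> oU.
pose q (z : 'rV[rat]_n * nat) : Rn := \row_i ratr (z.1 ord0 i).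
pose F (z : 'rV[rat]_n * nat) : set Rn :=
  if pselect (ball (q z) (z.2.+1%:R^-1) `<=` U) then ball (q z) (z.2.+1%:R^-1) else set0.
have -> : U = \bigcup_z F z.
  apply/seteqP; split => [x Ux|x [z _]]; last first.
    by rewrite /F; case: pselect => // h /h.
  have [e /= e0 xe] : nbhs_ball x U by rewrite nbhs_ballE; exact: open_nbhs_nbhs.
  have [k ke] : exists k : nat, k.+1%:R^-1 < e / 2.
    have [k _ /(_ k (leqnn k)) /=] := near_infty_natSinv_lt (PosNum (divr_gt0 e0 (ltr0n _ 2))).
    by exists k.
  have kp : 0 < k.+1%:R^-1 :> R by rewrite invr_gt0.
  have /choice[f fP] : forall i, exists r : rat,
      ratr r \in `]x ord0 i - k.+1%:R^-1, x ord0 i + k.+1%:R^-1[.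
    by move=> i; apply: rat_in_itvoo; rewrite ltrBlDr -addrA ltrDl addr_gt0.
  pose z := (\row_i f i : 'rV[rat]_n, k).
  have xz : ball (q z) (z.2.+1%:R^-1) x.
    rewrite ball_rVP// => i; rewrite !mxE; have := fP i.
    rewrite !in_itv/= /z/=; set t := k.+1%:R^-1 => /andP[a b].
    by apply/andP; split; lra.
  exists z => //; rewrite /F; case: pselect => // -[] y yz; apply: xe.
  rewrite [e]splitr; apply: (@ball_triangle _ _ (q z)).
    by apply: ball_sym; apply: le_ball xz; exact: ltW.
  by apply: le_ball yz; exact: ltW.
apply: countable_bigcupT_measurable; first exact: countableP.
move=> z; rewrite /F; case: pselect => // ?; last exact: measurable0.
by apply: measurable_ball_rV; rewrite invr_gt0.
Qed.

Lemma continuous_measurable_rV (f : Rn -> R) : continuous f ->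
  measurable_fun setT f.
Proof.
move=> cf; apply: (measurability _ (RGenOInfty.measurableE R)).
move=> _ [_ [a ->] <-]; rewrite setTI; apply: measurable_open_rV.
by apply: open_comp => //= x _; exact: cf.
Qed.

End balls.

(** * Smooth functions *)

Section chi.
Context {R : realType}.

(** The case m = 0 is the standard flat function exp(-1/t) on t > 0; its
    derivatives are combinations of the [chi m], which makes the family closed
    under differentiation. *)
Definition chi (m : nat) (t : R) : R :=
  if 0 < t then t^-1 ^+ m * expR (- t^-1) else 0.

Lemma chi_ge0 m t : 0 <= chi m t.
Proof.
by rewrite /chi; case: ifP => // t0; rewrite mulr_ge0// ?exprn_ge0 ?invr_ge0 ?expR_ge0// ltW.
Qed.

Lemma chi0_le1 t : chi 0 t <= 1.
Proof.
rewrite /chi expr0 mul1r; case: ifP => // t0.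
by rewrite expR_le1 oppr_le0 invr_ge0 ltW.
Qed.

Lemma chi0_gt0 t : 0 < t -> 0 < chi 0 t.
Proof. by move=> t0; rewrite /chi t0 expr0 mul1r expR_gt0. Qed.

Lemma chi_le0 m t : t <= 0 -> chi m t = 0.
Proof. by rewrite /chi leNgt => /negbTE ->. Qed.

(** Powers of 1/t grow slower than exp(1/t). The difference quotient of [chi m]
    at 0 is [chi m.+1], so this linear bound shows that the derivative at 0 is 0. *)
Lemma chi_le m t : chi m t <= m.+1`!%:R * `|t|.
Proof.
rewrite /chi; case: ifPn => [t0|_]; last by rewrite mulr_ge0.
have it0 : 0 < t^-1 by rewrite invr_gt0.
have := expR_ge1Dxn m (ltW it0).
set F : R := m.+1`!%:R; have F0 : 0 < F by rewrite ltr0n fact_gt0.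
move=> h.
have {}h : t^-1 ^+ m.+1 / F <= expR t^-1 by apply: le_trans h; rewrite lerDr.
rewrite expRN gtr0_norm// ler_pdivrMr ?expR_gt0//.
have -> : t^-1 ^+ m = F * t * (t^-1 ^+ m.+1 / F).
  by rewrite exprS; field; rewrite !gt_eqF.
by apply: ler_wpM2l => //; rewrite mulr_ge0 ?ltW.
Qed.

Lemma chi_shift m t : 0 < t -> t^-1 * chi m t = chi m.+1 t.
Proof. by move=> t0; rewrite /chi t0 exprS mulrA. Qed.

Lemma is_derive_chi m t :
  is_derive t (1 : R) (chi m) (chi m.+2 t - m%:R * chi m.+1 t).
Proof.
have [t0|t0|->] := ltgtP t 0.
- apply: (@near_eq_is_derive _ _ _ (cst 0)).
    by near=> s; rewrite chi_le0// ltW//; near: s; exact: lt_nbhsl.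
  by rewrite !chi_le0 ?ltW// mulr0 subr0; exact: is_derive_cst.
- apply: (@near_eq_is_derive _ _ _ (fun s : R => s^-1 ^+ m * expR (- s^-1) : R)).
    by near=> s; rewrite /chi ifT//; near: s; exact: lt_nbhsr.
  have t_neq0 : t != 0 by rewrite gt_eqF.
  have dg : is_derive t (1 : R) (fun s : R => s^-1) (- t^-1 ^+ 2).
    by apply: is_derive_eq; [exact: is_deriveV | rewrite /GRing.scale/= mulr1 exprVn].
  have de : is_derive t (1 : R) (fun s : R => expR (- s^-1)) (expR (- t^-1) * t^-1 ^+ 2).
    have := @is_derive1_comp _ expR (fun s : R => - s^-1) t _ _ (is_derive_expR _) (is_deriveN dg).
    by rewrite opprK.
  have := is_deriveM (is_deriveX m dg) de.
  rewrite (_ : _ * _ = fun s => s^-1 ^+ m * expR (- s^-1)); last first.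
    by apply/funext => s; rewrite mulrfctE exprfctE.
  move=> /is_derive_eq; apply.
  rewrite exprfctE /GRing.scale/= /chi t0; case: (m) => [|k].
    by rewrite !mul0r subr0 mulr0 addr0 expr0 mul1r mulrC.
  by rewrite succnK !exprS; ring.
- rewrite !chi_le0// mulr0 subr0.
  have c : (fun h : R => h^-1 *: ((chi m \o shift (0 : R)) (h *: (1 : R)) - chi m 0)) @ 0^' --> (0 : R).
    have F0 : 0 < m.+2`!%:R :> R by rewrite ltr0n fact_gt0.
    apply/cvgr0Pnorm_lt => e e0; near=> h.
    rewrite /= /GRing.scale/= mulr1 addr0 (chi_le0 _ (lexx 0)) subr0.
    have [h0|h0] := ltP 0 h; last by rewrite chi_le0// mulr0 normr0.
    rewrite chi_shift// ger0_norm ?chi_ge0//.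
    apply: le_lt_trans (chi_le _ _) _; rewrite mulrC -ltr_pdivlMr//.
    by near: h; apply: dnbhs0_lt; exact: divr_gt0.
  by apply: DeriveDef; [exact: (cvgP _ c) | exact: (cvg_lim _ c)].
Unshelve. all: by end_near. Qed.

End chi.

Section smooth_functions.
Context {R : realType} {n : nat}.
Local Notation Rn := 'rV[R]_n.
Local Notation e_ i := (delta_mx ord0 i : Rn).
Implicit Types (x y : Rn) (u v phi : Rn -> R).

Lemma smooth_continuous u : smooth u -> continuous u.
Proof. by move=> /(_ [::])[]. Qed.

Lemma smooth_derivable u : smooth u -> forall i x, derivable u x (e_ i).
Proof. by move=> /(_ [::])[]. Qed.

Lemma smooth_partial u i : smooth u -> smooth (partial i u).
Proof. by move=> su s; have := su (rcons s i); rewrite foldr_rcons. Qed.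

(** Smoothness quantifies over all words of directions; a family of functions
    stable under partial derivatives only has to be checked one step deep. *)
Lemma smooth_coind (P : (Rn -> R) -> Prop) :
  (forall v, P v -> [/\ continuous v, forall i x, derivable v x (e_ i) &
    forall i, P (partial i v)]) ->
  forall u, P u -> smooth u.
Proof.
move=> HP u Pu s; suff /HP[] : P (foldr (@partial R n) u s) by [].
by elim: s => //= i s /HP[_ _]; exact.
Qed.

(** The functions [chi m (a x_i + b)] are closed under partial derivatives only
    up to sums and products, so the closure is generated inductively; including
    all smooth functions gives the algebra rules for [smooth] at once. *)
Inductive smooth_gen : (Rn -> R) -> Prop :=
| gen_smooth u : smooth u -> smooth_gen u
| gen_cst c : smooth_gen (fun=> c)
| gen_chi m a b i : smooth_gen (fun x => chi m (a * x ord0 i + b))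
| gen_add u v : smooth_gen u -> smooth_gen v -> smooth_gen (u + v)
| gen_mul u v : smooth_gen u -> smooth_gen v -> smooth_gen (u * v).

Lemma is_derive_coord (f : R -> R) (df : R) (i j : 'I_n) x :
  is_derive (x ord0 j) (1 : R) f df ->
  is_derive x (e_ i) (fun y => f (y ord0 j)) ((i == j)%:R * df).
Proof.
move=> [df1 df2].
have E : (fun h : R => h^-1 *: (((fun y => f (y ord0 j)) \o shift x) (h *: (e_ i)) - f (x ord0 j))) =
  if i == j then (fun h : R => h^-1 *: ((f \o shift (x ord0 j)) (h *: (1 : R)) - f (x ord0 j)))
  else cst 0.
  apply/funext => h /=; rewrite !mxE eqxx/= eq_sym.
  case: (eqVneq i j) => [_|_] /=; first by [].
  by rewrite mulr0 add0r subrr scaler0.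
apply: DeriveDef; rewrite /derivable /derive E.
  by case: (eqVneq i j) => _; [exact: df1|exact: is_cvg_cst].
case: (eqVneq i j) => /= _; first by rewrite mul1r -df2.
by rewrite mul0r; exact: lim_cst.
Qed.

Lemma is_derive_chi_coord m a b (i j : 'I_n) x :
  is_derive x (e_ i) (fun y => chi m (a * y ord0 j + b))
   ((i == j)%:R * (a * (chi m.+2 (a * x ord0 j + b) - m%:R * chi m.+1 (a * x ord0 j + b)))).
Proof.
apply: (@is_derive_coord (fun t => chi m (a * t + b))).
have d1 : is_derive (x ord0 j) (1 : R) (fun t => a * t + b) a.
  have := is_deriveD (is_deriveZ a (is_derive_id (x ord0 j) (1 : R))) (is_derive_cst b (x ord0 j) (1 : R)).
  by rewrite addr0 /GRing.scale/= mulr1.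
have := @is_derive1_comp _ (chi m) (fun t => a * t + b) _ _ _ (is_derive_chi _ _) d1.
by rewrite mulrC.
Qed.

Lemma continuous_chi m : continuous (@chi R m).
Proof.
move=> t; apply: differentiable_continuous; apply/derivable1_diffP.
by have [] := is_derive_chi m t.
Qed.

Lemma smooth_gen_smooth u : smooth_gen u -> smooth u.
Proof.
apply: smooth_coind => {}u; elim => {u}.
- move=> u su; split; first exact: smooth_continuous.
  + exact: smooth_derivable.
  + by move=> i; apply: gen_smooth; exact: smooth_partial.
- move=> c; split; first exact: cst_continuous.
  + by move=> i x; have [] := is_derive_cst c x (e_ i).
  + move=> i; rewrite (_ : partial i _ = fun=> 0); first exact: gen_cst.
    by apply/funext => x; have [] := is_derive_cst c x (e_ i).
- move=> m a b i; split.
  + move=> x; apply: (@continuous_comp _ _ _ (fun y : Rn => a * y ord0 i + b) (chi m)); last exact: continuous_chi.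
    apply: (@cvgD _ R _ (nbhs x) _ (fun y : Rn => a * y ord0 i) (fun=> b)); last exact: cvg_cst.
    by apply: cvgMl_tmp; exact: coord_continuous.
  + by move=> j x; have [] := is_derive_chi_coord m a b j i x.
  + move=> j; rewrite (_ : partial j _ = (fun=> (j == i)%:R * a) *
      ((fun x => chi m.+2 (a * x ord0 i + b)) +
       (fun=> - m%:R) * (fun x => chi m.+1 (a * x ord0 i + b)))).
      by do ?[exact: gen_cst|exact: gen_chi|apply: gen_mul|apply: gen_add].
    apply/funext => x; rewrite /partial; have [_ ->] := is_derive_chi_coord m a b j i x.
    by rewrite !mulrfctE addrfctE mulrA mulNr.
- move=> u v gu [cu du pu] gv [cv dv pv]; split.
  + by move=> x; exact: (cvgD (cu x) (cv x)).
  + by move=> i x; exact: derivableD.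
  + move=> i; rewrite (_ : partial i _ = partial i u + partial i v).
      by apply: gen_add; [exact: pu | exact: pv].
    by apply/funext => x; rewrite /partial deriveD.
- move=> u v gu [cu du pu] gv [cv dv pv]; split.
  + by move=> x; exact: (cvgM (cu x) (cv x)).
  + by move=> i x; exact: derivableM.
  + move=> i; rewrite (_ : partial i _ = u * partial i v + v * partial i u).
      by apply: gen_add; apply: gen_mul.
    by apply/funext => x; rewrite /partial deriveM.
Qed.

Lemma smooth_cst c : smooth (fun _ : Rn => c).
Proof. exact/smooth_gen_smooth/gen_cst. Qed.

Lemma smooth_chi m a b i : smooth (fun x : Rn => chi m (a * x ord0 i + b)).
Proof. exact/smooth_gen_smooth/gen_chi. Qed.

Lemma smoothD u v : smooth u -> smooth v -> smooth (fun x => u x + v x).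
Proof. by move=> su sv; apply: smooth_gen_smooth; apply: gen_add; apply: gen_smooth. Qed.

Lemma smoothM u v : smooth u -> smooth v -> smooth (fun x => u x * v x).
Proof. by move=> su sv; apply: smooth_gen_smooth; apply: gen_mul; apply: gen_smooth. Qed.

Lemma smooth_prod (I : Type) (s : seq I) (f : I -> Rn -> R) :
  (forall i, smooth (f i)) -> smooth (fun x => \prod_(i <- s) f i x).
Proof.
move=> sf; elim: s => [|i s IH].
  rewrite (_ : (fun x => _) = fun=> 1); first exact: smooth_cst.
  by apply/funext => x; rewrite big_nil.
rewrite (_ : (fun x => _) = fun x => f i x * \prod_(j <- s) f j x).
  exact: (smoothM (sf i) IH).
by apply/funext => x; rewrite big_cons.
Qed.

Lemma is_derive_dilation tau c u i x : smooth u ->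
  is_derive x (e_ i) (fun y => c * u (tau *: y)) (c * tau * partial i u (tau *: x)).
Proof.
move=> su.
have dx : is_derive x (e_ i) (fun y => u (tau *: y)) (tau * partial i u (tau *: x)).
  have [->|t0] := eqVneq tau 0.
    under eq_fun do rewrite scale0r.
    by rewrite mul0r; exact: is_derive_cst.
  have d0 : derivable u (tau *: x) (e_ i) by exact: smooth_derivable.
  have c0 : (fun h : R => h^-1 *: (((fun y => u (tau *: y)) \o shift x) (h *: e_ i) - u (tau *: x))) @ 0^' -->
     tau * partial i u (tau *: x).
    have -> : (fun h : R => h^-1 *: (((fun y => u (tau *: y)) \o shift x) (h *: e_ i) - u (tau *: x))) =
       (fun h => tau * (h^-1 *: ((u \o shift (tau *: x)) (h *: e_ i) - u (tau *: x)))) \o (fun h => tau * h).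
      apply/funext => h /=; rewrite [tau *: (_ + _)]scalerDr scalerA.
      rewrite /GRing.scale/= invfM.
      by rewrite !mulrA divff// mul1r.
    apply: (@cvg_comp _ _ _ _ _ _ (0^' : set_system R)).
      move=> A /nbhs_ballP[e /= e0 eA]; apply/nbhs_ballP.
      exists (e / `|tau|) => /=; first by rewrite divr_gt0// normr_gt0.
      move=> t; rewrite -ball_normE/= sub0r normrN => te t_neq0.
      apply: eA; last by rewrite mulf_neq0.
      by rewrite -ball_normE/= sub0r normrN normrM mulrC -ltr_pdivlMr// normr_gt0.
    by apply: cvgMl_tmp; exact: d0.
  by apply: DeriveDef; [exact: (cvgP _ c0) | exact: (cvg_lim _ c0)].
have := is_deriveZ c dx; rewrite /GRing.scale/= mulrA; exact.
Qed.

Lemma smooth_dilation tau c u : smooth u -> smooth (fun x => c * u (tau *: x)).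
Proof.
pose P (v : Rn -> R) := exists c u, smooth u /\ v = (fun x => c * u (tau *: x)).
move=> su; apply: (@smooth_coind P); last by exists c, u.
move=> _ {c u su}[c [u [su ->]]]; split.
- have cu : continuous (fun y => u (tau *: y)).
    move=> x; apply: (@continuous_comp _ _ _ (fun y => tau *: y) u).
      exact: scaler_continuous.
    exact: smooth_continuous.
  by move=> x; exact: (cvgM (cvg_cst c) (cu x)).
- by move=> i x; have [] := is_derive_dilation tau c i x su.
- move=> i; exists (c * tau), (partial i u); split; first exact: smooth_partial.
  by apply/funext => x; have [_] := is_derive_dilation tau c i x su.
Qed.

Lemma partial_dilation tau c u i x : smooth u ->
  partial i (fun x => c * u (tau *: x)) x = c * tau * partial i u (tau *: x).
Proof. by move=> su; have [_] := is_derive_dilation tau c i x su. Qed.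

End smooth_functions.

(** * Smooth functions with compact support *)

Section compact_support.
Context {R : realType} {n : nat}.
Local Notation Rn := 'rV[R]_n.
Local Notation e_ i := (delta_mx ord0 i : Rn).
Implicit Types (x y h : Rn) (u v phi : Rn -> R).

Lemma enormD x y : enorm (x + y) <= enorm x + enorm y.
Proof.
rewrite -ler_sqr ?nnegrE ?addr_ge0 ?enorm_ge0// sqrrD !sqr_enorm.
rewrite !(dotDl, dotDr) (dotC y x).
have := le_trans (ler_norm _) (dot_le x y); lra.
Qed.

Lemma Cc_support u : Cc_infty u ->
  exists2 M, 0 < M & forall x, M < enorm x -> u x = 0.
Proof.
move=> [su /compact_bounded [M [Mr HM]]].
pose M' := `|M| + 1; have MM' : M < M'.
  by rewrite (le_lt_trans (ler_norm _))// ltrDl.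
have M'0 : 0 < M' by rewrite ltr_wpDl.
exists (n.+1%:R * M') => [|x xM]; first by rewrite mulr_gt0.
apply/eqP; apply: contraTT xM => ux; rewrite -leNgt.
apply: le_trans (enorm_le_norm x) _.
have xM' : `|x| <= M' by apply: (HM _ MM'); apply: subset_closure.
by apply: ler_pM => //; rewrite ler_nat.
Qed.

(** Supports are measured with the Euclidean norm, compactness with the sup norm
    that defines the topology; the two norms are comparable. *)
Lemma CcI M u : smooth u -> (forall x, M < enorm x -> u x = 0) -> Cc_infty u.
Proof.
move=> su uM; split => //; apply: bounded_closed_compact; last exact: closed_closure.
have sub : closure [set x | u x != 0] `<=` [set x : Rn | `|x| <= M].
  have cl : closed [set x : Rn | `|x| <= M].
    rewrite (_ : [set x : Rn | _] = (fun x : Rn => `|x|) @^-1` [set r | r <= M])//.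
    by apply: closed_comp; [move=> x _; exact: norm_continuous | exact: closed_le].
  rewrite closureE; apply: smallest_sub => // x /= ux.
  apply: contraNT ux; rewrite -ltNge => Mx; apply/eqP; apply: uM.
  exact: lt_le_trans (norm_le_enorm x).
exists M; split; first exact: num_real.
by move=> r Mr x /sub /= xM; rewrite (le_trans xM)// ltW.
Qed.

Lemma Cc_smooth u : Cc_infty u -> smooth u.
Proof. by case. Qed.

Lemma Cc_bounded u : Cc_infty u -> exists2 C, 0 < C & forall x, `|u x| <= C.
Proof.
move=> [su cu].
have : compact (u @` closure [set x | u x != 0]).
  apply: continuous_compact => //; apply: continuous_subspaceT.
  exact: smooth_continuous.
move=> /compact_bounded [M [Mr HM]].
exists (`|M| + 1) => [|x]; first by rewrite ltr_wpDl.
have [->|ux] := eqVneq (u x) 0; first by rewrite normr0 addr_ge0.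
apply: (HM (`|M| + 1)); first by rewrite (le_lt_trans (ler_norm _))// ltrDl.
by exists x => //; apply: subset_closure.
Qed.

Lemma partial_out M u i : (forall x, M < enorm x -> u x = 0) ->
  forall x, M < enorm x -> partial i u x = 0.
Proof.
move=> uM x Mx; rewrite /partial.
have nM : \forall y \near x, M < enorm y.
  apply/nbhs_ballP; exists ((enorm x - M) / n.+1%:R) => /=.
    by rewrite divr_gt0// subr_gt0.
  move=> y; rewrite -ball_normE/= ltr_pdivlMr// => xy.
  have := enormD (x - y) y; rewrite subrK.
  have := enorm_le_norm (x - y).
  have : n%:R * `|x - y| <= `|x - y| * n.+1%:R by rewrite mulrC ler_wpM2l// ler_nat.
  lra.
rewrite (@near_eq_derive _ _ _ _ (cst 0)).
  by have [] := is_derive_cst (0 : R) x (e_ i).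
by apply: filterS nM => y My; exact: uM.
Qed.

Lemma Cc_partial u i : Cc_infty u -> Cc_infty (partial i u).
Proof.
move=> cu; have [M _ uM] := Cc_support cu.
apply: (@CcI M); first by apply: smooth_partial; case: cu.
exact: partial_out.
Qed.

Lemma CcM u v : Cc_infty u -> smooth v -> Cc_infty (fun x => u x * v x).
Proof.
move=> cu sv; have [M _ uM] := Cc_support cu.
apply: (@CcI M); first exact: (smoothM (Cc_smooth cu) sv).
by move=> x /uM ->; rewrite mul0r.
Qed.

Lemma CcZ c u : Cc_infty u -> Cc_infty (fun x => c * u x).
Proof.
move=> cu; have [M _ uM] := Cc_support cu.
apply: (@CcI M); first exact: (smoothM (smooth_cst c) (Cc_smooth cu)).
by move=> x /uM ->; rewrite mulr0.
Qed.

Lemma smooth_shift u a : smooth u -> smooth (fun x => u (x + a)).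
Proof.
pose P (v : Rn -> R) := exists u, smooth u /\ v = (fun x => u (x + a)).
move=> su; apply: (@smooth_coind _ _ P); last by exists u.
move=> _ {u su}[u [su ->]].
have D i x : is_derive x (e_ i) (fun y => u (y + a)) (partial i u (x + a)).
  have d0 : derivable u (x + a) (e_ i) by exact: smooth_derivable.
  have E : (fun t : R => t^-1 *: (((fun y => u (y + a)) \o shift x) (t *: e_ i) - u (x + a))) =
    (fun t : R => t^-1 *: ((u \o shift (x + a)) (t *: e_ i) - u (x + a))).
    by apply/funext => t /=; rewrite addrA.
  by apply: DeriveDef; rewrite /derivable /derive E.
split.
- move=> x; apply: (@continuous_comp _ _ _ (fun y => y + a) u).
    exact: (@cvgD _ Rn _ (nbhs x) _ id (fun=> a) _ _ cvg_id (cvg_cst a)).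
  exact: smooth_continuous.
- by move=> i x; have [] := D i x.
- move=> i; exists (partial i u); split; first exact: smooth_partial.
  by apply/funext => x; have [_] := D i x.
Qed.

Lemma Cc_shift u a : Cc_infty u -> Cc_infty (fun x => u (x + a)).
Proof.
move=> cu; have [M _ uM] := Cc_support cu.
apply: (@CcI (M + enorm a)); first exact: (@smooth_shift u a (Cc_smooth cu)).
move=> x Mx; apply: uM.
have := enormD (x + a) (- a); rewrite enormN addrK; lra.
Qed.

Lemma Cc_dilation u tau c : 0 < tau -> Cc_infty u ->
  Cc_infty (fun x => c * u (tau *: x)).
Proof.
move=> t0 cu; have [M _ uM] := Cc_support cu.
apply: (@CcI (M / tau)); first exact: (smooth_dilation _ _ (Cc_smooth cu)).
by move=> x Mx; rewrite uM ?mulr0// enormZ gtr0_norm// mulrC -ltr_pdivrMr.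
Qed.

Lemma MVT_coord u i y s : smooth u ->
  exists2 c, `|c| <= `|s| & u (y + s *: e_ i) - u y = s * partial i u (y + c *: e_ i).
Proof.
move=> su; pose g (t : R) := u (y + t *: e_ i).
have dg t : is_derive t (1 : R) g (partial i u (y + t *: e_ i)).
  have d0 : derivable u (y + t *: e_ i) (e_ i) by exact: smooth_derivable.
  have E : (fun r : R => r^-1 *: ((g \o shift t) (r *: (1 : R)) - g t)) =
    (fun r : R => r^-1 *: ((u \o shift (y + t *: e_ i)) (r *: e_ i) - u (y + t *: e_ i))).
    apply/funext => r /=; rewrite /g; congr (_ *: (u _ - _)).
    have -> : r *: (1 : R) = r by exact: mulr1.
    by rewrite scalerDl addrCA.
  by apply: DeriveDef; rewrite /derivable /derive E.
have cg : continuous g.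
  by move=> t; apply: differentiable_continuous; apply/derivable1_diffP; have [] := dg t.
have g0 : g 0 = u y by rewrite /g scale0r addr0.
have [s0|s0] := leP 0 s.
  have [c cs e] := MVT_segment s0 (fun t _ => dg t) (continuous_subspaceT cg).
  exists c; last by rewrite -g0 -/(g s) e subr0 mulrC.
  by move: cs; rewrite in_itv/= => /andP[c0 cs]; rewrite !ger0_norm.
have [c cs e] := MVT_segment (ltW s0) (fun t _ => dg t) (continuous_subspaceT cg).
exists c; last by rewrite -g0 -/(g s) -opprB e sub0r mulrN opprK mulrC.
by move: cs; rewrite in_itv/= => /andP[c0 cs]; rewrite !ler0_norm ?lerN2// ltW.
Qed.

(** Change one coordinate at a time and apply the one-variable mean value
    theorem to each step; the intermediate points stay in the box spanned by
    [x] and [x + h]. *)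
Lemma increment_partials u x h : smooth u -> exists xi : 'I_n -> Rn,
  (forall i, `|xi i - x| <= `|h|) /\
  u (x + h) - u x = \sum_i h ord0 i * partial i u (xi i).
Proof.
move=> su.
(* the path from x to x + h that follows the coordinate axes one after another *)
pose y (k : nat) : Rn := x + \row_j (if (j < k)%N then h ord0 j else 0).
have yS (i : 'I_n) : y i.+1 = y i + h ord0 i *: e_ i.
  rewrite /y -addrA; congr (_ + _); apply/rowP => j; rewrite !mxE eqxx/= ltnS.
  rewrite -val_eqE/=; case: ltngtP => //= [_|_|/val_inj ->];
  by rewrite ?mulr0 ?mulr1 ?addr0 ?add0r.
have /choice[c cP] : forall i : 'I_n, exists c, `|c| <= `|h ord0 i| /\
    u (y i.+1) - u (y i) = h ord0 i * partial i u (y i + c *: e_ i).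
  by move=> i; have [c c1 c2] := MVT_coord i (y i) (h ord0 i) su; exists c; rewrite yS.
exists (fun i : 'I_n => y i + c i *: e_ i); split.
  move=> i; rewrite [y i + _]addrC /y [x + _]addrC addrA addrK.
  rewrite -[leLHS]/(mx_norm _) mx_normrE; apply: bigmax_le => // -[a j] _ /=.
  rewrite (ord1 a) !mxE eqxx/= -val_eqE/=; case: ltngtP => [_|_|ji].
  + by rewrite mulr0 add0r le_coord_norm.
  + by rewrite mulr0 add0r normr0.
  + by rewrite mulr1 addr0 (le_trans (cP i).1)// le_coord_norm.
rewrite -(eq_bigr _ (fun i _ => (cP i).2)).
rewrite -(big_mkord xpredT (fun k : nat => u (y k.+1) - u (y k))) telescope_sumr//.
congr (u _ - u _); rewrite /y; last first.
  by rewrite [X in x + X](_ : _ = 0) ?addr0//; apply/rowP => j; rewrite !mxE.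
by congr (_ + _); apply/rowP => j; rewrite !mxE ltn_ord.
Qed.

Lemma Cc_lipschitz u : Cc_infty u ->
  exists2 C, 0 <= C & forall x h, `|u (x + h) - u x| <= C * `|h|.
Proof.
move=> cu.
have /choice[C HC] : forall i, exists C, 0 < C /\ forall x, `|partial i u x| <= C.
  by move=> i; have [C C0 CC] := Cc_bounded (Cc_partial i cu); exists C.
exists (\sum_i C i) => [|x h]; first by apply: sumr_ge0 => i _; rewrite ltW// (HC i).1.
have [xi [_ ->]] := increment_partials x h (Cc_smooth cu).
rewrite mulr_suml; apply: le_trans (ler_norm_sum _ _ _) _; apply: ler_sum => i _.
by rewrite normrM mulrC ler_pM// ?(HC i).2// le_coord_norm.
Qed.

(** [increment_partials] writes the increment with partial derivatives taken at
    nearby points; these are Lipschitz, so moving them to [x] costs O(|h|) each. *)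
Lemma Cc_taylor u : Cc_infty u -> exists2 C, 0 <= C &
  forall x h, `|u (x + h) - u x - dot h (grad u x)| <= C * `|h| ^+ 2.
Proof.
move=> cu.
have /choice[C HC] : forall i, exists C, 0 <= C /\
    forall x h, `|partial i u (x + h) - partial i u x| <= C * `|h|.
  by move=> i; have [C C0 CC] := Cc_lipschitz (Cc_partial i cu); exists C.
exists (\sum_i C i) => [|x h]; first by apply: sumr_ge0 => i _; rewrite (HC i).1.
have [xi [xih ->]] := increment_partials x h (Cc_smooth cu).
rewrite /dot -sumrB mulr_suml; apply: le_trans (ler_norm_sum _ _ _) _.
apply: ler_sum => i _; rewrite mxE -mulrBr normrM expr2 mulrCA.
apply: ler_pM => //; first exact: le_coord_norm.
have := (HC i).2 x (xi i - x); rewrite addrCA subrr addr0 => /le_trans; apply.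
by rewrite ler_wpM2l// (HC i).1.
Qed.

(** For |h| <= 1 the remainder vanishes off the unit neighbourhood of the
    support, so that it may be integrated against locally integrable functions. *)
Lemma Cc_taylor_cpt u : Cc_infty u -> exists C M : R, [/\ 0 <= C, 0 < M &
  forall x h, enorm h <= 1 ->
  `|u (x + h) - u x - dot h (grad u x)| <=
    C * enorm h ^+ 2 * \1_[set x : Rn | enorm x <= M] x].
Proof.
move=> cu; have [C C0 HC] := Cc_taylor cu; have [M M0 uM] := Cc_support cu.
exists C, (M + 1); split => // [|x h h1]; first by rewrite addr_gt0.
rewrite indicE; case: (boolP (x \in _)) => [_|]; rewrite !(mulr0, mulr1).
  apply: le_trans (HC x h) _; apply: ler_wpM2l => //.
  by rewrite lerXn2r ?nnegrE ?enorm_ge0// norm_le_enorm.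
rewrite notin_setE/= => /negP; rewrite -ltNge => Mx.
have Mx' : M < enorm x by lra.
rewrite uM; last by have := enormD (x + h) (- h); rewrite enormN addrK; lra.
rewrite uM// /dot big1 ?subrr ?normr0// => i _.
by rewrite mxE (partial_out i uM)// mulr0.
Qed.

(** As [r] grows this tends to 1 at every point while staying in the unit
    interval, which suits dominated convergence. *)
Definition cutoff (r : R) x : R :=
  \prod_(i < n) (chi 0 (1 * x ord0 i + r) * chi 0 (- 1 * x ord0 i + r)).

Lemma Cc_cutoff r : Cc_infty (cutoff r).
Proof.
have [n0|n0] := posnP n.
  apply: (@CcI 0); first by apply: smooth_prod => i; apply: smoothM; exact: smooth_chi.
  move=> x; rewrite enorm_gt0 => /eqP; case; apply/rowP => i.
  by move: (ltn_ord i); rewrite [X in (_ < X)%N -> _]n0.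
apply: (@CcI (n%:R * `|r|)).
  by apply: smooth_prod => i; apply: smoothM; exact: smooth_chi.
move=> x rx; have {}rx : `|r| < `|x|.
  by rewrite -(@ltr_pM2l _ n%:R) ?ltr0n//; exact: lt_le_trans rx (enorm_le_norm x).
have [i ri] : exists i, `|r| < `|x ord0 i|.
  move: rx; rewrite -[`|x|]/(mx_norm x) mx_normrE => /bigmax_gtP[|[[a i] _]].
    by rewrite ltNge normr_ge0.
  by rewrite (ord1 a) => ?; exists i.
rewrite /cutoff (bigD1 i)//=.
suff -> : chi 0 (1 * x ord0 i + r) * chi 0 (- 1 * x ord0 i + r) = 0 by rewrite mul0r.
have := ler_norm r; have [xi0|xi0] := leP 0 (x ord0 i).
  by move: ri; rewrite (ger0_norm xi0) => ? ?; rewrite (@chi_le0 _ 0 (-1 * _ + _)) ?mulr0//; lra.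
by move: ri; rewrite (ltr0_norm xi0) => ? ?; rewrite chi_le0 ?mul0r//; lra.
Qed.

Lemma cutoff_ge0 r x : 0 <= cutoff r x.
Proof. by apply: prodr_ge0 => i _; rewrite mulr_ge0 ?chi_ge0. Qed.

Lemma cutoff_le1 r x : cutoff r x <= 1.
Proof.
suff /andP[] : 0 <= cutoff r x <= 1 by [].
apply: (big_ind (fun z => 0 <= z <= 1)) => [|y z|i _].
- by rewrite ler01 lexx.
- by move=> /andP[y0 y1] /andP[z0 z1]; rewrite mulr_ge0// mulr_ile1.
- by rewrite mulr_ge0 ?chi_ge0//= mulr_ile1 ?chi_ge0 ?chi0_le1.
Qed.

Lemma cutoff_gt0 r : 0 < r -> 0 < cutoff r 0.
Proof.
move=> r0; apply: prodr_gt0 => i _; rewrite mxE !mulr0 add0r.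
by rewrite mulr_gt0// chi0_gt0.
Qed.

End compact_support.

(** * Power inequalities and real-valued integrals *)

Section young.
Context {R : realType}.
Implicit Types a b s t p : R.

Definition conj_exp p : R := p / (p - 1).

Lemma conj_expP p : 1 < p -> [/\ 1 < conj_exp p, p^-1 + (conj_exp p)^-1 = 1,
  (p - 1) * conj_exp p = p & (conj_exp p - 1) * p = conj_exp p].
Proof.
move=> p1; have q0 : p - 1 != 0 by rewrite subr_eq0 gt_eqF.
have p0 : p != 0 by rewrite gt_eqF// (lt_trans ltr01).
rewrite /conj_exp; split.
- by rewrite ltr_pdivlMr ?subr_gt0// mul1r; lra.
- by field; rewrite q0 p0.
- by field.
- by field.
Qed.

(** The inequality behind duality: for fixed [a] the left side, as a function of
    [b], is maximal at [b = spow p a], where equality holds. *)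
Lemma young p a b : 1 < p ->
  p * (a * b) - (p - 1) * `|b| `^ (conj_exp p) <= `|a| `^ p.
Proof.
move=> p1; have [q1 pq pq1 qp1] := conj_expP p1.
have p0 : 0 < p by lra.
have q0 : 0 < conj_exp p by lra.
have := conjugate_powR (normr_ge0 a) (normr_ge0 b) p0 q0 pq.
set A := _ `^ p; set B := _ `^ _ => h.
have {}h : p * (`|a| * `|b|) <= A + (p - 1) * B.
  rewrite -(ler_pM2l p0) in h; apply: (le_trans h); rewrite mulrDr.
  rewrite le_eqVlt; apply/orP; left; apply/eqP.
  rewrite /conj_exp; field.
  by rewrite subr_eq0 !gt_eqF.
have : p * (a * b) <= p * (`|a| * `|b|).
  by rewrite ler_pM2l// -normrM ler_norm.
lra.
Qed.

(** The derivative of |a|^p / p, that is, the duality map of L^p. *)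
Definition spow p a : R := Num.sg a * `|a| `^ (p - 1).

Lemma mulr_spow p a : 1 < p -> a * spow p a = `|a| `^ p.
Proof.
by move=> p1; rewrite /spow mulrA (mulrC a) -normrEsg mulr_powRB1//; lra.
Qed.

Lemma norm_spow p a : 1 < p -> `|spow p a| = `|a| `^ (p - 1).
Proof.
move=> p1; rewrite /spow normrM (ger0_norm (powR_ge0 _ _)) normr_sg.
have [->|a0] := eqVneq a 0; last by rewrite mul1r.
by rewrite normr0 powR0 ?mul0r// subr_eq0 gt_eqF.
Qed.

Lemma spow_conj p a : 1 < p -> `|spow p a| `^ conj_exp p = `|a| `^ p.
Proof.
by move=> p1; rewrite norm_spow// -powRrM; have [_ _ -> _] := conj_expP p1.
Qed.

(** Young's inequality at the dual point of [s], where it is an equality for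
    [s] itself, says that |t|^p lies above its tangent at [s]. *)
Lemma powR_tangent p s t : 1 < p ->
  `|s| `^ p + p * (spow p s * (t - s)) <= `|t| `^ p.
Proof.
move=> p1; have := young t (spow p s) p1.
by rewrite spow_conj// mulrBr (mulrC _ s) mulr_spow// (mulrC t); lra.
Qed.

Lemma powR_lip p s t : 1 < p ->
  `|s| `^ p <= `|t| `^ p + p * (`|s| `^ (p - 1) * `|s - t|).
Proof.
move=> p1; have := powR_tangent s t p1.
have : p * (spow p s * (s - t)) <= p * (`|s| `^ (p - 1) * `|s - t|).
  by rewrite ler_pM2l ?(lt_trans ltr01 p1)// -norm_spow// -normrM ler_norm.
rewrite -[t - s]opprB mulrN; lra.
Qed.

Lemma powR_add_le p a b : 0 <= p ->
  `|a + b| `^ p <= 2 `^ p * (`|a| `^ p + `|b| `^ p).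
Proof.
move=> p0; have h m : `|a| <= m -> `|b| <= m -> `|a + b| `^ p <= 2 `^ p * m `^ p.
  move=> am bm; have m0 := le_trans (normr_ge0 a) am.
  rewrite -powRM//; apply: ge0_ler_powR => //; rewrite ?nnegrE ?mulr_ge0//.
  by rewrite (le_trans (ler_normD _ _))//; lra.
have [ab|/ltW ba] := leP `|a| `|b|.
- apply: le_trans (h _ ab (lexx _)) _.
  by rewrite ler_wpM2l ?powR_ge0// lerDr powR_ge0.
- apply: le_trans (h _ (lexx _) ba) _.
  by rewrite ler_wpM2l ?powR_ge0// lerDl powR_ge0.
Qed.

Lemma powR_ge_id p a : 1 <= p -> `|a| <= 1 + `|a| `^ p.
Proof.
move=> p1; have [a1|a1] := leP `|a| 1; first by rewrite (le_trans a1)// lerDl powR_ge0.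
by rewrite (le_trans (le1r_powR (ltW a1) p1))// lerDr.
Qed.

(** Jensen's inequality, by adding the tangent inequalities at the mean. *)
Lemma powR_sum_le p (m : nat) (a : 'I_m.+1 -> R) : 1 < p ->
  `|\sum_i a i| `^ p <= m.+1%:R `^ (p - 1) * \sum_i `|a i| `^ p.
Proof.
move=> p1; pose s := (\sum_i a i) / m.+1%:R.
have m0 : 0 < m.+1%:R :> R by [].
have sE : \sum_i a i = m.+1%:R * s by rewrite mulrC divfK// gt_eqF.
have : \sum_(i < m.+1) (`|s| `^ p + p * (spow p s * (a i - s))) <= \sum_i `|a i| `^ p.
  by apply: ler_sum => i _; exact: powR_tangent.
have s0 : \sum_i (a i - s) = 0.
  by rewrite sumrB sE sumr_const card_ord -[s *+ _]mulr_natl subrr.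
rewrite big_split/= -mulr_sumr -mulr_sumr s0 !mulr0 addr0 sE.
rewrite sumr_const card_ord -[_ *+ m.+1]mulr_natl => h.
rewrite normrM powRM// (ger0_norm (ltW m0)).
rewrite -(@mulr_powRB1 _ m.+1%:R p)//; last lra.
by rewrite (mulrC m.+1%:R) -mulrA ler_wpM2l// powR_ge0.
Qed.

End young.

Section real_integrals.
Context {d} {T : measurableType d} {R : realType}.
Variable mu : {measure set T -> \bar R}.
Implicit Types f g : T -> R.

Definition intg f := mu.-integrable setT (EFin \o f).

Lemma intg_measurable f : intg f -> measurable_fun setT f.
Proof. by move=> /integrableP[/measurable_EFinP]. Qed.

Lemma intg_le f g : measurable_fun setT f -> (forall x, `|f x| <= g x) ->
  intg g -> intg f.
Proof.
move=> mf fg; apply: le_integrable => //; first exact/measurable_EFinP.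
by move=> x _ /=; rewrite lee_fin (le_trans (fg x))// ler_norm.
Qed.

Lemma intgD f g : intg f -> intg g -> intg (fun x => f x + g x).
Proof. by move=> intf intg'; exact: (integrableD measurableT intf intg'). Qed.

Lemma intgB f g : intg f -> intg g -> intg (fun x => f x - g x).
Proof. by move=> intf intg'; exact: (integrableB measurableT intf intg'). Qed.

Lemma intgZ c f : intg f -> intg (fun x => c * f x).
Proof. by move=> intf; exact: (integrableZl measurableT c intf). Qed.

Lemma intg_norm f : intg f -> intg (fun x => `|f x|).
Proof. by move=> intf; exact: (integrable_norm intf). Qed.

Lemma intg_ge0P f : measurable_fun setT f -> (forall x, 0 <= f x) ->
  (\int[mu]_x (f x)%:E < +oo)%E -> intg f.
Proof.
move=> mf f0 foo; apply/integrableP; split; first exact/measurable_EFinP.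
by under eq_integral do rewrite /= ger0_norm//.
Qed.

Lemma EFin_Rintegral f : intg f -> (\int[mu]_x f x)%:E = (\int[mu]_x (f x)%:E)%E.
Proof. by move=> intf; rewrite fineK//; exact: integrable_fin_num. Qed.

Lemma Rintegral_dominated (f_ : nat -> T -> R) f g :
  (forall k, measurable_fun setT (f_ k)) ->
  (forall x, f_ ^~ x @ \oo --> f x) -> intg g ->
  (forall k x, `|f_ k x| <= g x) ->
  intg f /\ (\int[mu]_x f_ k x) @[k --> \oo] --> \int[mu]_x f x.
Proof.
move=> mf_ f_f ig f_g.
have mf : measurable_fun setT f.
  by apply: measurable_fun_cvg mf_ _ => x _; exact: f_f.
have [|||//||h1 _ h3] := @dominated_convergence _ _ _ mu setT measurableT
  (fun k => EFin \o f_ k) (EFin \o f) (EFin \o g).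
- by move=> k; exact/measurable_EFinP.
- exact/measurable_EFinP.
- apply: aeW => x _; apply: cvg_EFin; first exact: nearW.
  exact: f_f.
- by apply: aeW => x k _; rewrite /= lee_fin.
split => //.
by apply: fine_cvg; rewrite EFin_Rintegral.
Qed.

End real_integrals.

(** * Approximation by smooth functions with values in the unit interval *)

Lemma cvg_chi (R : realType) (s : nat -> R) :
  (forall A, \forall k \near \oo, A <= s k) ->
  chi 0 (s k) @[k --> \oo] --> (1 : R).
Proof.
move=> sA; apply/cvgrPdist_le => e e0; near=> k.
have se : e^-1 <= s k by near: k; exact: sA.
have s0 : 0 < s k by rewrite (lt_le_trans _ se)// invr_gt0.
rewrite ger0_norm ?subr_ge0 ?chi0_le1// /chi s0 expr0 mul1r.
have := expR_ge1Dx (- (s k)^-1).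
have : (s k)^-1 <= e by rewrite -(invrK e) lef_pV2// posrE invr_gt0.
lra.
Unshelve. all: by end_near. Qed.

Section approximation.
Context {R : realType} {n : nat}.
Local Notation Rn := 'rV[R]_n.
Local Notation leb := (@lebesgue_rV R n).
Implicit Types (x : Rn) (b phi w : Rn -> R).

Section weight.
Variable w : Rn -> R.
Hypotheses (w0 : forall x, 0 <= w x) (iw : intg leb w).

Let mw : measurable_fun setT w.
Proof. exact: intg_measurable iw. Qed.

(** Values in the unit interval make the class stable under complements and
    products, hence suited to a sigma-algebra argument. *)
Definition unit_fun b := measurable_fun setT b /\ forall x, 0 <= b x <= 1.

Lemma unit_fun_dist b b' : unit_fun b -> unit_fun b' -> forall x, `|b x - b' x| <= 1.
Proof.
move=> [_ ub] [_ ub'] x; have /andP[? ?] := ub x; have /andP[? ?] := ub' x.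
by rewrite ler_norml; apply/andP; split; lra.
Qed.

Lemma intg_unit_dist b b' : unit_fun b -> unit_fun b' ->
  intg leb (fun x => `|b x - b' x| * w x).
Proof.
move=> ub ub'; apply: intg_le iw.
  apply: measurable_funM => //; apply: measurableT_comp => //.
  by apply: measurable_funB; [exact: ub.1 | exact: ub'.1].
move=> x; rewrite normrM normr_id (ger0_norm (w0 x)) ler_piMl//.
exact: unit_fun_dist.
Qed.

(** Approximation in L^1 with weight [w], by smooth functions that also stay in
    the unit interval; the uniform bound is what later allows composition with
    powers. *)
Definition approximable b := unit_fun b /\ forall e, 0 < e -> exists phi,
  [/\ smooth phi, unit_fun phi & \int[leb]_x (`|phi x - b x| * w x) <= e].

Lemma smooth_unit_fun phi : smooth phi -> (forall x, 0 <= phi x <= 1) -> unit_fun phi.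
Proof.
by move=> sp p01; split => //; apply: continuous_measurable_rV; exact: smooth_continuous.
Qed.

Lemma approximable_smooth b : smooth b -> (forall x, 0 <= b x <= 1) -> approximable b.
Proof.
move=> sb b01; have ub := smooth_unit_fun sb b01; split => // e e0; exists b; split => //.
under eq_Rintegral do rewrite subrr normr0 mul0r.
by rewrite Rintegral_cst// mul0r ltW.
Qed.

Lemma approximable_close b : unit_fun b ->
  (forall e, 0 < e -> exists2 b', approximable b' &
     \int[leb]_x (`|b' x - b x| * w x) <= e) ->
  approximable b.
Proof.
move=> ub H; split => // e e0; have e2 : 0 < e / 2 by rewrite divr_gt0.
have [b' [ub' ab'] b'b] := H _ e2; have [phi [sp up pb']] := ab' _ e2.
exists phi; split => //; rewrite [leRHS]splitr.
apply: le_trans (lerD pb' b'b); rewrite -RintegralD//; try exact: intg_unit_dist.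
apply: le_Rintegral => //; first exact: intg_unit_dist.
  by apply: intgD; exact: intg_unit_dist.
by move=> x _; rewrite -mulrDl ler_wpM2r// ler_distD.
Qed.

Lemma approximable_lim (b_ : nat -> Rn -> R) b :
  (forall k, approximable (b_ k)) -> (forall x, b_ ^~ x @ \oo --> b x) ->
  approximable b.
Proof.
move=> ab_ b_b.
have mb : measurable_fun setT b.
  by apply: measurable_fun_cvg (fun k => (ab_ k).1.1) _ => x _; exact: b_b.
have ub : unit_fun b.
  split => // x; apply/andP; split.
    rewrite -(cvg_lim (@Rhausdorff R) (b_b x)); apply: limr_ge; first exact: (cvgP _ (b_b x)).
    by apply: nearW => k; have [[_ /(_ x)/andP[]]] := ab_ k.
  rewrite -(cvg_lim (@Rhausdorff R) (b_b x)); apply: limr_le; first exact: (cvgP _ (b_b x)).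
  by apply: nearW => k; have [[_ /(_ x)/andP[]]] := ab_ k.
apply: approximable_close => // e e0.
have [||||_] := @Rintegral_dominated _ _ _ leb (fun k x => `|b_ k x - b x| * w x) (fun=> 0) w.
- by move=> k; apply: intg_measurable; apply: intg_unit_dist => //; exact: (ab_ k).1.
- move=> x; rewrite -(mul0r (w x)); apply: cvgMr_tmp.
  rewrite -(normr0 R) -(subrr (b x)); apply: cvg_norm; apply: cvgB; first exact: b_b.
  exact: cvg_cst.
- exact: iw.
- move=> k x; rewrite normrM normr_id (ger0_norm (w0 x)) ler_piMl//.
  by apply: unit_fun_dist => //; exact: (ab_ k).1.
rewrite Rintegral_cst// mul0r => c.
have /cvgrPdist_le/(_ e e0)[k _ /(_ k (leqnn k)) /=] := c.
rewrite sub0r normrN => h; exists (b_ k) => //.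
by apply: le_trans h; exact: ler_norm.
Qed.

Lemma approximableC b : approximable b -> approximable (fun x => 1 - b x).
Proof.
move=> [[mb b01] ab]; split.
  split; first exact: measurable_funB.
  by move=> x; have /andP[? ?] := b01 x; apply/andP; split; lra.
move=> e e0; have [phi [sp [mp p01] pb]] := ab e e0.
have sp' : smooth (fun x => 1 + -1 * phi x).
  exact: (smoothD (smooth_cst _) (smoothM (smooth_cst _) sp)).
exists (fun x => 1 + -1 * phi x); split => //.
  by apply: smooth_unit_fun => // x; have /andP[? ?] := p01 x; apply/andP; split; lra.
apply: le_trans pb; rewrite le_eqVlt; apply/orP; left; apply/eqP.
apply: eq_Rintegral => x _; rewrite distrC.
by rewrite (_ : 1 - b x - (1 + -1 * phi x) = phi x - b x)//; ring.
Qed.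

Lemma approximableM b b' : approximable b -> approximable b' ->
  approximable (fun x => b x * b' x).
Proof.
move=> [[mb b01] ab] [[mb' b01'] ab']; split.
  split; first exact: measurable_funM.
  move=> x; have /andP[? ?] := b01 x; have /andP[? ?] := b01' x.
  by rewrite mulr_ge0//= mulr_ile1.
move=> e e0; have e2 : 0 < e / 2 by rewrite divr_gt0.
have [phi [sp up pb]] := ab _ e2.
have [phi' [sp' up' pb']] := ab' _ e2.
exists (fun x => phi x * phi' x); split.
- exact: smoothM.
- apply: smooth_unit_fun; first exact: smoothM.
  move=> x; have /andP[? ?] := up.2 x; have /andP[? ?] := up'.2 x.
  by rewrite mulr_ge0//= mulr_ile1.
rewrite [leRHS]splitr; apply: le_trans (lerD pb pb').
rewrite -RintegralD//; try by apply: intg_unit_dist.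
apply: le_Rintegral => //.
- apply: intg_unit_dist; split.
  + by apply: measurable_funM; [exact: up.1|exact: up'.1].
  + move=> x; have /andP[? ?] := up.2 x; have /andP[? ?] := up'.2 x.
    by rewrite mulr_ge0//= mulr_ile1.
  + exact: measurable_funM.
  + move=> x; have /andP[? ?] := b01 x; have /andP[? ?] := b01' x.
    by rewrite mulr_ge0//= mulr_ile1.
- by apply: intgD; apply: intg_unit_dist.
move=> x _; rewrite -mulrDl ler_wpM2r//.
have -> : phi x * phi' x - b x * b' x = (phi x - b x) * phi' x + b x * (phi' x - b' x) by ring.
apply: le_trans (ler_normD _ _) _; rewrite !normrM.
have /andP[? ?] := b01 x; have /andP[? ?] := up'.2 x.
by apply: lerD; [apply: ler_piMr|apply: ler_piMl] => //; rewrite ger0_norm.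
Qed.

(** Averages rather than sums keep the values in the unit interval. *)
Lemma approximable_avg b b' : approximable b -> approximable b' ->
  approximable (fun x => 2^-1 * b x + 2^-1 * b' x).
Proof.
move=> [[mb b01] ab] [[mb' b01'] ab']; split.
  split; first by apply: measurable_funD; exact: measurable_funM.
  by move=> x; have /andP[? ?] := b01 x; have /andP[? ?] := b01' x; apply/andP; split; lra.
move=> e e0; have [phi [sp up pb]] := ab _ e0.
have [phi' [sp' up' pb']] := ab' _ e0.
have s2 : smooth (fun x => 2^-1 * phi x + 2^-1 * phi' x).
  exact: (smoothD (smoothM (smooth_cst _) sp) (smoothM (smooth_cst _) sp')).
have u2 : unit_fun (fun x => 2^-1 * phi x + 2^-1 * phi' x).
  apply: smooth_unit_fun => // x.
  by have /andP[? ?] := up.2 x; have /andP[? ?] := up'.2 x; apply/andP; split; lra.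
exists (fun x => 2^-1 * phi x + 2^-1 * phi' x); split => //.
have i1 : intg leb (fun x => `|phi x - b x| * w x) by exact: intg_unit_dist.
have i2 : intg leb (fun x => `|phi' x - b' x| * w x) by exact: intg_unit_dist.
apply: (@le_trans _ _ (\int[leb]_x (2^-1 * (`|phi x - b x| * w x) + 2^-1 * (`|phi' x - b' x| * w x)))).
  apply: le_Rintegral => //.
  - apply: intg_unit_dist => //; split; first by apply: measurable_funD; exact: measurable_funM.
    by move=> x; have /andP[? ?] := b01 x; have /andP[? ?] := b01' x; apply/andP; split; lra.
  - by apply: intgD; exact: intgZ.
  move=> x _; rewrite !mulrA -mulrDl ler_wpM2r//.
  rewrite (_ : _ - _ = 2^-1 * (phi x - b x) + 2^-1 * (phi' x - b' x)); last by field.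
  by apply: le_trans (ler_normD _ _) _; rewrite !normrM ger0_norm.
rewrite RintegralD//; try exact: intgZ.
by rewrite !RintegralZl//; lra.
Qed.

Definition approximable_set (A : set Rn) := approximable (\1_A).

Lemma approximable_setC A : approximable_set A -> approximable_set (~` A).
Proof.
move=> aA; rewrite /approximable_set.
have -> : \1_(~` A) = (fun x => 1 - \1_A x) :> (Rn -> R).
  apply/funext => x; rewrite !indicE in_setC.
  by case: (x \in A); rewrite ?subrr ?subr0.
exact: approximableC.
Qed.

(** Complements are 1 - b, finite intersections are products, and countable
    unions are dominated limits. *)
Lemma approximable_sigma_algebra : sigma_algebra setT approximable_set.
Proof.
split.
- rewrite /approximable_set indic0; apply: approximable_smooth => [|x].
    exact: smooth_cst.
  by rewrite lexx ler01.
- by move=> A aA; rewrite setTD; exact: approximable_setC.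
- move=> F aF.
  pose b (k : nat) (x : Rn) : R := 1 - \prod_(i < k) (1 - \1_(F i) x).
  apply: (@approximable_lim b).
    move=> k; apply: approximableC; elim: k => [|k IH].
      rewrite (_ : (fun x => _) = fun=> 1).
        by apply: approximable_smooth => [|x]; [exact: smooth_cst|rewrite lexx ler01].
      by apply/funext => x; rewrite big_ord0.
    rewrite (_ : (fun x => _) = fun x => (\prod_(i < k) (1 - \1_(F i) x)) * (1 - \1_(F k) x)).
      by apply: approximableM => //; apply: approximableC; exact: aF.
    by apply/funext => x; rewrite big_ord_recr.
  move=> x; rewrite /b; have [[k _ Fkx]|nFx] := pselect ((\bigcup_k F k) x).
    apply: cvg_near_cst; exists k.+1 => // m /= km.
    rewrite (bigD1 (Ordinal km))//= !indicE mem_set//= subrr mul0r subr0.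
    by rewrite mem_set//; exists k.
  apply: cvg_near_cst; apply: nearW => m.
  rewrite big1 ?subrr ?indicE ?memNset// => i _.
  by rewrite indicE memNset ?subr0// => Fix; apply: nFx; exists i.
Qed.

(** The flat function exp(-1/t), dilated by k, tends to the indicator of t > 0. *)
Lemma approximable_ray i a : approximable_set [set x : Rn | a < x ord0 i].
Proof.
apply: (@approximable_lim (fun k x => chi 0 (k%:R * x ord0 i + - (k%:R * a)))).
  move=> k; apply: approximable_smooth; first exact: smooth_chi.
  by move=> x; rewrite chi_ge0 chi0_le1.
move=> x; rewrite indicE; have [ax|xa] := ltP a (x ord0 i); last first.
  rewrite memNset/=; last by rewrite ltNge xa.
  apply: cvg_near_cst; apply: nearW => k; rewrite chi_le0//.
  by rewrite -mulrN -mulrDr mulr_ge0_le0// subr_le0.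
rewrite mem_set//=; apply: cvg_chi => A.
near=> k; rewrite -mulrN -mulrDr -ler_pdivrMr ?subr_gt0//.
by near: k; exact: nbhs_infty_ger.
Unshelve. all: by end_near. Qed.

Lemma approximable_measurable (A : set Rn) : measurable A -> approximable_set A.
Proof.
apply: smallest_sub; first exact: approximable_sigma_algebra.
rewrite -bigcup_seq; apply: bigcup_sub => i _ _ [Y mY <-]; rewrite setTI.
pose S := [set Y : set (measurableTypeR R) | approximable_set ((fun x : Rn => x ord0 i) @^-1` Y)].
suff : measurable `<=` S by apply.
have -> : @measurable _ (measurableTypeR R) = <<s @RGenOInfty.G R >> by exact: RGenOInfty.measurableE.
apply: smallest_sub; last first.
  move=> _ [a ->]; rewrite /S/= (_ : _ @^-1` _ = [set x : Rn | a < x ord0 i]).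
    exact: approximable_ray.
  by apply/seteqP; split => x /=; rewrite in_itv/= andbT.
have [h0 hC hU] := approximable_sigma_algebra; split.
- by rewrite /S/= preimage_set0.
- by move=> B SB; rewrite /S/= setTD; have := hC _ SB; rewrite setTD.
- by move=> F SF; rewrite /S/= preimage_bigcup; exact: hU.
Qed.

(** One binary digit at a time: b is half the indicator of b >= 1/2 plus half
    of a function 2 b - 1_A with values in the unit interval again. *)
Lemma approximable_digits N b : unit_fun b ->
  exists2 b', approximable b' & forall x, `|b' x - b x| <= 2^-1 ^+ N.
Proof.
elim: N b => [|N IH] b [mb b01].
  exists (fun=> 0); first by apply: approximable_smooth => [|x]; [exact: smooth_cst|rewrite lexx ler01].
  by move=> x; have /andP[? ?] := b01 x; rewrite sub0r normrN expr0 ger0_norm.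
pose A := [set x | 2^-1 <= b x].
have mA : measurable A.
  rewrite (_ : A = b @^-1` `[2^-1, +oo[); last first.
    by apply/seteqP; split => x /=; rewrite in_itv/= andbT.
  by rewrite -[X in measurable X]setTI; exact: mb.
have [|b' ab' bb'] := IH (fun x => 2 * b x - \1_A x).
  split; first by apply: measurable_funB; [exact: measurable_funM | exact: measurable_indic].
  move=> x; have /andP[? ?] := b01 x; rewrite indicE.
  case: (boolP (x \in A)) => [/set_mem|/negP Ax] /=; rewrite ?[A]/(A) /A/=.
    by move=> h; apply/andP; split; lra.
  have {}Ax : b x < 2^-1 by rewrite ltNge; apply/negP => h; apply: Ax; exact: mem_set.
  by apply/andP; split; lra.
exists (fun x => 2^-1 * \1_A x + 2^-1 * b' x).
  by apply: approximable_avg => //; exact: approximable_measurable.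
move=> x.
rewrite (_ : _ - _ = 2^-1 * (b' x - (2 * b x - \1_A x))); last by field.
by rewrite normrM ger0_norm// exprS ler_wpM2l.
Qed.

Lemma approximable_fun b : unit_fun b -> approximable b.
Proof.
move=> ub.
have /choice[c cP] : forall N, exists c, approximable c /\ forall x, `|c x - b x| <= 2^-1 ^+ N.
  by move=> N; have [c c1 c2] := approximable_digits N ub; exists c.
apply: (@approximable_lim c) => [k|x]; first exact: (cP k).1.
apply/cvgrPdist_le => e e0; near=> k; rewrite distrC.
apply: le_trans ((cP k).2 x) _.
have : `|0 - 2^-1 ^+ k| <= e.
  near: k; have cz : 2^-1 ^+ k @[k --> \oo] --> (0 : R).
    by apply: cvg_expr; rewrite ger0_norm// invf_lt1// ltr1n.
  by move/cvgrPdist_le : cz => /(_ e e0).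
by rewrite sub0r normrN; apply: le_trans; exact: ler_norm.
Unshelve. all: by end_near. Qed.

End weight.

End approximation.

(** * Duality for p-th power integrals *)

Section duality.
Context {R : realType} {n : nat}.
Local Notation Rn := 'rV[R]_n.
Local Notation leb := (@lebesgue_rV R n).
Implicit Types (x : Rn) (g phi : Rn -> R).

(** Membership in L^p, phrased with the real-valued integrand. *)
Definition Lpi (p : R) g := measurable_fun setT g /\ intg leb (fun x => `|g x| `^ p).

Lemma intg_ball M : intg leb (\1_[set x : Rn | enorm x <= M]).
Proof.
apply: intg_ge0P => //.
  by apply: measurable_indic; exact: measurable_eball.
rewrite integral_indic; [|exact: measurableT|exact: measurable_eball].
by rewrite setIT; exact: eball_fin.
Qed.

Lemma Cc_measurable phi : Cc_infty phi -> measurable_fun setT phi.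
Proof.
by move=> cphi; apply: continuous_measurable_rV; exact: smooth_continuous (Cc_smooth cphi).
Qed.

Lemma Cc_dom phi : Cc_infty phi -> exists C M : R, 0 < C /\
  forall x, `|phi x| <= C * \1_[set x : Rn | enorm x <= M] x.
Proof.
move=> cphi; have [C C0 phiC] := Cc_bounded cphi.
have [M _ phiM] := Cc_support cphi; exists C, M; split => // x.
rewrite indicE; case: (boolP (x \in _)) => [_|]; first by rewrite mulr1.
by rewrite notin_setE/= => /negP; rewrite -ltNge => /phiM ->; rewrite normr0 mulr0.
Qed.

Lemma Cc_intg phi : Cc_infty phi -> intg leb phi.
Proof.
move=> cphi; have [C [M [C0 phiC]]] := Cc_dom cphi.
apply: (intg_le (Cc_measurable cphi) phiC).
exact/intgZ/intg_ball.
Qed.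

Lemma measurable_norm_powR d (T : measurableType d) (f : T -> R) (r : R) :
  measurable_fun setT f -> measurable_fun setT (fun t => `|f t| `^ r).
Proof.
move=> mf; apply: (measurableT_comp (measurable_powR r)).
exact: measurableT_comp.
Qed.

Lemma Cc_intg_powR phi r : 0 < r -> Cc_infty phi -> intg leb (fun x => `|phi x| `^ r).
Proof.
move=> r0 cphi; have [C [M [C0 phiC]]] := Cc_dom cphi.
apply: intg_le (intgZ (C `^ r) (intg_ball M)).
  by apply: measurable_norm_powR; exact: Cc_measurable.
move=> x; rewrite ger0_norm ?powR_ge0//; have := phiC x; rewrite indicE.
case: (x \in _) => /=; rewrite ?mulr1 ?mulr0 => h.
  by apply: ge0_ler_powR => //; rewrite ?nnegrE//; exact: ltW.
have -> : `|phi x| = 0 by apply/eqP; rewrite eq_le h normr_ge0.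
by rewrite powR0 ?gt_eqF.
Qed.

Lemma Lpi_mul_Cc p g phi : 1 < p -> Lpi p g -> Cc_infty phi ->
  intg leb (fun x => g x * phi x).
Proof.
move=> p1 [mg ig] cphi; have [C [M [C0 phiC]]] := Cc_dom cphi.
apply: (intg_le (g := fun x => C * (\1_[set x : Rn | enorm x <= M] x + `|g x| `^ p))).
- by apply: measurable_funM => //; exact: Cc_measurable.
- move=> x; rewrite normrM; apply: le_trans (ler_wpM2l (normr_ge0 _) (phiC x)) _.
  rewrite mulrCA ler_wpM2l ?(ltW C0)// indicE; case: (x \in _) => /=.
    by rewrite mulr1; apply: powR_ge_id; exact: ltW.
  by rewrite mulr0 add0r powR_ge0.
- by apply: intgZ; apply: intgD => //; exact: intg_ball.
Qed.

Lemma cvg_cutoff x : cutoff k%:R x @[k --> \oo] --> (1 : R).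
Proof.
suff : cutoff k%:R x @[k --> \oo] --> (\prod_(i < n) (1 * 1) : R).
  by rewrite big1// => i _; rewrite mulr1.
apply: cvg_big; first exact: mul_continuous.
move=> i _; apply: cvgM; apply: cvg_chi => A; near=> k; rewrite -lerBlDl.
  by near: k; exact: nbhs_infty_ger.
by near: k; exact: nbhs_infty_ger.
Unshelve. all: by end_near. Qed.

Lemma measurable_spow p : measurable_fun setT (@spow R p).
Proof.
apply: measurable_funM; last by apply: measurable_norm_powR.
rewrite (_ : Num.sg = fun x : R => \1_[set y | 0 < y] x - \1_[set y | y < 0] x).
  apply: measurable_funB; apply: measurable_indic.
    by rewrite -set_itvoy; exact: measurable_itv.
  by rewrite -set_itvNyo; exact: measurable_itv.
apply/funext => x; rewrite !indicE.
have [x0|x0|->] := ltgtP x 0.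
- by rewrite ltr0_sg// memNset/= ?mem_set//= ?sub0r// => /(lt_trans x0); rewrite ltxx.
- by rewrite gtr0_sg// mem_set//= memNset/= ?subr0// => /(lt_trans x0); rewrite ltxx.
- by rewrite sgr0 !memNset/= ?ltxx// subrr.
Qed.

Definition pairing p g phi : R :=
  \int[leb]_x (p * (g x * phi x) - (p - 1) * `|phi x| `^ conj_exp p).

Lemma intg_pairing p g phi : 1 < p -> Lpi p g -> Cc_infty phi ->
  intg leb (fun x => p * (g x * phi x) - (p - 1) * `|phi x| `^ conj_exp p).
Proof.
move=> p1 ig cphi; apply: intgB; apply: intgZ; first exact: Lpi_mul_Cc ig cphi.
by apply: Cc_intg_powR => //; have [? _ _ _] := conj_expP p1; lra.
Qed.

Lemma pairingE p g phi : 1 < p -> Lpi p g -> Cc_infty phi ->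
  pairing p g phi = p * (\int[leb]_x (g x * phi x)) -
    (p - 1) * \int[leb]_x (`|phi x| `^ conj_exp p).
Proof.
move=> p1 ig cphi.
have i1 := Lpi_mul_Cc p1 ig cphi.
have i2 : intg leb (fun x => `|phi x| `^ conj_exp p).
  by apply: Cc_intg_powR => //; have [? _ _ _] := conj_expP p1; lra.
by rewrite /pairing RintegralB ?RintegralZl//; exact: intgZ.
Qed.

Lemma pairing_le p g phi : 1 < p -> Lpi p g -> Cc_infty phi ->
  pairing p g phi <= \int[leb]_x (`|g x| `^ p).
Proof.
move=> p1 ig cphi; apply: le_Rintegral => //; first exact: intg_pairing.
  exact: ig.2.
by move=> x _; exact: young.
Qed.

(** The optimal competitor is the dual function |g|^(p-1) sign g. It is first
    truncated in size and cut off in space, which costs little by dominated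
    convergence; the resulting bounded function is then replaced by a smooth one
    that is close in L^1 for a weight controlling the change of the integrand. *)
Lemma pairing_sup p g eta : 1 < p -> Lpi p g -> 0 < eta -> exists2 phi,
  Cc_infty phi & \int[leb]_x (`|g x| `^ p) - eta <= pairing p g phi.
Proof.
have aux (r s t e : R) : r - e / 2 <= s -> s - t <= e / 2 -> r - e <= t by lra.
move=> p1 [mg ig] eta0; have [q1 pq pq1 qp1] := conj_expP p1.
set q := conj_exp p in q1 pq pq1 qp1 *.
have eta2 : 0 < eta / 2 by rewrite divr_gt0.
pose a x := spow p (g x).
have ma : measurable_fun setT a by apply: measurableT_comp mg; exact: measurable_spow.
(* the dual function a is truncated at height k.+1, then cut off in space *)
pose A (k : nat) := [set x | `|a x| <= k.+1%:R].
have mA k : measurable (A k).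
  rewrite (_ : A k = (fun x => `|a x|) @^-1` `]-oo, k.+1%:R]); last first.
    by apply/seteqP; split => x /=; rewrite in_itv.
  have mna : measurable_fun setT (fun x => `|a x|) by exact: measurableT_comp.
  by rewrite -[X in measurable X]setTI; exact: mna.
pose b (k : nat) x := a x * \1_(A k) x.
have mb k : measurable_fun setT (b k).
  by apply: measurable_funM => //; exact: measurable_indic.
have b_le k x : `|b k x| <= `|a x|.
  rewrite normrM indicE ler_piMr//; case: (x \in A k) => /=; rewrite ?normr1 ?normr0 ?lexx ?ler01//.
have b_leN k x : `|b k x| <= k.+1%:R.
  rewrite /b indicE; case: (boolP (x \in A k)) => [/set_mem Akx|_] /=.
    by rewrite mulr1.
  by rewrite mulr0 normr0.
pose th (k : nat) : Rn -> R := cutoff k%:R.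
have th0 k x : 0 <= th k x by exact: cutoff_ge0.
have th1 k x : th k x <= 1 by exact: cutoff_le1.
have mth k : measurable_fun setT (th k).
  by apply: Cc_measurable; exact: Cc_cutoff.
pose F x y := p * (g x * y) - (p - 1) * `|y| `^ q.
have thb_le k x : `|th k x * b k x| <= `|a x|.
  rewrite normrM ger0_norm//; apply: le_trans (ler_piMl _ (th1 k x)) _ => //.
have aq x : `|a x| `^ q = `|g x| `^ p by exact: spow_conj.
have pq0 : 0 <= q by lra.
have ga x : `|g x| * `|a x| = `|g x| `^ p.
  by rewrite -normrM mulr_spow// ger0_norm// powR_ge0.
have mF (f : Rn -> R) : measurable_fun setT f -> measurable_fun setT (fun x => F x (f x)).
  move=> mf; apply: measurable_funB.
    by apply: measurable_funM => //; exact: measurable_funM.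
  by apply: measurable_funM => //; exact: measurable_norm_powR.
have FB x y : `|y| <= `|a x| -> `|F x y| <= (p + (p - 1)) * `|g x| `^ p.
  move=> ya; apply: le_trans (ler_normB _ _) _.
  rewrite [leRHS]mulrDl; apply: lerD.
    rewrite normrM (ger0_norm (ltW (lt_trans ltr01 p1))); apply: ler_wpM2l; first by lra.
    by rewrite -ga normrM ler_wpM2l.
  rewrite normrM (@ger0_norm _ (p - 1)); last by lra.
  apply: ler_wpM2l; first by lra.
  by rewrite ger0_norm ?powR_ge0// -aq; apply: ge0_ler_powR; rewrite ?nnegrE.
have [||||_ cF] := @Rintegral_dominated _ _ _ leb
   (fun k x => F x (th k x * b k x)) (fun x => `|g x| `^ p) (fun x => (p + (p - 1)) * `|g x| `^ p).
- by move=> k; apply: mF; exact: measurable_funM.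
- move=> x.
  have -> : `|g x| `^ p = F x (1 * a x).
    by rewrite mul1r /F aq mulr_spow//; ring.
  have c : th k x * b k x @[k --> \oo] --> 1 * a x.
    apply: cvgM; first exact: cvg_cutoff.
    apply: cvg_near_cst; near=> k; rewrite /b indicE mem_set ?mulr1//=.
    apply: (@le_trans _ _ k%:R); last by rewrite ler_nat.
    by near: k; exact: nbhs_infty_ger.
  apply: cvgB; first by apply: cvgMl_tmp; apply: cvgMl_tmp.
  apply: cvgMl_tmp.
  rewrite mul1r in c *.
  apply: (@squeeze_cvgr _ _ _ _
    (fun k => `|a x| `^ q - q * (`|a x| `^ (q - 1) * `|a x - th k x * b k x|))
    (fun=> `|a x| `^ q)).
  + apply: nearW => k; rewrite lerBlDr (powR_lip _ _ q1)/=.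
    by apply: ge0_ler_powR; rewrite ?nnegrE.
  + have c0 : `|a x - th k x * b k x| @[k --> \oo] --> (0 : R).
      rewrite -(normr0 R) -(subrr (a x)); apply: cvg_norm; apply: cvgB => //.
      exact: cvg_cst.
    have := cvgB (cvg_cst (`|a x| `^ q)) (cvgMl_tmp (a := q) (cvgMl_tmp (a := `|a x| `^ (q - 1)) c0)).
    rewrite !mulr0 subr0; exact.
  + exact: cvg_cst.
- exact: intgZ.
- by move=> k x; exact: FB.
have [k Hk] : exists k, \int[leb]_x (`|g x| `^ p) - eta / 2 <= \int[leb]_x F x (th k x * b k x).
  move/cvgrPdist_le : cF => /(_ _ eta2)[k _ /(_ k (leqnn k))/=].
  by rewrite ler_norml => /andP[h1 h2]; exists k; lra.
pose N : R := k.+1%:R; have N0 : 0 < N by [].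
(* w times the distance in the unit interval bounds the change of the integrand F
   between two functions with values in [-N, N] *)
pose w x := th k x * (p * `|g x| + p * N `^ (q - 1)) * (2 * N).
have w0 x : 0 <= w x.
  have p0 : 0 <= p by rewrite ltW// (lt_trans ltr01).
  rewrite mulr_ge0 ?mulr_ge0 ?(ltW N0)// addr_ge0 ?mulr_ge0 ?powR_ge0//.
have iw : intg leb w.
  have i1 : intg leb (fun x => g x * th k x) by apply: (Lpi_mul_Cc p1) => //; exact: Cc_cutoff.
  have i2 : intg leb (th k) by apply: Cc_intg; exact: Cc_cutoff.
  have -> : w = fun x => (2 * N) * (p * `|g x * th k x| + (p * N `^ (q - 1)) * th k x).
    by apply/funext => x; rewrite /w normrM (ger0_norm (th0 k x)); ring.
  by apply: intgZ; apply: intgD; apply: intgZ => //; exact: intg_norm.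
(* [-N, N] is rescaled to the unit interval, where smooth approximation applies *)
pose b' x := (b k x / N + 1) / 2.
have ub' : unit_fun b'.
  split.
    by apply: measurable_funM => //; apply: measurable_funD => //; exact: measurable_funM.
  move=> x; have := b_leN k x; rewrite -/N ler_norml => /andP[h1 h2].
  have h3 : b k x / N <= 1 by rewrite ler_pdivrMr// mul1r.
  have h4 : -1 <= b k x / N by rewrite ler_pdivlMr// mulN1r.
  rewrite /b'; move: h3 h4; set t := b k x / N => h3 h4.
  by clearbody t; clear -h3 h4; apply/andP; split; lra.
have [phi' [sp' up' pb']] := (approximable_fun w0 iw ub').2 _ eta2.
pose phi x := th k x * (N * (2 * phi' x + -1)).
have cphi : Cc_infty phi.
  apply: CcM; first exact: Cc_cutoff.
  exact: (smoothM (smooth_cst N) (smoothD (smoothM (smooth_cst 2) sp') (smooth_cst (-1)))).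
exists phi; first exact: cphi.
have iF1 : intg leb (fun x => F x (th k x * b k x)).
  apply: (intg_le (g := fun x => (p + (p - 1)) * `|g x| `^ p)); last exact: intgZ.
    by apply: mF; exact: measurable_funM.
  by move=> x; exact: FB.
have iF2 : intg leb (fun x => F x (phi x)) by exact: intg_pairing.
have id : intg leb (fun x => `|phi' x - b' x| * w x) by exact: intg_unit_dist.
have : \int[leb]_x F x (th k x * b k x) - \int[leb]_x F x (phi x) <= eta / 2.
  apply: le_trans pb'; rewrite -RintegralB//; apply: le_Rintegral => //.
    exact: intgB.
  move=> x _; rewrite /F.
  have phiN : `|phi x| <= N.
    have /andP[u1 u2] := up'.2 x.
    rewrite /phi normrM (ger0_norm (th0 k x)) mulrC.
    apply: le_trans (ler_piMr _ (th1 k x)) _ => //.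
    rewrite normrM (ger0_norm (ltW N0)) ler_piMr ?(ltW N0)//.
    by clear -u1 u2; rewrite ler_norml; apply/andP; split; lra.
  have dphi : `|th k x * b k x - phi x| = th k x * (2 * N) * `|phi' x - b' x|.
    rewrite /phi -mulrBr normrM (ger0_norm (th0 k x)) -mulrA; congr (_ * _).
    rewrite distrC (_ : _ - _ = 2 * N * (phi' x - b' x)); last first.
      by rewrite /b'; field; rewrite gt_eqF.
    by rewrite normrM ger0_norm// mulr_ge0// ltW.
  have h1 := powR_lip (phi x) (th k x * b k x) q1.
  have h2 : `|phi x| `^ (q - 1) <= N `^ (q - 1).
    by clear -phiN q1 N0; apply: ge0_ler_powR; rewrite ?nnegrE// ?ltW//; lra.
  have h3 : g x * (th k x * b k x - phi x) <= `|g x| * `|th k x * b k x - phi x|.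
    by rewrite -normrM ler_norm.
  have h4 : `|phi x| `^ (q - 1) * `|phi x - th k x * b k x| <= N `^ (q - 1) * `|phi x - th k x * b k x|.
    by rewrite ler_wpM2r.
  have wE : `|phi' x - b' x| * w x = p * (`|g x| * `|th k x * b k x - phi x|) +
     p * (N `^ (q - 1) * `|phi x - th k x * b k x|).
    by rewrite (distrC (phi x)) dphi /w; ring.
  rewrite wE.
  have h5 : p * (g x * (th k x * b k x - phi x)) <= p * (`|g x| * `|th k x * b k x - phi x|).
    by rewrite ler_wpM2l//; clear -p1; lra.
  have h6 : (p - 1) * (q * (`|phi x| `^ (q - 1) * `|phi x - th k x * b k x|)) <=
     p * (N `^ (q - 1) * `|phi x - th k x * b k x|).
    have -> z : (p - 1) * (q * z) = p * z by rewrite mulrA pq1.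
    by rewrite ler_wpM2l// ltW// (lt_trans ltr01).
  have h7 : (p - 1) * `|phi x| `^ q <= (p - 1) * (`|th k x * b k x| `^ q +
     q * (`|phi x| `^ (q - 1) * `|phi x - th k x * b k x|)).
    by rewrite ler_wpM2l//; clear -p1; lra.
  by clear -h5 h6 h7; rewrite mulrBr in h5; rewrite mulrDr in h7; lra.
exact: aux Hk.
Unshelve. all: by end_near. Qed.

End duality.

(** * Increments are dominated by slopes *)

Section more_integrals.
Context {d} {T : measurableType d} {R : realType}.
Variable mu : {measure set T -> \bar R}.

Lemma intg_sum (I : Type) (s : seq I) (f : I -> T -> R) :
  (forall i, intg mu (f i)) -> intg mu (fun x => \sum_(i <- s) f i x).
Proof.
move=> fi; elim: s => [|i s IH].
  under eq_fun do rewrite big_nil; exact: integrable0.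
under eq_fun do rewrite big_cons; exact: intgD.
Qed.

Lemma Rintegral_sum (I : Type) (s : seq I) (f : I -> T -> R) :
  (forall i, intg mu (f i)) ->
  \int[mu]_x (\sum_(i <- s) f i x) = \sum_(i <- s) \int[mu]_x f i x.
Proof.
move=> fi; elim: s => [|i s IH].
  under eq_Rintegral do rewrite big_nil.
  by rewrite big_nil Rintegral_cst// mul0r.
under eq_Rintegral do rewrite big_cons.
rewrite RintegralD//; [by rewrite IH big_cons | exact: fi | exact: intg_sum].
Qed.

End more_integrals.

Section weak_gradients.
Context {R : realType} {n : nat}.
Local Notation Rn := 'rV[R]_n.
Local Notation leb := (@lebesgue_rV R n).
Implicit Types (x h w : Rn) (g phi : Rn -> R).

Lemma LpiD p g1 g2 : 1 < p -> Lpi p g1 -> Lpi p g2 -> Lpi p (fun x => g1 x + g2 x).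
Proof.
move=> p1 [m1 i1] [m2 i2]; split; first exact: measurable_funD.
apply: (intg_le (g := fun x => 2 `^ p * (`|g1 x| `^ p + `|g2 x| `^ p))).
- by apply: measurable_norm_powR; exact: measurable_funD.
- by move=> x; rewrite ger0_norm ?powR_ge0//; apply: powR_add_le; lra.
- by apply: intgZ; exact: intgD.
Qed.

Lemma LpiZ p c g : Lpi p g -> Lpi p (fun x => c * g x).
Proof.
move=> [m1 i1]; split; first exact: measurable_funM.
rewrite (_ : (fun x => _) = fun x => `|c| `^ p * `|g x| `^ p); first exact: intgZ.
by apply/funext => x; rewrite normrM powRM.
Qed.

Lemma Lpi0 p : 1 < p -> Lpi p (fun _ : Rn => 0).
Proof.
move=> p1; split => //; rewrite normr0 powR0; first exact: integrable0.
by rewrite gt_eqF//; lra.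
Qed.

Lemma Lpi_sum p (I : Type) (s : seq I) (f : I -> Rn -> R) : 1 < p ->
  (forall i, Lpi p (f i)) -> Lpi p (fun x => \sum_(i <- s) f i x).
Proof.
move=> p1 fi; elim: s => [|i s IH].
  by under eq_fun do rewrite big_nil; exact: Lpi0.
by under eq_fun do rewrite big_cons; exact: LpiD.
Qed.

Lemma Lpi_norm p g : Lpi p g -> Lpi p (fun x => `|g x|).
Proof.
move=> [m1 i1]; split; first exact: measurableT_comp.
by under eq_fun do rewrite normr_id.
Qed.

Lemma Rintegral_shift g h : intg leb g ->
  \int[leb]_x g (x + h) = \int[leb]_x g x.
Proof.
by move=> ig; congr fine; exact: (integral_preserves (preserves_leb_shift h) ig).
Qed.

Lemma intg_shift g h : intg leb g -> intg leb (fun x => g (x + h)).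
Proof. by move=> ig; exact: (integrable_preserves (preserves_leb_shift h) ig). Qed.

Lemma Lpi_shift p g h : Lpi p g -> Lpi p (fun x => g (x + h)).
Proof.
move=> [mg ig]; split; first by apply: measurableT_comp => //; exact: measurable_addrV.
exact: (intg_shift h ig).
Qed.

Variables (p : R) (u : Rn -> R) (G : Rn -> Rn).
Hypotheses (p1 : 1 < p) (Lu : Lpi p u) (LG : forall i, Lpi p (fun x => G x ord0 i)).
Hypothesis weak : forall phi i, Cc_infty phi ->
  \int[leb]_x (u x * partial i phi x) = - \int[leb]_x (G x ord0 i * phi x).

Let p0 : 0 < p. Proof. exact: lt_trans p1. Qed.

Definition diff_energy h := \int[leb]_x (`|u x - u (x - h)| `^ p).
Definition slope_energy h := \int[leb]_x (`|dot h (G x)| `^ p).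

Lemma Lpi_dot h : Lpi p (fun x => dot h (G x)).
Proof. by apply: Lpi_sum => // i; exact: LpiZ. Qed.

Lemma Lpi_diff h : Lpi p (fun x => u x - u (x - h)).
Proof.
apply: LpiD => //.
have := LpiZ (-1) (Lpi_shift (- h) Lu).
by under eq_fun do rewrite mulN1r.
Qed.

(** The defining identity of a weak gradient, summed over the coordinates of
    [h]. *)
Lemma weak_dot h phi : Cc_infty phi ->
  \int[leb]_x (u x * dot h (grad phi x)) = - \int[leb]_x (dot h (G x) * phi x).
Proof.
move=> cphi.
have i1 i : intg leb (fun x => u x * partial i phi x).
  by apply: (Lpi_mul_Cc p1 Lu); exact: Cc_partial.
have i2 i : intg leb (fun x => G x ord0 i * phi x) by exact: (Lpi_mul_Cc p1 (LG i)).
transitivity (\int[leb]_x \sum_i (h ord0 i * (u x * partial i phi x))).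
  apply: eq_Rintegral => x _; rewrite /dot mulr_sumr; apply: eq_bigr => i _.
  by rewrite mxE mulrCA.
rewrite Rintegral_sum; last by move=> i; exact: intgZ.
transitivity (- \int[leb]_x \sum_i (h ord0 i * (G x ord0 i * phi x))); last first.
  congr (- _); apply: eq_Rintegral => x _; rewrite /dot mulr_suml.
  by apply: eq_bigr => i _; rewrite mulrA.
rewrite Rintegral_sum; last by move=> i; exact: intgZ.
rewrite -sumrN; apply: eq_bigr => i _.
rewrite RintegralZl; [|exact: measurableT|exact: i1].
rewrite RintegralZl; [|exact: measurableT|exact: i2].
by rewrite weak// mulrN.
Qed.

Lemma intg_u_ball M : intg leb (fun x => `|u x| * \1_[set x : Rn | enorm x <= M] x).
Proof.
apply: (intg_le (g := fun x => \1_[set x : Rn | enorm x <= M] x + `|u x| `^ p)).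
- apply: measurable_funM; first by apply: measurableT_comp => //; exact: Lu.1.
  by apply: measurable_indic; exact: measurable_eball.
- move=> x; rewrite normrM normr_id indicE; case: (x \in _) => /=.
    by rewrite normr1 mulr1; apply: powR_ge_id; exact: ltW.
  by rewrite normr0 mulr0 add0r powR_ge0.
- by apply: intgD; [exact: intg_ball | exact: Lu.2].
Qed.

(** First-order expansion of the integral of u phi(. + h) in [h]: the linear term
    of phi is integrated by parts and the Taylor remainder is compactly
    supported. *)
Lemma increment_weak phi : Cc_infty phi -> exists2 C, 0 <= C &
  forall h, enorm h <= 1 ->
  `|\int[leb]_x (u x * phi (x + h)) - \int[leb]_x (u x * phi x)
    + \int[leb]_x (dot h (G x) * phi x)| <= C * enorm h ^+ 2.
Proof.
move=> cphi; have [C [M [C0 M0 HC]]] := Cc_taylor_cpt cphi.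
pose A := \int[leb]_x (`|u x| * \1_[set x : Rn | enorm x <= M] x).
exists (C * A) => [|h h1].
  by rewrite mulr_ge0//; apply: Rintegral_ge0 => x _; rewrite mulr_ge0.
have i1 : intg leb (fun x => u x * phi (x + h)).
  by apply: (Lpi_mul_Cc p1 Lu); exact: Cc_shift.
have i2 : intg leb (fun x => u x * phi x) by exact: (Lpi_mul_Cc p1 Lu).
have i3 : intg leb (fun x => u x * dot h (grad phi x)).
  rewrite (_ : (fun x => _) = fun x => \sum_i (h ord0 i * (u x * partial i phi x))).
    by apply: intg_sum => i; apply: intgZ; apply: (Lpi_mul_Cc p1 Lu); exact: Cc_partial.
  apply/funext => x; rewrite /dot mulr_sumr; apply: eq_bigr => i _.
  by rewrite mxE mulrCA.
rewrite -[X in _ + X]opprK -weak_dot// -RintegralB// -RintegralB//; last exact: intgB.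
apply: le_trans (le_normr_Rintegral _ _) _ => //; first by apply: intgB => //; exact: intgB.
rewrite -mulrA (mulrC A) mulrA -RintegralZl//; last exact: intg_u_ball.
apply: le_Rintegral => //.
- by apply: intg_norm; apply: intgB => //; exact: intgB.
- by apply: intgZ; exact: intg_u_ball.
move=> x _; rewrite -!mulrBr normrM [leRHS]mulrCA.
by apply: ler_wpM2l => //; exact: HC.
Qed.

Lemma diff_pairing h phi : Cc_infty phi ->
  \int[leb]_x ((u x - u (x - h)) * phi x) =
  \int[leb]_x (u x * phi x) - \int[leb]_x (u x * phi (x + h)).
Proof.
move=> cphi.
have i1 : intg leb (fun x => u x * phi (x + h)).
  by apply: (Lpi_mul_Cc p1 Lu); exact: Cc_shift.
have i2 : intg leb (fun x => u x * phi x) by exact: (Lpi_mul_Cc p1 Lu).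
rewrite -(Rintegral_shift (- h) i1) -RintegralB//; last exact: (intg_shift (- h) i1).
by apply: eq_Rintegral => x _; rewrite subrK mulrBl.
Qed.

(** The mean value theorem for t |-> the integral of u phi(. + t h), whose
    derivative is given by [increment_weak]. Tested against phi, an increment of
    u is therefore a slope tested against a translate of phi. *)
Lemma diff_pairing_MVT h phi : Cc_infty phi -> exists t : R,
  \int[leb]_x ((u x - u (x - h)) * phi x) =
  \int[leb]_x (dot h (G x) * phi (x + t *: h)).
Proof.
move=> cphi.
pose E (t : R) := \int[leb]_x (u x * phi (x + t *: h)).
pose D (t : R) := - \int[leb]_x (dot h (G x) * phi (x + t *: h)).
have dE t : is_derive t (1 : R) E (D t).
  have [C C0 HC] := increment_weak (Cc_shift (t *: h) cphi).
  have c : (fun s : R => s^-1 *: ((E \o shift t) (s *: (1 : R)) - E t)) @ 0^' --> D t.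
    pose K := C * enorm h ^+ 2.
    have K0 : 0 <= K by rewrite mulr_ge0// exprn_ge0// enorm_ge0.
    apply/cvgrPdist_lt => e e0; near=> s.
    have s0 : s != 0 by near: s; exact: nbhs_dnbhs_neq.
    have ns0 : 0 < `|s| by rewrite normr_gt0.
    have sh1 : enorm (s *: h) <= 1.
      rewrite enormZ.
      have : `|s| < (enorm h + 1)^-1.
        by near: s; apply: dnbhs0_lt; rewrite invr_gt0 ltr_wpDl// enorm_ge0.
      rewrite -[X in _ < X]mul1r ltr_pdivlMr; last by rewrite ltr_wpDl// enorm_ge0.
      by rewrite mulrDr mulr1; have := normr_ge0 s; lra.
    have sK : `|s| * K < e.
      have : `|s| < e / (K + 1).
        by near: s; apply: dnbhs0_lt; rewrite divr_gt0// ltr_wpDl.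
      by rewrite ltr_pdivlMr ?ltr_wpDl// mulrDr mulr1; lra.
    have := HC _ sh1; rewrite enormZ exprMn.
    have -> : (\int[leb]_x (u x * phi (x + s *: h + t *: h))) = E (s + t).
      by apply: eq_Rintegral => x _; rewrite scalerDl addrA.
    rewrite -/(E t).
    have -> : \int[leb]_x (dot (s *: h) (G x) * phi (x + t *: h)) = - (s * D t).
      rewrite /D mulrN opprK -RintegralZl//; last first.
        by apply: (Lpi_mul_Cc p1 (Lpi_dot h)); exact: Cc_shift.
      by apply: eq_Rintegral => x _; rewrite dotZl mulrA.
    move=> H; rewrite /= (_ : s *: (1 : R) = s); last exact: mulr1.
    rewrite -(ltr_pM2l ns0) -normrM mulrBr /GRing.scale/= mulrA divff// mul1r distrC.
    apply: le_lt_trans H _.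
    rewrite mulrCA -/K expr2 -mulrA ltr_pM2l//.
  by apply: DeriveDef; [exact: (cvgP _ c) | exact: (cvg_lim _ c)].
have cE : continuous E.
  by move=> t; apply: differentiable_continuous; apply/derivable1_diffP; have [] := dE t.
have [t _ e] := MVT_segment ler01 (fun t _ => dE t) (continuous_subspaceT cE).
exists t; rewrite diff_pairing//.
have -> : \int[leb]_x (u x * phi x) = E 0.
  by apply: eq_Rintegral => x _; rewrite scale0r addr0.
have -> : \int[leb]_x (u x * phi (x + h)) = E 1.
  by apply: eq_Rintegral => x _; rewrite scale1r.
by rewrite -opprB e subr0 mulr1 opprK.
Unshelve. all: by end_near. Qed.

(** Translating the test function changes neither its conjugate norm nor the
    supremum over test functions, so the duality formula for the increment is
    bounded by that for the slope. *)
Lemma diff_energy_le h : diff_energy h <= slope_energy h.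
Proof.
apply/ler_addgt0Pr => eta eta0.
have [phi cphi] := pairing_sup p1 (Lpi_diff h) eta0.
rewrite -/(diff_energy h) lerBlDr => /le_trans; apply; rewrite lerD2r.
rewrite pairingE//; last exact: Lpi_diff.
have [t ->] := diff_pairing_MVT h cphi.
have cphit := Cc_shift (t *: h) cphi.
have iphi : intg leb (fun x => `|phi x| `^ conj_exp p).
  by apply: Cc_intg_powR => //; have [? _ _ _] := conj_expP p1; lra.
rewrite -(Rintegral_shift (t *: h) iphi).
rewrite -pairingE//; last exact: Lpi_dot.
exact: pairing_le (Lpi_dot h) cphit.
Qed.

End weak_gradients.

(** * Slopes are dominated by small increments *)

Section lower_bound.
Context {R : realType} {n : nat}.
Local Notation Rn := 'rV[R]_n.
Local Notation leb := (@lebesgue_rV R n).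
Implicit Types (x h w : Rn) (g phi : Rn -> R).
Variables (p : R) (u : Rn -> R) (G : Rn -> Rn).
Hypotheses (p1 : 1 < p) (Lu : Lpi p u) (LG : forall i, Lpi p (fun x => G x ord0 i)).
Hypothesis weak : forall phi i, Cc_infty phi ->
  \int[leb]_x (u x * partial i phi x) = - \int[leb]_x (G x ord0 i * phi x).

Let p0 : 0 < p. Proof. exact: lt_trans p1. Qed.

Lemma slope_energyZ r w : slope_energy p G (r *: w) = `|r| `^ p * slope_energy p G w.
Proof.
rewrite /slope_energy -RintegralZl//; last exact: (Lpi_dot p1 LG w).2.
by apply: eq_Rintegral => x _; rewrite dotZl normrM powRM.
Qed.

(** Test the increment by r w against r^(p-1) phi: all terms then scale like
    r^p, and the first-order expansion leaves an error of relative size r.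
    The constant depends on phi but not on the direction [w]. *)
Lemma diff_energy_ge phi : Cc_infty phi -> exists2 C, 0 <= C &
  forall (r : R) w, 0 < r <= 1 -> enorm w = 1 ->
  r `^ p * (pairing p (fun x => dot w (G x)) phi - C * r) <=
  diff_energy p u (r *: w).
Proof.
move=> cphi; have [C C0 HC] := increment_weak p1 Lu LG weak cphi.
exists (p * C) => [|r w /andP[r0 r1] w1]; first by rewrite mulr_ge0// ltW.
set h := r *: w; have hr : enorm h = r by rewrite enormZ w1 mulr1 gtr0_norm.
have /HC : enorm h <= 1 by rewrite hr.
rewrite hr => H.
pose psi x := r `^ (p - 1) * phi x.
have cpsi : Cc_infty psi by exact: CcZ.
have := pairing_le p1 (Lpi_diff p1 Lu h) cpsi.
rewrite -/(diff_energy p u h) => /(le_trans _); apply.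
have iphi : intg leb (fun x => `|phi x| `^ conj_exp p).
  by apply: Cc_intg_powR => //; have [? _ _ _] := conj_expP p1; lra.
rewrite (pairingE p1 (Lpi_dot p1 LG w) cphi) (pairingE p1 (Lpi_diff p1 Lu h) cpsi).
have -> : \int[leb]_x (`|psi x| `^ conj_exp p) =
    r `^ p * \int[leb]_x (`|phi x| `^ conj_exp p).
  rewrite -RintegralZl//; apply: eq_Rintegral => x _.
  rewrite /psi normrM (ger0_norm (powR_ge0 _ _)) powRM ?powR_ge0// -powRrM.
  by have [_ _ -> _] := conj_expP p1.
have -> : \int[leb]_x ((u x - u (x - h)) * psi x) =
    r `^ (p - 1) * \int[leb]_x ((u x - u (x - h)) * phi x).
  rewrite -RintegralZl//; last exact: (Lpi_mul_Cc p1 (Lpi_diff p1 Lu h)).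
  by apply: eq_Rintegral => x _; rewrite mulrCA.
rewrite (diff_pairing p1 Lu h cphi).
have E : \int[leb]_x (dot h (G x) * phi x) = r * \int[leb]_x (dot w (G x) * phi x).
  rewrite -RintegralZl//; last exact: (Lpi_mul_Cc p1 (Lpi_dot p1 LG w)).
  by apply: eq_Rintegral => x _; rewrite dotZl mulrA.
move: H; rewrite E.
rewrite -(@mulr_powRB1 _ r p (ltW r0) p0).
have P0 : 0 <= r `^ (p - 1) by exact: powR_ge0.
move: P0; move: (r `^ (p - 1)) => P P0.
move: (\int[leb]_x (u x * phi x)) (\int[leb]_x (u x * phi (x + h))) => a b.
move: (\int[leb]_x (dot w (G x) * phi x)) (\int[leb]_x (`|phi x| `^ conj_exp p)) => c e.
rewrite ler_norml => /andP[_ H].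
have {}H : P * (r * c - C * r ^+ 2) <= P * (a - b) by rewrite ler_wpM2l//; lra.
have {}H : p * (P * (r * c - C * r ^+ 2)) <= p * (P * (a - b)) by rewrite ler_pM2l.
rewrite expr2 in H; lra.
Qed.

(** A function of L^p that dominates |dot w (G x)| and its oscillation in [w]. *)
Let M x := \sum_i `|G x ord0 i|.

Let LM : Lpi p M.
Proof. by apply: Lpi_sum => // i; apply: Lpi_norm; exact: LG. Qed.

Let dotM w x : `|dot w (G x)| <= `|w| * M x.
Proof.
rewrite /M mulr_sumr; apply: le_trans (ler_norm_sum _ _ _) _; apply: ler_sum => i _.
by rewrite normrM ler_wpM2r// le_coord_norm.
Qed.

Lemma slope_energy_lip w w' : `|w'| <= 1 ->
  slope_energy p G w' <= slope_energy p G w + p * `|w' - w| * \int[leb]_x (`|M x| `^ p).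
Proof.
move=> w1; have i1 := (Lpi_dot p1 LG w).2; have i2 := (Lpi_dot p1 LG w').2.
rewrite /slope_energy -RintegralZl//; last exact: LM.2.
rewrite -RintegralD//; last by apply: intgZ; exact: LM.2.
apply: le_Rintegral => //; first by apply: intgD => //; apply: intgZ; exact: LM.2.
move=> x _; apply: le_trans (powR_lip _ (dot w (G x)) p1) _; rewrite lerD2l -mulrA.
rewrite ler_pM2l// -dotBl.
have M0 : 0 <= M x by exact: sumr_ge0.
rewrite (ger0_norm M0) -(@mulr_powRB1 _ (M x) p)// mulrA [leRHS]mulrC.
apply: ler_pM => //; rewrite ?powR_ge0//.
apply: ge0_ler_powR; rewrite ?nnegrE//; first by rewrite subr_ge0 ltW.
by apply: le_trans (dotM _ _) _; rewrite ler_piMl.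
Qed.

Lemma pairing_lip phi : Cc_infty phi -> exists2 A, 0 <= A & forall w w',
  pairing p (fun x => dot w (G x)) phi - A * `|w' - w| <=
  pairing p (fun x => dot w' (G x)) phi.
Proof.
move=> cphi.
have iM : intg leb (fun x => `|M x * phi x|) by apply: intg_norm; exact: (Lpi_mul_Cc p1 LM).
exists (p * \int[leb]_x `|M x * phi x|) => [|w w'].
  by rewrite mulr_ge0 ?(ltW p0)//; apply: Rintegral_ge0.
have i1 := Lpi_mul_Cc p1 (Lpi_dot p1 LG w) cphi.
have i2 := Lpi_mul_Cc p1 (Lpi_dot p1 LG w') cphi.
rewrite (pairingE p1 (Lpi_dot p1 LG w) cphi) (pairingE p1 (Lpi_dot p1 LG w') cphi).
rewrite addrAC lerD2r -mulrA -mulrBr ler_pM2l// lerBlDr -lerBlDl.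
rewrite -RintegralB// mulrC -RintegralZl//.
apply: le_Rintegral => //; [exact: intgB|exact: intgZ|].
move=> x _; rewrite -mulrBl -dotBl; apply: le_trans (ler_norm _) _.
rewrite normrM normrM mulrA ler_wpM2r// distrC.
have M0 : 0 <= M x by exact: sumr_ge0.
by rewrite (ger0_norm M0) dotM.
Qed.

Lemma near_dist_le x (e : R) : 0 < e -> \forall y \near x, `|x - y| <= e.
Proof.
move=> e0; apply/nbhs_ballP; exists e => // y.
by rewrite -ball_normE/= => /ltW.
Qed.

Lemma compact_sphere : compact [set w : Rn | enorm w = 1].
Proof.
apply: bounded_closed_compact.
  exists 1; split; first exact: num_real.
  by move=> r r1 w /= w1; rewrite (le_trans (norm_le_enorm w))// w1 ltW.
have cn : continuous (@enorm R n).
  move=> x; have Fx := nbhs_filter x; apply/(@cvgrPdist_le _ _ _ (nbhs x)) => e e0.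
  have e1 : 0 < e / n.+1%:R by exact: divr_gt0.
  apply: (@filterS _ (nbhs x) (nbhs_filter x) _ _ _ (near_dist_le x e1)) => y /=.
  rewrite ler_pdivlMr// mulrC => xy; have := enorm_le_norm (x - y).
  have : n%:R * `|x - y| <= n.+1%:R * `|x - y| by rewrite ler_wpM2r// ler_nat.
  have h1 := enormD (x - y) y; rewrite subrK in h1.
  have h2 := enormD (y - x) x; rewrite subrK -opprB enormN in h2.
  by move=> a b; rewrite ler_norml; apply/andP; split; lra.
rewrite (_ : [set w : Rn | _] = @enorm R n @^-1` [set 1])//.
by apply: closed_comp; [move=> y _; exact: cn | exact: closed_eq].
Qed.

(** In a fixed direction, an almost optimal phi in [diff_energy_ge] does it for
    small r. Both the slope energy and the pairing are Lipschitz in the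
    direction, so the same phi serves nearby directions, and the unit sphere is
    compact. *)
Lemma slope_energy_small eta : 0 < eta -> exists rho : R, [/\ 0 < rho, rho <= 1 &
  forall h, enorm h <= rho ->
    slope_energy p G h <= diff_energy p u h + eta * enorm h `^ p].
Proof.
move=> eta0.
have eta3 : 0 < eta / 4 by rewrite divr_gt0.
pose A0 := \int[leb]_x (`|M x| `^ p).
have A00 : 0 <= A0 by apply: Rintegral_ge0 => x _; exact: powR_ge0.
have : \forall r \near 0^'+, [set w : Rn | enorm w = 1] `<=`
    (fun w => r `^ p * (slope_energy p G w - eta) <= diff_energy p u (r *: w)).
  have /compact_near_coveringP/near_covering_withinP := compact_sphere; apply.
  move=> w w1.
  have [phi cphi H1] := pairing_sup p1 (Lpi_dot p1 LG w) eta3.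
  have [C C0 H2] := diff_energy_ge cphi.
  have [A AA0 H3] := pairing_lip cphi.
  near=> w' r => /= w'1.
  have r0 : 0 < r by near: r; exact: nbhs_right_gt.
  have r1 : r <= 1 by near: r; exact: nbhs_right_le.
  apply: le_trans (H2 r w' _ w'1); last by rewrite r0.
  rewrite ler_pM2l ?powR_gt0//.
  (* eta / 4 is lost in the choice of phi, in the radius r and in the direction *)
  have C1 : C * r <= eta / 4.
    have : r < eta / 4 / (C + 1) by near: r; apply: nbhs_right_lt; rewrite divr_gt0// ltr_wpDl.
    by rewrite ltr_pdivlMr ?ltr_wpDl//; lra.
  have d1 : (A + p * A0 + 1) * `|w' - w| <= eta / 4.
    rewrite mulrC -ler_pdivlMr; last by rewrite ltr_wpDl// addr_ge0// mulr_ge0// ltW.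
    rewrite distrC; near: w'.
    apply: near_dist_le.
    by rewrite divr_gt0// ltr_wpDl// addr_ge0// mulr_ge0// ltW.
  have w'n : `|w'| <= 1 by rewrite -w'1 norm_le_enorm.
  have H4 := slope_energy_lip w w'n.
  have H5 := H3 w w'.
  move: H1 H4 H5 d1 C1; rewrite -/A0 -/(slope_energy p G w).
  have d0 : 0 <= `|w' - w| by [].
  move: d0; move: `|w' - w| => dd d0.
  move: (slope_energy p G w) (slope_energy p G w') => s s'.
  move: (pairing _ _ _) (pairing _ _ _) => q q'.
  rewrite !mulrDl mul1r.
  have : 0 <= p * A0 * dd by rewrite !mulr_ge0// ltW.
  have : 0 <= A * dd by rewrite mulr_ge0.
  by rewrite mulrAC => *; lra.
move=> /nbhs_ballP[e /= e0 He].
have De0 h : 0 <= diff_energy p u h by apply: Rintegral_ge0 => x _; exact: powR_ge0.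
exists (Num.min (e / 2) 1); split.
- by rewrite lt_min divr_gt0//= ltr01.
- by rewrite ge_min lexx orbT.
move=> h; rewrite le_min => /andP[he h1].
have [->|h0] := eqVneq h 0.
  rewrite enorm0 -(scale0r (0 : Rn)) slope_energyZ normr0 powR0 ?gt_eqF// mul0r mulr0 addr0.
  exact: De0.
have nh : 0 < enorm h by rewrite enorm_gt0.
pose w := (enorm h)^-1 *: h.
have w1 : enorm w = 1.
  by rewrite enormZ ger0_norm ?invr_ge0 ?enorm_ge0// mulVf ?gt_eqF.
have hw : enorm h *: w = h by rewrite scalerA divff ?gt_eqF// scale1r.
have := He (enorm h) _ nh w w1; rewrite hw => H.
rewrite -[in leLHS]hw slope_energyZ ger0_norm ?enorm_ge0//.
have : enorm h `^ p * (slope_energy p G w - eta) <= diff_energy p u h.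
  apply: H; rewrite -ball_normE/= sub0r normrN ger0_norm ?enorm_ge0//.
  by rewrite (le_lt_trans he)// ltr_pdivrMr// ltr_pMr// ltr1n.
by rewrite mulrBr lerBlDr (mulrC eta).
Unshelve. all: by end_near. Qed.

End lower_bound.

(** * Energies as integrals over increments, and the sphere constant *)

Section energy_formula.
Context {R : realType} {n : nat}.
Local Notation Rn := 'rV[R]_n.
Local Notation leb := (@lebesgue_rV R n).
Implicit Types (x y h : Rn) (u k : Rn -> R).

Lemma measurable_diff u : measurable_fun setT u ->
  measurable_fun setT (fun z : Rn * Rn => u z.1 - u (z.1 - z.2)).
Proof.
move=> mu; apply: measurable_funB; apply: (measurableT_comp mu) => //.
exact: measurable_subV.
Qed.

(** Substitute y = x - h in the inner integral and exchange the order. *)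
Lemma double_integral_diff p k u : 1 < p -> Lpi p u -> measurable_fun setT k ->
  (forall h, 0 <= k h) ->
  (\int[leb]_x \int[leb]_y (`|u x - u y| `^ p * k (x - y))%:E =
   \int[leb]_h (k h * diff_energy p u h)%:E)%E.
Proof.
move=> p1 Lu mk k0.
pose f (z : Rn * Rn) : \bar R := (`|u z.1 - u (z.1 - z.2)| `^ p * k z.2)%:E.
have mf : measurable_fun setT f.
  apply/measurable_EFinP; apply: measurable_funM.
    by apply: measurable_norm_powR; apply: measurable_diff; exact: Lu.1.
  exact: measurableT_comp.
have f0 z : (0 <= f z)%E by rewrite lee_fin mulr_ge0// powR_ge0.
transitivity (\int[leb]_x \int[leb]_h f (x, h))%E.
  apply: eq_integral => x _.
  have mfx : measurable_fun setT (fun h => f (x, h)) by exact: measurableT_comp.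
  apply: etrans (ge0_integral_sub x mfx (fun h => f0 (x, h))).
  by apply: eq_integral => y _; rewrite /f/= subKr.
rewrite fubini_tonelli//; apply: eq_integral => h _.
rewrite mulrC EFinM /diff_energy (EFin_Rintegral (Lpi_diff p1 Lu h).2).
rewrite -ge0_integralZr//; last by rewrite lee_fin.
by apply/measurable_EFinP; apply: intg_measurable (Lpi_diff p1 Lu h).2.
Qed.

Lemma measurable_diff_energy p u : 1 < p -> Lpi p u ->
  measurable_fun setT (diff_energy p u).
Proof.
move=> p1 Lu; apply/measurable_EFinP.
pose f (z : Rn * Rn) : \bar R := (`|u z.1 - u (z.1 - z.2)| `^ p)%:E.
have mf : measurable_fun setT f.
  apply/measurable_EFinP.
  by apply: measurable_norm_powR; apply: measurable_diff; exact: Lu.1.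
have f0 z : (0 <= f z)%E by rewrite lee_fin powR_ge0.
rewrite (_ : EFin \o _ = fun h => \int[leb]_x f (x, h))%E.
  exact: (@measurable_fun_fubini_tonelli_G _ _ _ _ _ leb f mf f0).
by apply/funext => h /=; rewrite /diff_energy (EFin_Rintegral (Lpi_diff p1 Lu h).2).
Qed.

End energy_formula.

Section image_measure.
Local Open Scope ereal_scope.
Context d1 d2 (X : measurableType d1) (Y : measurableType d2) (R : realType).
Variables (m1 : {measure set Y -> \bar R}) (m2 : {measure set X -> \bar R}).
Variables (phi : X -> Y) (mphi : measurable_fun setT phi).
Variables (D : set X) (mD : measurable D) (k : {nonneg R}).
Hypothesis m12 : forall A, measurable A -> m1 A = k%:num%:E * m2 (phi @^-1` A `&` D).

(** Integration against a scaled image of a restricted measure, in the form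
    taken by the surface measure of the sphere. *)
Lemma ge0_integral_image (f : Y -> \bar R) : measurable_fun setT f ->
  (forall y, 0 <= f y) ->
  \int[m1]_y f y = k%:num%:E * \int[m2]_(x in D) f (phi x).
Proof.
move=> mf f0.
pose mP := @measure_function_pushforward__canonical__measure_function_Measure
  _ _ _ _ R (mrestr m2 mD) phi mphi.
rewrite (@eq_measure_integral _ _ _ _ (mscale k mP)); last first.
  by move=> A mA _; rewrite m12.
rewrite ge0_integral_mscale//; congr (_ * _).
rewrite /mP (ge0_integral_pushforward mphi)// preimage_setT.
have mfphi E : measurable_fun E (f \o phi).
  by apply: measurable_funTS; exact: measurableT_comp.
have mDC : measurable (~` D) by exact: measurableC.
have dD : [disjoint D & ~` D] by apply/disj_setPCl.
rewrite -(setUv D) ge0_integral_setU//.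
  rewrite (@eq_measure_integral _ _ _ D m2); last first.
    by move=> A mA AP; rewrite /= /mrestr setIidl.
  rewrite (@eq_measure_integral _ _ _ (~` D) mzero); last first.
    move=> A mA AP; rewrite /= /mrestr /mzero (_ : _ `&` _ = set0) ?measure0//.
    by apply/seteqP; split => x // -[/AP].
  by rewrite integral_measure_zero adde0.
by move=> x _; exact: f0.
Qed.

End image_measure.

Section radial_moments.
Context {R : realType} {n : nat}.
Local Notation Rn := 'rV[R]_n.+1.
Local Notation leb := (@lebesgue_rV R n.+1).
Local Notation e := (delta_mx ord0 ord_max : Rn).
Implicit Types (a b h x : Rn) (kappa : R -> R) (p : R).

Definition nonneg_profile kappa := measurable_fun [set: measurableTypeR R] kappa /\ forall r, 0 <= kappa r.

Lemma measurable_profile kappa : nonneg_profile kappa ->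
  measurable_fun setT (fun h => kappa (enorm h)).
Proof. by move=> [mk _]; apply: (measurableT_comp mk (@measurable_enorm R n.+1)). Qed.

Definition moment p kappa a : \bar R :=
  (\int[leb]_h (kappa (enorm h) * `|dot a h| `^ p)%:E)%E.

Lemma measurable_moment_integrand p kappa a : nonneg_profile kappa ->
  measurable_fun setT (fun h => (kappa (enorm h) * `|dot a h| `^ p)%:E).
Proof.
move=> pk; apply/measurable_EFinP; apply: measurable_funM; first exact: measurable_profile.
by apply: measurable_norm_powR; exact: measurable_dot.
Qed.

(** The reflection exchanging [a] and [b] preserves both the volume and |h|. *)
Lemma moment_rot p kappa a b : nonneg_profile kappa -> enorm a = enorm b ->
  moment p kappa a = moment p kappa b.
Proof.
move=> pk ab; have [->//|nab] := eqVneq a b.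
have v0 : a - b != 0 by rewrite subr_eq0.
have Tb : reflect_along (a - b) b = a.
  by rewrite -[X in reflect_along _ X](reflect_swap nab ab) reflectK.
have pT := preserves_leb_reflect v0.
rewrite /moment -(ge0_integral_preserves pT (measurable_moment_integrand p b pk)).
  apply: eq_integral => h _ /=; rewrite enorm_reflect//.
  by rewrite -dot_reflect Tb.
by move=> h; rewrite lee_fin mulr_ge0 ?powR_ge0//; exact: pk.2.
Qed.

Lemma momentE p kappa a : nonneg_profile kappa ->
  moment p kappa a = ((enorm a `^ p)%:E * moment p kappa e)%E.
Proof.
move=> pk.
rewrite (@moment_rot p kappa a (enorm a *: e))//; last first.
  by rewrite enormZ enorm_delta mulr1 ger0_norm ?enorm_ge0.
rewrite /moment -ge0_integralZl//.
- apply: eq_integral => h _; rewrite -EFinM; congr EFin.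
  by rewrite dotZl normrM powRM// ger0_norm ?enorm_ge0// mulrCA.
- exact: measurable_moment_integrand.
- by move=> h _; rewrite lee_fin mulr_ge0 ?powR_ge0//; exact: pk.2.
- by rewrite lee_fin powR_ge0.
Qed.

(** Integrating over h first leaves only the length of [f x]. *)
Lemma moment_swap p kappa (f : Rn -> Rn) (g : Rn -> R) : nonneg_profile kappa ->
  measurable_fun setT f -> measurable_fun setT g -> (forall x, 0 <= g x) ->
  (\int[leb]_h \int[leb]_x (kappa (enorm h) * (g x * `|dot (f x) h| `^ p))%:E =
   moment p kappa e * \int[leb]_x (g x * enorm (f x) `^ p)%:E)%E.
Proof.
move=> pk mf mg g0.
pose F (z : Rn * Rn) : \bar R := (kappa (enorm z.1) * (g z.2 * `|dot (f z.2) z.1| `^ p))%:E.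
have mF : measurable_fun setT F.
  apply/measurable_EFinP; apply: measurable_funM.
    by apply: (measurableT_comp (measurable_profile pk)).
  apply: measurable_funM; first exact: measurableT_comp.
  apply: measurable_norm_powR; apply: measurable_dot2 => //.
  exact: measurableT_comp.
have F0 z : (0 <= F z)%E.
  by rewrite lee_fin mulr_ge0//; [exact: pk.2 | rewrite mulr_ge0 ?powR_ge0].
rewrite (fubini_tonelli F)//.
rewrite -ge0_integralZl//; first apply: eq_integral => x _.
- rewrite EFinM muleCA (muleC (moment _ _ _)) -momentE// -ge0_integralZl//.
  + by apply: eq_integral => h _; rewrite -EFinM /F/= mulrCA.
  + exact: measurable_moment_integrand.
  + by move=> h _; rewrite lee_fin mulr_ge0 ?powR_ge0//; exact: pk.2.
  + by rewrite lee_fin.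
- apply/measurable_EFinP; apply: measurable_funM => //.
  apply: (measurableT_comp (measurable_powR p)).
  exact: (measurableT_comp (@measurable_enorm R n.+1)).
- by move=> x _; rewrite lee_fin mulr_ge0 ?powR_ge0.
- apply: integral_ge0 => h _; rewrite lee_fin mulr_ge0 ?powR_ge0//; exact: pk.2.
Qed.

(** With this profile |dot a h|^p becomes |dot a (h / |h|)|^p on the punctured
    unit ball, the integrand that defines the sphere constant. *)
Definition unit_profile p (r : R) : R := \1_[set r : measurableTypeR R | 0 < r <= 1] r * r `^ (- p).

Lemma unit_profileP p : nonneg_profile (unit_profile p).
Proof.
split.
  apply: measurable_funM; last exact: measurable_powR.
  apply: measurable_indic.
  rewrite (_ : [set r | _] = `]0, 1]%classic); first exact: measurable_itv.
  by apply/seteqP; split => r /=; rewrite in_itv.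
by move=> r; rewrite mulr_ge0 ?powR_ge0.
Qed.

Lemma unit_profile_norm p h : p != 0 ->
  unit_profile p (enorm h) * enorm h `^ p = \1_(@punctured_ball R n.+1) h.
Proof.
move=> p0; rewrite /unit_profile !indicE.
have -> : (h \in @punctured_ball R n.+1) = (enorm h \in [set r : measurableTypeR R | 0 < r <= 1]).
  by apply/idP/idP => /set_mem ?; apply/mem_set.
case: (boolP (enorm h \in _)) => [/set_mem/= /andP[h0 _]|_]; last by rewrite !mul0r.
by rewrite !mul1r powRN mulVf// gt_eqF// powR_gt0.
Qed.

Let PB := @punctured_ball R n.+1.

Lemma lebesgue_rV_set0 : leb [set 0] = 0%E.
Proof.
have -> : [set 0] = [set x : Rn | forall i, [set (0 : measurableTypeR R)] (x ord0 i)].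
  apply/seteqP; split => x /=; first by move=> -> i; rewrite mxE.
  by move=> x0; apply/rowP => i; rewrite mxE x0.
rewrite (@lebesgue_rV_box R n.+1 (fun=> [set 0])) => [|i]; last exact: measurable_set1.
by rewrite big_ord_recl lebesgue_measure_set1 mul0e.
Qed.

(** The origin has volume 0, and the unit ball contains a cube and is
    contained in one. *)
Lemma punctured_ball_pos : (0 < leb PB)%E /\ (leb PB < +oo)%E.
Proof.
have mPB : measurable PB by exact: measurable_punctured_ball.
have sub : PB `<=` [set x : Rn | enorm x <= 1] by move=> x /andP[].
split; last first.
  apply: le_lt_trans (eball_fin 1); apply: le_measure; rewrite ?inE//.
  exact: measurable_eball.
have m0 : measurable [set (0 : Rn)].
  rewrite (_ : [set 0] = [set x : Rn | enorm x <= 0]); first exact: measurable_eball.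
  apply/seteqP; split => [x ->|x /= x0]; first by rewrite /= enorm0.
  by apply/eqP; rewrite -enorm_eq0 eq_le x0 enorm_ge0.
have <- : leb (PB `|` [set 0]) = leb PB.
  rewrite measureU//; first by rewrite [X in (_ + X)%E]lebesgue_rV_set0 adde0.
  by apply/seteqP; split => x //= [] /[swap] ->; rewrite /PB/punctured_ball/= enorm0 ltxx.
apply: (@lt_le_trans _ _ (leb [set x : Rn | (enorm x <= 1)%R])).
  exact: eball_pos.
apply: le_measure; rewrite ?inE//.
- exact: measurable_eball.
- exact: measurableU.
- move=> x /= x1; have [->|x0] := eqVneq x 0; [by right | left].
  by rewrite /PB/punctured_ball/= x1 enorm_gt0 x0.
Qed.

(** Integrate kappa(|x|) kappa0(|y|) |x . y|^p in both orders, kappa0 being the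
    unit profile. This symmetry replaces polar coordinates: the ratio of the
    moment in a direction to the full moment is the same for every profile. *)
Lemma momentC p kappa : nonneg_profile kappa -> p != 0 ->
  (moment p kappa e * leb PB =
   moment p (unit_profile p) e * \int[leb]_h (kappa (enorm h) * enorm h `^ p)%:E)%E.
Proof.
move=> pk p0; have pu := unit_profileP p.
have mk := measurable_profile pk; have mun := measurable_profile pu.
have := moment_swap p pu (@measurable_id _ _ setT) mk (fun x => pk.2 _).
have := moment_swap p pk (@measurable_id _ _ setT) mun (fun x => pu.2 _).
have -> : (\int[leb]_x (unit_profile p (enorm x) * enorm x `^ p)%:E = leb PB)%E.
  under eq_integral do rewrite unit_profile_norm//.
  rewrite integral_indic; [|exact: measurableT|exact: measurable_punctured_ball].
  by rewrite setIT.
move=> <- <-; rewrite (fubini_tonelli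
  (fun z => (kappa (enorm z.1) * (unit_profile p (enorm z.2) * `|dot z.2 z.1| `^ p))%:E)).
- apply: eq_integral => x _; apply: eq_integral => y _.
  by rewrite mulrCA dotC.
- apply/measurable_EFinP; apply: measurable_funM.
    by apply: (measurableT_comp mk).
  apply: measurable_funM; first exact: (measurableT_comp mun).
  by apply: measurable_norm_powR; apply: measurable_dot2.
- move=> z; rewrite lee_fin mulr_ge0 ?mulr_ge0 ?powR_ge0//.
  exact: pk.2.
Qed.

Lemma surface_integral (f : Rn -> \bar R) : measurable_fun setT f ->
  (forall x, 0 <= f x)%E ->
  (\int[@surface_measure R n.+1]_(w in sphere) f w =
   n.+1%:R%:E * \int[leb]_(x in PB) f (normalize x))%E.
Proof.
move=> mf f0.
have msph : measurable (@sphere R n.+1).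
  rewrite (_ : sphere = @enorm R n.+1 @^-1` [set 1])//.
  by rewrite -[X in measurable X]setTI; exact: measurable_enorm.
rewrite integral_mkcond.
rewrite (@ge0_integral_image _ _ _ _ _ _ leb _ (@measurable_normalize R n.+1) _
  (@measurable_punctured_ball R n.+1) (NngNum (ler0n R n.+1)))//.
- congr (_ * _)%E; apply: eq_integral => x /set_mem/andP[x0 _].
  rewrite patchT//; apply/mem_set; rewrite /sphere/= /normalize enormZ.
  by rewrite ger0_norm ?invr_ge0 ?enorm_ge0// mulVf// gt_eqF.
- by apply/(measurable_restrictT _ msph); exact: measurable_funTS.
- by move=> x; rewrite /patch; case: ifP.
Qed.

(** The surface measure is n times the volume of cones, so a mean over the
    sphere is a mean over the punctured ball. *)
Lemma sphere_constantE p : p != 0 -> 0 <= p ->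
  (moment p (unit_profile p) e = (sphere_constant n p)%:E * leb PB)%E.
Proof.
move=> p0 pge0.
have [PB0 PBoo] := punctured_ball_pos.
have mPB := @measurable_punctured_ball R n.+1.
have mf : measurable_fun setT (fun w : Rn => (`|w ord0 ord_max| `^ p)%:E).
  by apply/measurable_EFinP; apply: measurable_norm_powR; exact: measurable_coord.
have E1 : (\int[leb]_(x in PB) (`|normalize x ord0 ord_max| `^ p)%:E =
    moment p (unit_profile p) e)%E.
  rewrite integral_mkcond; apply: eq_integral => x _.
  rewrite /patch dotC dot_delta; case: ifPn => [/set_mem|] xPB.
    have /andP[x0 _] := xPB.
    rewrite /unit_profile indicE mem_set/=; last by have /andP[-> ->] := xPB.
    rewrite mul1r /normalize mxE normrM powRM// ger0_norm ?invr_ge0 ?enorm_ge0//.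
    by rewrite -powR_inv1 ?enorm_ge0// -powRrM mulN1r.
  rewrite /unit_profile indicE memNset ?mul0r//= => h.
  by move/negP: xPB; apply; apply/mem_set.
have E2 : surface_measure (@sphere R n.+1) = (n.+1%:R%:E * leb PB)%E.
  rewrite /surface_measure; congr (_ * leb _)%E.
  apply/setIidPr => x /andP[x0 _]; rewrite /sphere/= /normalize enormZ.
  by rewrite ger0_norm ?invr_ge0 ?enorm_ge0// mulVf// gt_eqF.
have Jfin : moment p (unit_profile p) e \is a fin_num.
  rewrite ge0_fin_numE; last first.
    by apply: integral_ge0 => h _; rewrite lee_fin mulr_ge0 ?powR_ge0//; exact: (unit_profileP p).2.
  apply: le_lt_trans PBoo.
  rewrite -E1; have -> : leb PB = (\int[leb]_(x in PB) 1%:E)%E.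
    by rewrite (integral_cst _ mPB 1) mul1e.
  apply: ge0_le_integral => //.
  - apply/measurable_EFinP; apply: measurable_funTS; apply: measurable_norm_powR.
    by apply: (measurableT_comp (measurable_coord ord_max)); exact: measurable_normalize.
  - move=> x /andP[x0 _]; rewrite lee_fin.
    apply: (@le_trans _ _ (1 `^ p)); last by rewrite powR1.
    apply: ge0_ler_powR; rewrite ?nnegrE//.
    apply: le_trans (le_coord_enorm _ _) _; rewrite /normalize enormZ.
    by rewrite ger0_norm ?invr_ge0 ?enorm_ge0// mulVf// gt_eqF.
rewrite /sphere_constant (surface_integral mf)//.
rewrite E1 E2.
have PBfin : leb PB \is a fin_num by rewrite ge0_fin_numE.
rewrite !fineM//= -[in RHS](fineK PBfin) -EFinM -mulf_div divff// mul1r.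
by rewrite divfK ?fineK// gt_eqF// fine_gt0// PB0 PBoo.
Qed.

Lemma profile_moment p kappa : 0 < p -> nonneg_profile kappa ->
  (moment p kappa e =
   (sphere_constant n p)%:E * \int[leb]_h (kappa (enorm h) * enorm h `^ p)%:E)%E.
Proof.
move=> p0 pk; have [PB0 PBoo] := punctured_ball_pos.
apply: (mule_finI PB0 PBoo); rewrite momentC ?gt_eqF//.
by rewrite sphere_constantE ?gt_eqF ?(ltW p0)// muleAC.
Qed.

(** Tonelli and rotation invariance: for each x, the weighted mean of
    |dot h (G x)|^p over h is |G x|^p times a moment independent of x. *)
Lemma slope_energy_profile p kappa (G : Rn -> Rn) : 1 < p -> nonneg_profile kappa ->
  (forall i, Lpi p (fun x => G x ord0 i)) ->
  (\int[leb]_h (kappa (enorm h) * slope_energy p G h)%:E =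
   (sphere_constant n p)%:E * gradient_energy p G *
   \int[leb]_h (kappa (enorm h) * enorm h `^ p)%:E)%E.
Proof.
move=> p1 pk LG; have p0 : 0 < p by lra.
have mG : measurable_fun setT G by apply: measurable_fun_rVP => i; exact: (LG i).1.
have := moment_swap p pk mG (@measurable_cst _ _ _ _ setT (1 : R)) (fun=> ler01).
rewrite (profile_moment p0 pk) => H.
rewrite muleAC /gradient_energy.
transitivity (\int[leb]_h \int[leb]_x (kappa (enorm h) * (1 * `|dot (G x) h| `^ p))%:E)%E.
  apply: eq_integral => h _; rewrite EFinM /slope_energy (EFin_Rintegral (Lpi_dot p1 LG h).2).
  rewrite -ge0_integralZl//.
  - by apply: eq_integral => x _; rewrite mul1r dotC EFinM.
  - apply/measurable_EFinP; exact: intg_measurable (Lpi_dot p1 LG h).2.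
  - by rewrite lee_fin; exact: pk.2.
rewrite H; congr (_ * _)%E; apply: eq_integral => x _.
by rewrite mul1r.
Qed.

End radial_moments.

(** * Bounds on the increment energy *)

Section diff_energy_bounds.
Context {R : realType} {n : nat}.
Local Notation Rn := 'rV[R]_n.
Local Notation leb := (@lebesgue_rV R n).
Implicit Types (x y h : Rn) (u : Rn -> R).
Variable p : R.
Hypothesis p1 : 1 < p.
Let p0 : 0 < p. Proof. exact: lt_trans p1. Qed.

Lemma diff_energy_bounded u : Lpi p u ->
  exists2 C, 0 <= C & forall h, diff_energy p u h <= C.
Proof.
move=> Lu; pose U := \int[leb]_x (`|u x| `^ p).
have U0 : 0 <= U by apply: Rintegral_ge0 => x _; exact: powR_ge0.
exists (2 `^ p * (U + U)) => [|h]; first by rewrite mulr_ge0 ?powR_ge0// addr_ge0.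
have Lh := Lpi_shift (- h) Lu.
rewrite /U -{2}(Rintegral_shift (- h) Lu.2) -RintegralD//; [|exact: Lu.2|exact: Lh.2].
rewrite -RintegralZl//; last by apply: intgD; [exact: Lu.2|exact: Lh.2].
apply: le_Rintegral => //; first exact: (Lpi_diff p1 Lu h).2.
  by apply: intgZ; apply: intgD; [exact: Lu.2|exact: Lh.2].
move=> x _; rewrite -(normrN (u (x - h))).
by apply: powR_add_le; exact: ltW.
Qed.

(** An increment by m h is a sum of m translated increments by h; Jensen's
    inequality bounds the p-th power of the sum. *)
Lemma diff_energy_mul u h (m : nat) : Lpi p u ->
  diff_energy p u (m.+1%:R *: h) <= m.+1%:R `^ p * diff_energy p u h.
Proof.
move=> Lu; have Ld := Lpi_diff p1 Lu h.
pose a (i : nat) x := u (x - i%:R *: h) - u (x - i.+1%:R *: h).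
have aE i x : a i x = (fun x => u x - u (x - h)) (x + - (i%:R *: h)).
  by rewrite /a -addrA -opprD -[X in _ *: h + X]scale1r -scalerDl natr1.
have ia (i : nat) : intg leb (fun x => `|a i x| `^ p).
  by under eq_fun do rewrite aE; exact: (Lpi_shift (- (i%:R *: h)) Ld).2.
have Ia (i : nat) : \int[leb]_x (`|a i x| `^ p) = diff_energy p u h.
  under eq_Rintegral do rewrite aE.
  exact: (Rintegral_shift (- (i%:R *: h)) Ld.2).
have tel x : u x - u (x - m.+1%:R *: h) = \sum_(i < m.+1) a i x.
  rewrite -(big_mkord xpredT (fun i : nat => a i x)) /a.
  under eq_bigr do rewrite -opprB.
  rewrite sumrN (telescope_sumr (fun i : nat => u (x - i%:R *: h)))//.
  by rewrite opprB scale0r subr0.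
apply: (@le_trans _ _ (\int[leb]_x (m.+1%:R `^ (p - 1) * \sum_(i < m.+1) `|a i x| `^ p))).
  apply: le_Rintegral => //.
  - exact: (Lpi_diff p1 Lu _).2.
  - by apply: intgZ; apply: intg_sum => i; exact: ia.
  - by move=> x _; rewrite tel; exact: powR_sum_le.
rewrite RintegralZl//; last by apply: intg_sum => i; exact: ia.
rewrite Rintegral_sum; last by move=> i; exact: ia.
under eq_bigr do rewrite Ia.
rewrite sumr_const card_ord -[diff_energy p u h *+ _]mulr_natl mulrA (mulrC _ m.+1%:R).
by rewrite mulr_powRB1.
Qed.

Lemma Cc_Lpi u : Cc_infty u -> Lpi p u.
Proof. by move=> cu; split; [exact: Cc_measurable | exact: Cc_intg_powR]. Qed.

Lemma Cc_norm_pos u : Cc_infty u -> (exists x, u x != 0) ->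
  0 < \int[leb]_x (`|u x| `^ p).
Proof.
move=> cu [x0 ux0]; have Lu := Cc_Lpi cu.
have cont := smooth_continuous (Cc_smooth cu).
have a0 : 0 < `|u x0| / 2 by rewrite divr_gt0// normr_gt0.
have : \forall x \near x0, `|u x0| / 2 <= `|u x|.
  have Fx := nbhs_filter x0.
  have /(@cvgrPdist_le _ _ _ (nbhs x0)) /(_ _ a0) := cont x0.
  apply: (@filterS _ (nbhs x0) Fx) => x h.
  have := ler_normD (u x0 - u x) (u x); rewrite subrK; lra.
move=> /nbhs_ballP[r /= r0 Hr].
have mB := measurable_ball_rV x0 r0.
have lB : leb (ball x0 r) = ((2 * r) ^+ n)%:E.
  have [_ <-] := cube_measure x0 r0; congr (leb _).
  by apply/seteqP; split => y /=; rewrite ball_rVP.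
have iB : intg leb (\1_(ball x0 r)).
  apply: intg_ge0P => //.
  rewrite integral_indic; [|exact: measurableT|exact: mB].
  by rewrite setIT [X in (X < _)%E]lB ltry.
apply: (@lt_le_trans _ _ (\int[leb]_x ((`|u x0| / 2) `^ p * \1_(ball x0 r) x))); last first.
  apply: le_Rintegral => //; [exact: intgZ | exact: Lu.2|].
  move=> x _; rewrite indicE; case: (boolP (x \in _)) => [/set_mem xB|_].
    rewrite mulr1; apply: ge0_ler_powR; rewrite ?nnegrE ?(ltW p0) ?(ltW a0)//.
    exact: Hr.
  by rewrite mulr0 powR_ge0.
rewrite RintegralZl//; apply: mulr_gt0; first exact: powR_gt0.
rewrite /Rintegral integral_indic; [|exact: measurableT|exact: mB].
by rewrite setIT [X in fine X]lB /= exprn_gt0// mulr_gt0.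
Qed.

(** Translates by more than the diameter of the support are disjoint from the
    original function. *)
Lemma diff_energy_far u M h : Lpi p u -> (forall x, M < enorm x -> u x = 0) ->
  2 * M < enorm h -> \int[leb]_x (`|u x| `^ p) <= diff_energy p u h.
Proof.
move=> Lu uM Mh; apply: le_Rintegral => //; first exact: Lu.2.
  exact: (Lpi_diff p1 Lu h).2.
move=> x _; have [xM|xM] := leP (enorm x) M; last first.
  by rewrite (uM x xM) normr0 powR0 ?gt_eqF// powR_ge0.
rewrite [u (x - h)]uM ?subr0//.
by have := enormD (h - x) x; rewrite subrK -opprB enormN; lra.
Qed.

(** Choose m so that m h just exceeds the diameter of the support: the
    energy at m h is bounded below, and it is at most m^p times the energy at
    h, with m of order 1/|h| for small h. *)
Lemma diff_energy_coercive u : Cc_infty u -> (exists x, u x != 0) ->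
  exists2 c, 0 < c & forall h, c * Num.min 1 (enorm h `^ p) <= diff_energy p u h.
Proof.
move=> cu ux; have Lu := Cc_Lpi cu; have U0 := Cc_norm_pos cu ux.
set U := (X in 0 < X) in U0.
have [M M0 uM] := Cc_support cu.
pose D := 2 * M + 1; have D0 : 0 < D by rewrite addr_gt0// mulr_gt0.
exists (U / (D + 1) `^ p) => [|h].
  by rewrite divr_gt0// powR_gt0// addr_gt0.
have [->|h0] := eqVneq h 0.
  rewrite enorm0 (powR0 (lt0r_neq0 p0)) (min_r (ler01 : (0 : R) <= 1)) mulr0.
  by apply: Rintegral_ge0 => x _; exact: powR_ge0.
have nh : 0 < enorm h by rewrite enorm_gt0.
(* m.+1 is the first multiple for which m.+1%:R *: h leaves the ball of radius D *)
pose m := Num.truncn (D / enorm h).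
have [m1 m2] : m%:R <= D / enorm h /\ D / enorm h < m.+1%:R.
  by have /andP[] := truncn_itv (ltW (divr_gt0 D0 nh)).
have far : 2 * M < enorm (m.+1%:R *: h).
  rewrite enormZ ger0_norm//; rewrite ltr_pdivrMr// in m2.
  by apply: lt_trans m2; rewrite ltrDl.
have := le_trans (diff_energy_far Lu uM far) (diff_energy_mul h m Lu).
rewrite -/U => H.
have mm : m.+1%:R * Num.min 1 (enorm h) <= D + 1.
  rewrite ler_pdivlMr// in m1; rewrite -natr1 mulrDl mul1r.
  have [h1|h1] := leP 1 (enorm h).
    rewrite mulr1 lerD2r; apply: le_trans m1; exact: ler_peMr.
  apply: lerD => //; exact: ltW.
have minE : Num.min 1 (enorm h `^ p) = Num.min 1 (enorm h) `^ p.
  have [h1|h1] := leP 1 (enorm h).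
    by rewrite powR1 min_l//; apply: le_trans (le1r_powR h1 (ltW p1)).
  by rewrite min_r//; apply: le_trans (ge1r_powR _ (ltW p1)) _; rewrite ?nh ?ltW.
have mp : 0 < m.+1%:R `^ p by rewrite powR_gt0.
rewrite -(ler_pM2l mp); apply: le_trans H.
rewrite minE mulrCA -powRM// ?le_min ?ler01 ?enorm_ge0//.
have D1 : 0 < (D + 1) `^ p by rewrite powR_gt0// addr_gt0.
rewrite -mulrA; apply: ler_piMr; first exact: ltW.
rewrite mulrC ler_pdivrMr// mul1r.
apply: ge0_ler_powR; rewrite ?nnegrE ?(ltW p0)//.
  by rewrite mulr_ge0// le_min ler01 enorm_ge0.
by rewrite addr_ge0// ltW.
Qed.

End diff_energy_bounds.

(** * Near and far parts of a radial profile *)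

Section profile_inequalities.
Context {R : realType} {n : nat}.
Local Notation Rn := 'rV[R]_n.+1.
Local Notation leb := (@lebesgue_rV R n.+1).
Implicit Types (x h : Rn) (kappa : R -> R).
Variables (p : R) (u : Rn -> R) (G : Rn -> Rn).
Hypotheses (p1 : 1 < p) (Lu : Lpi p u) (LG : forall i, Lpi p (fun x => G x ord0 i)).
Hypothesis weak : forall phi i, Cc_infty phi ->
  \int[leb]_x (u x * partial i phi x) = - \int[leb]_x (G x ord0 i * phi x).
Let p0 : 0 < p. Proof. exact: lt_trans p1. Qed.

Let one_powR : 1 `^ p = 1 :> R. Proof. by rewrite powR1. Qed.

Definition near_profile kappa (delta r : R) :=
  kappa r * \1_[set r : measurableTypeR R | r <= delta] r.
Definition far_profile kappa (delta r : R) :=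
  kappa r * \1_[set r : measurableTypeR R | delta < r] r.

Lemma near_profileP kappa delta : nonneg_profile kappa ->
  nonneg_profile (near_profile kappa delta).
Proof.
move=> [mk k0]; split; last by move=> r; rewrite mulr_ge0.
apply: measurable_funM => //; apply: measurable_indic.
by rewrite (_ : [set r | _] = `]-oo, delta]%classic)// set_itvNyc.
Qed.

Lemma far_profileP kappa delta : nonneg_profile kappa ->
  nonneg_profile (far_profile kappa delta).
Proof.
move=> [mk k0]; split; last by move=> r; rewrite mulr_ge0.
apply: measurable_funM => //; apply: measurable_indic.
by rewrite (_ : [set r | _] = `]delta, +oo[%classic)// set_itvoy.
Qed.

(** Splitting the profile rather than the domain keeps every integral over the
    whole space. *)
Lemma near_far_profile kappa delta r :
  near_profile kappa delta r + far_profile kappa delta r = kappa r.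
Proof.
rewrite /near_profile /far_profile !indicE -mulrDr.
have [rd|rd] := leP r delta.
  by rewrite mem_set//= memNset/= ?addr0 ?mulr1// => /lt_le_trans/(_ rd); rewrite ltxx.
by rewrite memNset/= ?mem_set//= ?add0r ?mulr1// => /(lt_le_trans rd); rewrite ltxx.
Qed.

Definition near_moment kappa delta : \bar R :=
  (\int[leb]_h (near_profile kappa delta (enorm h) * enorm h `^ p)%:E)%E.
Definition far_mass kappa delta : \bar R :=
  (\int[leb]_h (far_profile kappa delta (enorm h))%:E)%E.
Definition profile_mass kappa : \bar R :=
  (\int[leb]_h (Num.min 1 (enorm h `^ p) * kappa (enorm h))%:E)%E.
Definition profile_energy kappa tau : \bar R :=
  (\int[leb]_h (kappa (enorm h) * diff_energy p u (tau *: h))%:E)%E.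

Lemma far_massE kappa delta :
  far_mass kappa delta = (\int[leb]_(h in [set h : Rn | (delta < enorm h)%R]) (kappa (enorm h))%:E)%E.
Proof.
rewrite integral_mkcond; apply: eq_integral => h _.
rewrite /patch /far_profile indicE.
case: ifPn => [/set_mem/= hd|hd]; first by rewrite mem_set//= mulr1.
by rewrite memNset ?mulr0//= => hd'; move/negP: hd; apply; exact: mem_set.
Qed.

Lemma measurable_enorm_powR : measurable_fun setT (fun h : Rn => enorm h `^ p).
Proof. exact: (measurableT_comp (measurable_powR p) (@measurable_enorm R n.+1)). Qed.

Lemma measurable_scaled_energy tau : measurable_fun setT (fun h => diff_energy p u (tau *: h)).
Proof.
apply: (measurableT_comp (measurable_diff_energy p1 Lu)).
exact: measurable_scaleV.
Qed.

Lemma measurable_profile_mul kappa (f : Rn -> R) : nonneg_profile kappa ->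
  measurable_fun setT f -> measurable_fun setT (fun h => (kappa (enorm h) * f h)%:E).
Proof.
move=> pk mf; apply/measurable_EFinP; apply: measurable_funM => //.
exact: measurable_profile.
Qed.

Lemma profile_split kappa delta (f : Rn -> R) : nonneg_profile kappa ->
  measurable_fun setT f -> (forall h, 0 <= f h) ->
  (\int[leb]_h (kappa (enorm h) * f h)%:E =
   \int[leb]_h (near_profile kappa delta (enorm h) * f h)%:E +
   \int[leb]_h (far_profile kappa delta (enorm h) * f h)%:E)%E.
Proof.
move=> pk mf f0; have pn := near_profileP delta pk; have pf := far_profileP delta pk.
rewrite -ge0_integralD//.
- by apply: eq_integral => h _; rewrite -EFinD -mulrDl near_far_profile.
- by move=> h _; rewrite lee_fin mulr_ge0//; exact: pn.2.
- exact: measurable_profile_mul.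
- by move=> h _; rewrite lee_fin mulr_ge0//; exact: pf.2.
- exact: measurable_profile_mul.
Qed.

Lemma le_profile_integral kappa (f g : Rn -> R) : nonneg_profile kappa ->
  measurable_fun setT f -> measurable_fun setT g ->
  (forall h, 0 <= f h) ->
  (forall h, 0 < kappa (enorm h) -> f h <= g h) ->
  (\int[leb]_h (kappa (enorm h) * f h)%:E <= \int[leb]_h (kappa (enorm h) * g h)%:E)%E.
Proof.
move=> pk mf mg f0 fg.
have kle h : kappa (enorm h) * f h <= kappa (enorm h) * g h.
  have [k0|k0] := ltP 0 (kappa (enorm h)); first by rewrite ler_wpM2l ?(ltW k0)// fg.
  have -> : kappa (enorm h) = 0 by apply/eqP; rewrite eq_le k0 pk.2.
  by rewrite !mul0r.
have kf0 h : 0 <= kappa (enorm h) * f h by rewrite mulr_ge0//; exact: pk.2.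
apply: ge0_le_integral => //.
- by move=> h _; rewrite lee_fin.
- exact: measurable_profile_mul.
- exact: measurable_profile_mul.
- by move=> h _; rewrite lee_fin.
Qed.

Lemma near_profile_gt0 kappa delta r : 0 < near_profile kappa delta r -> r <= delta.
Proof.
rewrite /near_profile indicE; case: (boolP (r \in _)) => [/set_mem//|_].
by rewrite mulr0 ltxx.
Qed.

Lemma far_profile_gt0 kappa delta r : 0 < far_profile kappa delta r -> delta < r.
Proof.
rewrite /far_profile indicE; case: (boolP (r \in _)) => [/set_mem//|_].
by rewrite mulr0 ltxx.
Qed.

Lemma profile_integralZ kappa (f : Rn -> R) c : nonneg_profile kappa ->
  measurable_fun setT f -> (forall h, 0 <= f h) -> 0 <= c ->
  (\int[leb]_h (kappa (enorm h) * (c * f h))%:E =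
   c%:E * \int[leb]_h (kappa (enorm h) * f h)%:E)%E.
Proof.
move=> pk mf f0 c0; rewrite -ge0_integralZl//.
- by apply: eq_integral => h _; rewrite mulrCA EFinM.
- exact: measurable_profile_mul.
- by move=> h _; rewrite lee_fin mulr_ge0//; exact: pk.2.
Qed.

Lemma near_moment_ge0 kappa delta : nonneg_profile kappa -> (0 <= near_moment kappa delta)%E.
Proof.
move=> pk; apply: integral_ge0 => h _.
by rewrite lee_fin mulr_ge0 ?powR_ge0//; exact: (near_profileP _ pk).2.
Qed.

Lemma far_mass_ge0 kappa delta : nonneg_profile kappa -> (0 <= far_mass kappa delta)%E.
Proof.
move=> pk; apply: integral_ge0 => h _.
by rewrite lee_fin; exact: (far_profileP _ pk).2.
Qed.

Lemma diff_energy_ge0 h : 0 <= diff_energy p u h.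
Proof. by apply: Rintegral_ge0 => x _; exact: powR_ge0. Qed.

Lemma slope_energy_ge0 h : 0 <= slope_energy p G h.
Proof. by apply: Rintegral_ge0 => x _; exact: powR_ge0. Qed.

Lemma profile_energy_ge0 kappa tau : nonneg_profile kappa -> (0 <= profile_energy kappa tau)%E.
Proof.
move=> pk; apply: integral_ge0 => h _.
by rewrite lee_fin mulr_ge0 ?diff_energy_ge0//; exact: pk.2.
Qed.

Lemma measurable_slope_energy : measurable_fun setT (slope_energy p G).
Proof.
have mG : measurable_fun setT G by apply: measurable_fun_rVP => i; exact: (LG i).1.
apply/measurable_EFinP.
pose f (z : Rn * Rn) : \bar R := (`|dot z.2 (G z.1)| `^ p)%:E.
have mf : measurable_fun setT f.
  apply/measurable_EFinP; apply: measurable_norm_powR.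
  by apply: measurable_dot2 => //; exact: (measurableT_comp mG).
have f0 z : (0 <= f z)%E by rewrite lee_fin powR_ge0.
rewrite (_ : EFin \o _ = fun h => \int[leb]_x f (x, h))%E.
  exact: (@measurable_fun_fubini_tonelli_G _ _ _ _ _ leb f mf f0).
by apply/funext => h /=; rewrite /slope_energy (EFin_Rintegral (Lpi_dot p1 LG h).2).
Qed.

Lemma measurable_min1 : measurable_fun setT (fun h : Rn => Num.min 1 (enorm h `^ p)).
Proof. by apply: measurable_minr => //; exact: measurable_enorm_powR. Qed.

Lemma min1_ge0 h : 0 <= Num.min 1 (enorm h `^ p).
Proof. by rewrite le_min ler01 powR_ge0. Qed.

Lemma profile_massE kappa : profile_mass kappa =
  (\int[leb]_h (kappa (enorm h) * Num.min 1 (enorm h `^ p))%:E)%E.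
Proof. by apply: eq_integral => h _; rewrite mulrC. Qed.

Lemma far_mass1 kappa delta : far_mass kappa delta =
  (\int[leb]_h (far_profile kappa delta (enorm h) * 1)%:E)%E.
Proof. by apply: eq_integral => h _; rewrite mulr1. Qed.

Lemma profile_mass_le kappa delta : nonneg_profile kappa ->
  (profile_mass kappa <= near_moment kappa delta + far_mass kappa delta)%E.
Proof.
move=> pk; have pn := near_profileP delta pk; have pf := far_profileP delta pk.
rewrite profile_massE (profile_split delta pk measurable_min1 min1_ge0) far_mass1.
have mp := measurable_enorm_powR.
apply: leeD; apply: le_profile_integral => //; try exact: measurable_min1; try exact: min1_ge0.
by move=> h _; rewrite ge_min lexx orbT.
Qed.

Lemma near_moment_le kappa delta : nonneg_profile kappa -> delta <= 1 ->
  (near_moment kappa delta <= profile_mass kappa)%E.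
Proof.
move=> pk d1; have pn := near_profileP delta pk; have pf := far_profileP delta pk.
rewrite profile_massE (profile_split delta pk measurable_min1 min1_ge0).
rewrite -[leLHS]adde0; apply: leeD.
  apply: le_profile_integral => //; [exact: measurable_enorm_powR|exact: measurable_min1| |].
    by move=> h; exact: powR_ge0.
  move=> h /near_profile_gt0 hd; rewrite le_min lexx andbT.
  rewrite -[leRHS]one_powR; apply: ge0_ler_powR; rewrite ?nnegrE ?enorm_ge0 ?(ltW p0)//.
  exact: le_trans d1.
by apply: integral_ge0 => h _; rewrite lee_fin mulr_ge0 ?min1_ge0//; exact: pf.2.
Qed.

Lemma profile_mass1 kappa : nonneg_profile kappa ->
  profile_mass kappa = (near_moment kappa 1 + far_mass kappa 1)%E.
Proof.
move=> pk; have pn := near_profileP 1 pk; have pf := far_profileP 1 pk.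
rewrite profile_massE (profile_split 1 pk measurable_min1 min1_ge0) far_mass1.
have mp := measurable_enorm_powR.
congr (_ + _)%E; apply/eqP; rewrite eq_le; apply/andP; split;
  apply: le_profile_integral => //; try exact: measurable_min1; try exact: min1_ge0;
  try (by move=> h; exact: powR_ge0).
- by move=> h _; rewrite ge_min lexx orbT.
- move=> h /near_profile_gt0 h1; rewrite le_min lexx andbT.
  by rewrite -[leRHS]one_powR; apply: ge0_ler_powR; rewrite ?nnegrE ?enorm_ge0 ?(ltW p0).
- move=> h /far_profile_gt0 h1; rewrite le_min lexx/=.
  by rewrite -[leLHS]one_powR; apply: ge0_ler_powR; rewrite ?nnegrE ?enorm_ge0 ?(ltW p0)// ltW.
Qed.

Variable L : R.
Hypothesis LE : ((sphere_constant n p)%:E * gradient_energy p G = L%:E)%E.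

(** Homogeneity of the slope energy pulls out tau^p; the rest is
    [slope_energy_profile] for the profile cut at [delta]. *)
Lemma near_slope kappa delta tau : 0 < tau -> nonneg_profile kappa ->
  (\int[leb]_h (near_profile kappa delta (enorm h) * slope_energy p G (tau *: h))%:E =
   (tau `^ p * L)%:E * near_moment kappa delta)%E.
Proof.
move=> tau0 pk; have pn := near_profileP delta pk.
rewrite EFinM -LE -[RHS]muleA -(slope_energy_profile p1 pn LG).
rewrite -profile_integralZ ?powR_ge0//; first last.
- exact: slope_energy_ge0.
- exact: measurable_slope_energy.
by apply: eq_integral => h _; rewrite (slope_energyZ p1 LG) ger0_norm ?(ltW tau0).
Qed.

(** The increment energy is at most the slope energy near 0 and at most a
    constant far away. *)
Lemma profile_energy_le kappa delta tau C : nonneg_profile kappa -> 0 < tau -> 0 <= C ->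
  (forall h, diff_energy p u h <= C) ->
  (profile_energy kappa tau <=
   (tau `^ p * L)%:E * near_moment kappa delta + C%:E * far_mass kappa delta)%E.
Proof.
move=> pk tau0 C0 FC; have pn := near_profileP delta pk; have pf := far_profileP delta pk.
have mF := measurable_scaled_energy tau.
have mS : measurable_fun setT (fun h => slope_energy p G (tau *: h)).
  by apply: (measurableT_comp measurable_slope_energy); exact: measurable_scaleV.
rewrite /profile_energy (profile_split delta pk mF (fun h => diff_energy_ge0 _)).
rewrite -(near_slope delta tau0 pk); apply: leeD.
  apply: (le_profile_integral pn mF mS) => [h|h _]; first exact: diff_energy_ge0.
  exact: (diff_energy_le p1 Lu LG weak).
rewrite far_mass1 -(profile_integralZ pf (@measurable_cst _ _ _ _ setT (1 : R)) (fun=> ler01) C0).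
apply: (le_profile_integral pf mF (@measurable_cst _ _ _ _ setT (C * 1))) => [h|h _].
  exact: diff_energy_ge0.
by rewrite mulr1.
Qed.

(** Near 0, where [tau * delta <= rho] makes dilated increments small, the
    slope energy is the increment energy up to [eta]; far away coercivity gives
    at least c (tau delta)^p, because [rho <= 1]. *)
Lemma profile_energy_ge kappa delta tau rho eta c : nonneg_profile kappa ->
  0 < tau -> 0 < delta -> rho <= 1 -> tau * delta <= rho -> 0 < eta -> 0 <= c ->
  (forall h, enorm h <= rho ->
    slope_energy p G h <= diff_energy p u h + eta * enorm h `^ p) ->
  (forall h, c * Num.min 1 (enorm h `^ p) <= diff_energy p u h) ->
  ((tau `^ p * L)%:E * near_moment kappa delta + (c * (tau * delta) `^ p)%:E * far_mass kappa delta
   <= profile_energy kappa tau + (eta * tau `^ p)%:E * near_moment kappa delta)%E.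
Proof.
move=> pk tau0 d0 rho1 td eta0 c0 HS Hc.
have pn := near_profileP delta pk; have pf := far_profileP delta pk.
have mF := measurable_scaled_energy tau.
have mS : measurable_fun setT (fun h => slope_energy p G (tau *: h)).
  by apply: (measurableT_comp measurable_slope_energy); exact: measurable_scaleV.
have mp := measurable_enorm_powR.
have td0 : 0 <= tau * delta by rewrite mulr_ge0 ?ltW.
rewrite /profile_energy (profile_split delta pk mF (fun h => diff_energy_ge0 _)).
rewrite -(near_slope delta tau0 pk) [leRHS]addeAC; apply: leeD.
  have et0 : 0 <= eta * tau `^ p by rewrite mulr_ge0 ?powR_ge0// ltW.
  have mep : measurable_fun setT (fun h : Rn => eta * tau `^ p * enorm h `^ p).
    exact: measurable_funM.
  have ep0 (h : Rn) : 0 <= enorm h `^ p by exact: powR_ge0.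
  rewrite /near_moment -(profile_integralZ pn mp ep0 et0).
  have f10 (h : Rn) (_ : setT h) : (0 <= (near_profile kappa delta (enorm h) * diff_energy p u (tau *: h))%:E)%E.
    by rewrite lee_fin mulr_ge0 ?diff_energy_ge0//; exact: pn.2.
  have f20 (h : Rn) (_ : setT h) : (0 <= (near_profile kappa delta (enorm h) * (eta * tau `^ p * enorm h `^ p))%:E)%E.
    by rewrite lee_fin; apply: mulr_ge0; [exact: pn.2 | exact: mulr_ge0].
  rewrite -(ge0_integralD leb measurableT f10 (measurable_profile_mul pn mF)
    f20 (measurable_profile_mul pn mep)).
  under [X in (_ <= X)%E]eq_integral do rewrite -EFinD -mulrDr.
  apply: (le_profile_integral pn mS (measurable_funD mF mep)).
    by move=> h; exact: slope_energy_ge0.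
  move=> h /near_profile_gt0 hd.
  have tE : enorm (tau *: h) = tau * enorm h by rewrite enormZ gtr0_norm.
  have : enorm (tau *: h) <= rho.
    by rewrite tE (le_trans _ td)// ler_wpM2l// ltW.
  move=> /HS; rewrite tE powRM ?enorm_ge0 ?(ltW tau0)//.
  by rewrite mulrA.
have c1 : 0 <= c * (tau * delta) `^ p by rewrite mulr_ge0 ?powR_ge0.
rewrite far_mass1 -(profile_integralZ pf (@measurable_cst _ _ _ _ setT (1 : R)) (fun=> ler01) c1).
apply: (le_profile_integral pf (@measurable_cst _ _ _ _ setT (c * (tau * delta) `^ p * 1)) mF).
  by move=> h; rewrite mulr1.
move=> h /far_profile_gt0 hd; rewrite mulr1; apply: le_trans (Hc _).
have tE : enorm (tau *: h) = tau * enorm h by rewrite enormZ gtr0_norm.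
have tdh : (tau * delta) `^ p <= enorm (tau *: h) `^ p.
  apply: ge0_ler_powR; rewrite ?nnegrE ?enorm_ge0 ?(ltW p0)//.
  by rewrite tE ler_wpM2l ?(ltW tau0)// ltW.
apply: ler_wpM2l => //; rewrite le_min tdh andbT -[leRHS]one_powR.
apply: ge0_ler_powR; rewrite ?nnegrE ?(ltW p0)//.
exact: le_trans rho1.
Qed.

Lemma far_mass_le_energy kappa delta c : nonneg_profile kappa -> 0 < delta -> 0 <= c ->
  (forall h, c * Num.min 1 (enorm h `^ p) <= diff_energy p u h) ->
  ((c * Num.min 1 (delta `^ p))%:E * far_mass kappa delta <= profile_energy kappa 1)%E.
Proof.
move=> pk d0 c0 Hc.
have pn := near_profileP delta pk; have pf := far_profileP delta pk.
have mF := measurable_scaled_energy 1.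
have m0 : 0 <= Num.min 1 (delta `^ p) by rewrite le_min ler01 powR_ge0.
rewrite /profile_energy (profile_split delta pk mF (fun h => diff_energy_ge0 _)).
rewrite -[leLHS]add0e; apply: leeD.
  apply: integral_ge0 => h _.
  by rewrite lee_fin mulr_ge0 ?diff_energy_ge0//; exact: pn.2.
have c1 : 0 <= c * Num.min 1 (delta `^ p) by rewrite mulr_ge0.
rewrite far_mass1 -(profile_integralZ pf (@measurable_cst _ _ _ _ setT (1 : R)) (fun=> ler01) c1).
apply: (le_profile_integral pf (@measurable_cst _ _ _ _ setT (c * Num.min 1 (delta `^ p) * 1)) mF).
  by move=> h; rewrite mulr1.
move=> h /far_profile_gt0 hd; rewrite mulr1 scale1r; apply: le_trans (Hc _).
apply: ler_wpM2l => //; rewrite le_min ge_min lexx/= ge_min; apply/orP; right.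
by apply: ge0_ler_powR; rewrite ?nnegrE ?enorm_ge0 ?(ltW p0) ?(ltW d0)// ltW.
Qed.

Lemma profile_mass_le_energy kappa c : nonneg_profile kappa -> 0 <= c ->
  (forall h, c * Num.min 1 (enorm h `^ p) <= diff_energy p u h) ->
  (c%:E * profile_mass kappa <= profile_energy kappa 1)%E.
Proof.
move=> pk c0 Hc; have mF := measurable_scaled_energy 1.
rewrite profile_massE -(profile_integralZ pk measurable_min1 min1_ge0 c0).
have mc : measurable_fun setT (fun h : Rn => c * Num.min 1 (enorm h `^ p)).
  by apply: measurable_funM => //; exact: measurable_min1.
apply: (le_profile_integral pk mc mF) => [h|h _].
  by rewrite mulr_ge0// min1_ge0.
by rewrite scale1r; exact: Hc.
Qed.

Lemma far_mass_mono kappa delta delta' : nonneg_profile kappa -> delta <= delta' ->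
  (far_mass kappa delta' <= far_mass kappa delta)%E.
Proof.
move=> pk dd; rewrite !far_massE.
have mD (r : R) : measurable [set h : Rn | (r < enorm h)%R].
  apply: (@measurable_setenorm _ _ [set s : measurableTypeR R | r < s]).
  by rewrite (_ : [set s | _] = `]r, +oo[%classic)// set_itvoy.
apply: ge0_subset_integral => //.
- by apply/measurable_EFinP; apply: measurable_funTS; exact: measurable_profile.
- by move=> h _; rewrite lee_fin; exact: pk.2.
- by move=> h /=; exact: le_lt_trans.
Qed.

End profile_inequalities.

(** * Limits of the energies *)

Section ereal_limits.
Context {R : realType} {T : Type} (F : set_system T) {FF : Filter F}.
Implicit Types (f : T -> \bar R).

Lemma cvgeP_le f (l : R) : f @ F --> l%:E <->
  forall a : R, 0 < a -> \near F, ((l - a)%:E <= f F)%E && (f F <= (l + a)%:E)%E.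
Proof.
split => [/fine_cvgP[ffin /cvgrPdist_le fl] a a0|H].
  near=> x.
  have fx : f x \is a fin_num by near: x.
  have : `|l - fine (f x)| <= a by near: x; exact: fl.
  rewrite -(fineK fx) !lee_fin/= ler_norml => /andP[h1 h2].
  by apply/andP; split; lra.
have ffin : \near F, f F \is a fin_num.
  apply: filterS (H 1 ltr01) => x /andP[h1 h2].
  by rewrite fin_numElt (lt_le_trans _ h1) ?ltNyr// (le_lt_trans h2)// ltry.
apply/fine_cvgP; split => //; apply/cvgrPdist_le => a a0.
near=> x; have fx : f x \is a fin_num by near: x.
have : ((l - a)%:E <= f x)%E && (f x <= (l + a)%:E)%E by near: x; exact: H.
rewrite -(fineK fx) !lee_fin/= => /andP[h1 h2].
by rewrite ler_norml; apply/andP; split; lra.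
Unshelve. all: by end_near. Qed.

Lemma upper_bound_arith (L C a b m t e : R) : 0 <= L -> 0 <= C ->
  (L + C) * b <= a -> m <= 1 + b -> t <= b -> e <= L * m + C * t -> e <= L + a.
Proof.
move=> L0 C0 ab mb tb eb; have := ler_wpM2l L0 mb; have := ler_wpM2l C0 tb; lra.
Qed.

Lemma lower_bound_arith (L a b m t e : R) : 0 <= L -> 0 <= a ->
  b <= 1 -> L * b <= a / 4 -> 1 - b <= m -> m <= 1 + b -> t <= b ->
  L * m <= e + a / 4 * m + L * t -> L - a <= e.
Proof.
move=> L0 a0 b1 ab m1 m2 tb eb.
have h1 := ler_wpM2l L0 m1; have h2 := ler_wpM2l L0 tb.
have a4 : 0 <= a / 4 by lra.
have h3 := ler_wpM2l a4 m2.
have h4 := ler_wpM2l a4 b1; lra.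
Qed.

(** Squeeze the energies between L m (1 - o(1)) - o(1) and L m + o(1), where m
    is the mass. The quantities are extended reals, known to be finite only
    eventually. *)
Lemma concentration_limit (E M : T -> \bar R) (t : R -> T -> \bar R) (L C : R) :
  0 <= L -> 0 <= C ->
  (\near F, (0 <= E F)%E) -> (forall d, \near F, (0 <= t d F)%E) ->
  (\near F, (E F <= L%:E * M F + C%:E * t 1%R F)%E) ->
  (forall eta, 0 < eta -> exists2 rho, 0 < rho &
    \near F, (L%:E * M F <= E F + eta%:E * M F + L%:E * t rho F)%E) ->
  M @ F --> 1%E -> (forall d, 0 < d -> t d @ F --> 0%E) -> E @ F --> L%:E.
Proof.
move=> L0 C0 E0 t0 up low M1 t_0; apply/cvgeP_le => a a0.
have a4 : 0 < a / 4 by rewrite divr_gt0.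
have [rho rho0 lowr] := low _ a4.
(* a common tolerance for the mass and for both far masses, small enough that
   its contributions, weighted by L and C, stay below a *)
pose b := Num.min 1 (a / 4 / (L + C + 1)).
have LC : 0 < L + C + 1 by rewrite ltr_wpDl// addr_ge0.
have b0 : 0 < b by rewrite lt_min ltr01 divr_gt0.
have b1 : b <= 1 by rewrite ge_min lexx.
have bLC : (L + C + 1) * b <= a / 4.
  by rewrite mulrC -ler_pdivlMr// ge_min lexx orbT.
have LCb : (L + C) * b <= a by move: b0 bLC; rewrite !mulrDl; lra.
have Lb : L * b <= a / 4.
  by have := mulr_ge0 C0 (ltW b0); move: b0 bLC; rewrite !mulrDl; lra.
move/cvgeP_le : M1 => /(_ _ b0) M1.
have /cvgeP_le/(_ _ b0) t1 := t_0 1 ltr01.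
have /cvgeP_le/(_ _ b0) tr := t_0 rho rho0.
near=> x.
have : ((1 - b)%:E <= M x)%E && (M x <= (1 + b)%:E)%E by near: x; exact: M1.
have : ((0 - b)%:E <= t 1%R x)%E && (t 1%R x <= (0 + b)%:E)%E by near: x; exact: t1.
have : ((0 - b)%:E <= t rho x)%E && (t rho x <= (0 + b)%:E)%E by near: x; exact: tr.
have : (0 <= E x)%E by near: x; exact: E0.
have : (E x <= L%:E * M x + C%:E * t 1%R x)%E by near: x; exact: up.
have : (L%:E * M x <= E x + (a / 4)%:E * M x + L%:E * t rho x)%E by near: x; exact: lowr.
case: (M x) => [m| |] //=; rewrite ?andbF//.
case: (t 1%R x) => [t1x| |] //=; rewrite ?andbF//.
case: (t rho x) => [trx| |] //=; rewrite ?andbF//.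
case: (E x) => [e| |] //=.
rewrite -!EFinM -!EFinD !lee_fin !add0r => h1 h2 _ /andP[_ h3] /andP[_ h4] /andP[h5 h6].
apply/andP; split.
  exact: (lower_bound_arith L0 (ltW a0) b1 Lb h5 h6 h3 h1).
exact: (upper_bound_arith L0 C0 LCb h6 h4 h2).
Unshelve. all: by end_near. Qed.

(** The three uses of the family of limits: tau = 1 bounds [S] and [t], a large
    tau gives S >= 1 - eta, and tau = rho / d then leaves at most a small
    share to [t]. The error [eta] is chosen small before [rho] and tau are. *)
Lemma concentration_converse (H S t : R -> T -> \bar R) (L C c p : R) :
  1 < p -> 0 < L -> 0 <= C -> 0 < c ->
  (forall tau, 0 < tau -> H tau @ F --> (tau `^ p * L)%:E) ->
  (forall d, \near F, (0 <= S d F)%E) -> (forall d, \near F, (0 <= t d F)%E) ->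
  (forall d, 0 < d -> d <= 1 -> \near F, (c%:E * S d F <= H 1%R F)%E) ->
  (forall d, 0 < d -> \near F, ((c * Num.min 1 (d `^ p))%:E * t d F <= H 1%R F)%E) ->
  (forall d tau, 0 < d -> 0 < tau -> \near F,
     (H tau F <= (tau `^ p * L)%:E * S d F + C%:E * t d F)%E) ->
  (forall eta, 0 < eta -> exists2 rho, 0 < rho & forall d tau, 0 < d -> 0 < tau ->
     tau * d <= rho -> \near F,
     ((tau `^ p * L)%:E * S d F + (c * (tau * d) `^ p)%:E * t d F <=
      H tau F + (eta * tau `^ p)%:E * S d F)%E) ->
  forall d, 0 < d -> d <= 1 -> S d @ F --> 1%E /\ t d @ F --> 0%E.
Proof.
move=> p1 L0 C0 c0 Hlim S0 t0 HS Ht up low d d0 d1.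
have p0 : 0 < p by lra.
pose K := c * Num.min 1 (d `^ p).
have K0 : 0 < K by rewrite mulr_gt0// lt_min ltr01 powR_gt0.
have dp0 : 0 < d `^ p by exact: powR_gt0.
suff key a : 0 < a -> \near F, exists s r : R, [/\ S d F = s%:E, t d F = r%:E,
    1 - a <= s <= 1 + a & 0 <= r <= a].
  split; apply/cvgeP_le => a a0; apply: filterS (key a a0) => x [s [r [Ss tr /andP[? ?] /andP[? ?]]]].
    by rewrite Ss !lee_fin; apply/andP; split.
  by rewrite tr !lee_fin; apply/andP; split; lra.
move=> a0.
(* the bounds serve, in turn, to keep L - eta positive, and to obtain
   S d <= 1 + a, 1 - a <= S d and t d <= a *)
pose eta := Num.min (L / 2) (Num.min (a * L / 4) (Num.min a (a * (c * d `^ p) / (2 + L)))).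
have cd : 0 < c * d `^ p by rewrite mulr_gt0.
have eta0 : 0 < eta.
  by rewrite !lt_min !divr_gt0 ?mulr_gt0// ?addr_gt0// a0.
have [e1 e2 e3 e4] : [/\ eta <= L / 2, eta <= a * L / 4, eta <= a &
    eta <= a * (c * d `^ p) / (2 + L)].
  by split; rewrite /eta !ge_min lexx ?orbT.
have [rho rho0 lowr] := low _ eta0.
(* the a priori bound on t d given by the energy at tau = 1 *)
pose Tb := (L + 1) / K.
pose A := C * Tb / (L * eta / 2).
have Le0 : 0 < L * eta / 2 by rewrite divr_gt0// mulr_gt0.
have Tb0 : 0 <= Tb by rewrite divr_ge0// ltW// addr_gt0.
(* large enough for C * t d to be negligible against tau1 `^ p; as p > 1 and
   tau1 >= 1, tau1 `^ p is at least A *)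
pose tau1 := Num.max 1 A.
have tau11 : 1 <= tau1 by rewrite le_max lexx.
have tau10 : 0 < tau1 by rewrite (lt_le_trans ltr01).
have tau1p : C * Tb <= tau1 `^ p * (L * eta / 2).
  rewrite -ler_pdivrMr// -/A; apply: le_trans (le1r_powR tau11 (ltW p1)).
  by rewrite le_max lexx orbT.
(* the largest dilation for which radii up to d remain below rho *)
pose tau2 := rho / d; have tau20 : 0 < tau2 by rewrite divr_gt0.
have tau2d : tau2 * d = rho by rewrite /tau2 divfK// gt_eqF.
have P1 : 0 < tau1 `^ p by rewrite powR_gt0.
have P2 : 0 < tau2 `^ p by rewrite powR_gt0.
have /cvgeP_le/(_ _ ltr01) H1 := Hlim 1 ltr01.
have b1 : 0 < tau1 `^ p * (L * eta / 2) by rewrite mulr_gt0.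
have b2 : 0 < tau2 `^ p * eta by rewrite mulr_gt0.
have /cvgeP_le/(_ _ b1) H2 := Hlim _ tau10.
have /cvgeP_le/(_ _ b2) H3 := Hlim _ tau20.
have HSd := HS d d0 d1; have Htd := Ht d d0; have upd := up d _ d0 tau10.
have lowd : \near F, ((tau2 `^ p * L)%:E * S d F + (c * (tau2 * d) `^ p)%:E * t d F <=
      H tau2 F + (eta * tau2 `^ p)%:E * S d F)%E.
  by apply: lowr => //; rewrite tau2d.
near=> x.
have : (0 <= S d x)%E by near: x; exact: S0.
have : (0 <= t d x)%E by near: x; exact: t0.
have : (c%:E * S d x <= H 1%R x)%E by near: x; exact: HSd.
have : (K%:E * t d x <= H 1%R x)%E by near: x; exact: Htd.
have : (H tau1 x <= (tau1 `^ p * L)%:E * S d x + C%:E * t d x)%E by near: x; exact: upd.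
have : ((tau2 `^ p * L)%:E * S d x + (c * (tau2 * d) `^ p)%:E * t d x <=
      H tau2 x + (eta * tau2 `^ p)%:E * S d x)%E by near: x; exact: lowd.
have : ((1 `^ p * L - 1)%:E <= H 1%R x)%E && (H 1%R x <= (1 `^ p * L + 1)%:E)%E by near: x; exact: H1.
have : ((tau1 `^ p * L - tau1 `^ p * (L * eta / 2))%:E <= H tau1 x)%E &&
  (H tau1 x <= (tau1 `^ p * L + tau1 `^ p * (L * eta / 2))%:E)%E by near: x; exact: H2.
have : ((tau2 `^ p * L - tau2 `^ p * eta)%:E <= H tau2 x)%E &&
  (H tau2 x <= (tau2 `^ p * L + tau2 `^ p * eta)%:E)%E by near: x; exact: H3.
case: (H tau2 x) => [h2| |] //=; rewrite ?andbF//.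
case: (H tau1 x) => [h1| |] //=; rewrite ?andbF//.
case: (H 1%R x) => [h| |] //=; rewrite ?andbF//.
rewrite powR1 mul1r.
move=> /andP[_ a2] /andP[a1 _] /andP[_ ah] q1 q2 q3 q4 q5 q6.
have Sfin : S d x \is a fin_num.
  rewrite ge0_fin_numE//; case: (S d x) q4 => [s| |] //=; first by rewrite ltry.
  by rewrite gt0_muley ?lte_fin.
have tfin : t d x \is a fin_num.
  rewrite ge0_fin_numE//; case: (t d x) q3 => [s| |] //=; first by rewrite ltry.
  by rewrite gt0_muley ?lte_fin.
exists (fine (S d x)), (fine (t d x)); rewrite !fineK//.
move: q1 q2 q3 q4 q5 q6; rewrite -(fineK Sfin) -(fineK tfin)/=.
move: (fine (S d x)) (fine (t d x)) => s r.
rewrite -!EFinM -!EFinD !lee_fin in a1 a2 ah *.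
move=> q1 q2 q3 q4 r0 s0.
have rT : r <= Tb by rewrite /Tb ler_pdivlMr// mulrC (le_trans q3).
have s1 : 1 - eta <= s.
  have : C * r <= tau1 `^ p * (L * eta / 2) by apply: le_trans tau1p; exact: ler_wpM2l.
  move=> Cr; have : tau1 `^ p * (L * (1 - eta)) <= tau1 `^ p * (L * s).
    by move: a1 q2 Cr; clear; lra.
  by rewrite !ler_pM2l.
have q1' : (L - eta) * s + c * d `^ p * r <= L + eta.
  rewrite -(ler_pM2l P2); move: q1 a2; rewrite (powRM p (ltW tau20) (ltW d0)).
  by clear; lra.
have Le : 0 < L - eta by move: L0 e1; clear; lra.
have cdr : 0 <= c * d `^ p * r by rewrite mulr_ge0 ?(ltW cd).
split => //.
- apply/andP; split; first by move: s1 e3; clear; lra.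
  have : (L - eta) * s <= (L - eta) * (1 + a).
    have ea : eta * a <= L / 2 * a by rewrite ler_wpM2r// ltW.
    have e2' : 4 * eta <= a * L by move: e2; clear; lra.
    by move: q1' ea e2' cdr; clear; lra.
  by rewrite ler_pM2l.
- apply/andP; split => //.
  have : c * d `^ p * r <= c * d `^ p * a.
    have : (L - eta) * (1 - eta) <= (L - eta) * s by rewrite ler_pM2l.
    have : eta * (2 + L) <= a * (c * d `^ p) by rewrite -ler_pdivlMr// addr_gt0.
    have : 0 <= eta * eta by rewrite mulr_ge0 ?ltW.
    by move: q1'; clear; lra.
  by rewrite ler_pM2l.
Unshelve. all: by end_near. Qed.

End ereal_limits.

(** * Sobolev functions *)

Section function_space_links.
Context {R : realType} {n : nat}.
Local Notation Rn := 'rV[R]_n.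
Local Notation leb := (@lebesgue_rV R n).
Implicit Types (x h : Rn) (u phi : Rn -> R) (G : Rn -> Rn).

(** The p-norm is finite exactly when its p-th power is. *)
Lemma LfunP (p : R) u : 0 < p -> u \in Lfun leb p%:E <-> Lpi p u.
Proof.
move=> p0; have p0' : p != 0 by rewrite gt_eqF.
have E : ('N[leb]_p%:E[EFin \o u] `^ p = \int[leb]_x (`|u x| `^ p)%:E)%E by exact: powR_Lnorm.
split.
  move=> /andP[mu fu]; move: mu fu; rewrite !inE/= => mu fu; split => //.
  apply: intg_ge0P => //; first exact: measurable_norm_powR.
  by rewrite -E; exact: poweR_lty.
move=> [mu iu]; apply/andP; split; rewrite inE//=.
rewrite /finite_norm ltNge leye_eq; apply/negP => /eqP Ey.
have := integrable_fin_num measurableT iu.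
by move=> /=; rewrite -E Ey poweRyr.
Qed.

Lemma is_derive_Cc u i x : smooth u -> is_derive x (delta_mx ord0 i) u (partial i u x).
Proof. by move=> su; split => //; exact: smooth_derivable. Qed.

Lemma partialM u phi i x : smooth u -> smooth phi ->
  partial i (fun y => u y * phi y) x = u x * partial i phi x + partial i u x * phi x.
Proof.
move=> su sphi.
have := is_deriveM (is_derive_Cc i x su) (is_derive_Cc i x sphi).
move=> [_]; rewrite /partial => ->.
by rewrite -!/(partial _ _ _) -[in RHS](mulrC (phi x)).
Qed.

(** Translation invariance makes the integral of u(x + s e_i) - u(x) vanish, and
    Taylor's formula says that it is s times the integral of the derivative up
    to O(s^2). *)
Lemma Rintegral_partial u i : Cc_infty u -> \int[leb]_x partial i u x = 0.
Proof.
move=> cu; have [C [M [C0 M0 T]]] := Cc_taylor_cpt cu.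
set J := Rintegral _ _ _.
pose B := \1_[set x : Rn | enorm x <= M] : Rn -> R.
have iB : intg leb B by exact: intg_ball.
pose V := \int[leb]_x B x.
have V0 : 0 <= V by apply: Rintegral_ge0 => x _; rewrite /B indicE; case: (_ \in _).
have iu := Cc_intg cu.
have ip := Cc_intg (Cc_partial i cu).
(* the main term is linear in s, the Taylor remainder quadratic *)
have key s : 0 < s -> s <= 1 -> `|J| <= C * V * s.
  move=> s0 s1; pose h : Rn := s *: delta_mx ord0 i.
  have hn : enorm h = s.
    by rewrite enormZ enorm_delta mulr1 gtr0_norm.
  have dh x : dot h (grad u x) = s * partial i u x.
    by rewrite dotZl dotC dot_delta mxE.
  have ish : intg leb (fun x => u (x + h)) by exact: intg_shift.
  have : `|\int[leb]_x (u (x + h) - u x - s * partial i u x)| <= C * s ^+ 2 * V.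
    apply: le_trans (le_normr_Rintegral _ _) _ => //.
      by apply: intgB; [exact: intgB | exact: intgZ].
    rewrite -RintegralZl//; apply: le_Rintegral => //.
    - by apply: intg_norm; apply: intgB; [exact: intgB | exact: intgZ].
    - exact: intgZ.
    - by move=> x _; rewrite -dh -hn; apply: T; rewrite hn.
  rewrite RintegralB//; [|exact: intgB|exact: intgZ].
  rewrite RintegralB// Rintegral_shift// subrr sub0r normrN RintegralZl//.
  rewrite normrM (gtr0_norm s0) expr2 => H.
  by rewrite -(ler_pM2l s0); apply: le_trans H _; rewrite le_eqVlt; apply/orP; left; apply/eqP; ring.
apply/eqP; rewrite -normr_le0; apply/ler_addgt0Pl => eps eps0; rewrite addr0.
pose K := C * V + 1.
have CV : 0 <= C * V by exact: mulr_ge0.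
have K0 : 0 < K by rewrite /K; lra.
pose s := Num.min 1 (eps / K).
have s0 : 0 < s by rewrite lt_min ltr01 divr_gt0.
have s1 : s <= 1 by rewrite ge_min lexx.
apply: le_trans (key _ s0 s1) _.
have : K * s <= eps by rewrite mulrC -ler_pdivlMr// ge_min lexx orbT.
by rewrite /K mulrDl; lra.
Qed.

(** The integral of the derivative of the product vanishes. *)
Lemma Cc_by_parts u phi i : Cc_infty u -> Cc_infty phi ->
  \int[leb]_x (u x * partial i phi x) = - \int[leb]_x (partial i u x * phi x).
Proof.
move=> cu cphi; have su := Cc_smooth cu; have sphi := Cc_smooth cphi.
have := Rintegral_partial i (CcM cu sphi).
under eq_Rintegral do rewrite partialM//.
rewrite RintegralD//.
- by move=> /eqP; rewrite addr_eq0 => /eqP.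
- exact: (Cc_intg (CcM cu (smooth_partial i sphi))).
- exact: (Cc_intg (CcM (Cc_partial i cu) sphi)).
Qed.

Lemma Lp_weak_gradient_real (p : R) u G : 1 < p -> Lpi p u -> Lp_weak_gradient p u G ->
  (forall i, Lpi p (fun x => G x ord0 i)) /\
  (forall phi i, Cc_infty phi ->
    \int[leb]_x (u x * partial i phi x) = - \int[leb]_x (G x ord0 i * phi x)).
Proof.
move=> p1 Lu wG; have p0 : 0 < p by exact: lt_trans p1.
have LG i : Lpi p (fun x => G x ord0 i) by apply/LfunP => //; exact: (wG i).1.
split => // phi i cphi; apply: EFin_inj.
rewrite EFinN !EFin_Rintegral; first exact: (wG i).2.
  exact: (Lpi_mul_Cc p1 (LG i) cphi).
exact: (Lpi_mul_Cc p1 Lu (Cc_partial i cphi)).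
Qed.

Lemma Cc_weak_gradient (p : R) u : 1 < p -> Cc_infty u ->
  u \in Lfun leb p%:E /\ Lp_weak_gradient p u (grad u).
Proof.
move=> p1 cu; have p0 : 0 < p by exact: lt_trans p1.
split; first by apply/LfunP => //; exact: Cc_Lpi.
move=> i; rewrite (_ : (fun x => grad u x ord0 i) = partial i u).
  split; first by apply/LfunP => //; apply: Cc_Lpi => //; exact: Cc_partial.
  move=> phi cphi.
  transitivity (\int[leb]_x (u x * partial i phi x))%:E.
    rewrite EFin_Rintegral//.
    exact: (Cc_intg (CcM cu (smooth_partial i (Cc_smooth cphi)))).
  rewrite Cc_by_parts// EFinN EFin_Rintegral.
    by congr (- _)%E; apply: eq_integral => x _; rewrite mxE.
  exact: (Cc_intg (CcM (Cc_partial i cu) (Cc_smooth cphi))).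
by apply/funext => x; rewrite mxE.
Qed.

End function_space_links.

(** * Radial kernels and rescaled functions *)

Section radial_kernels.
Context {R : realType} {n : nat}.
Local Notation Rn := 'rV[R]_n.+1.
Local Notation leb := (@lebesgue_rV R n.+1).
Local Notation e1 := (delta_mx ord0 ord_max : Rn).
Implicit Types (h : Rn) (k u : Rn -> R) (G : Rn -> Rn).

(** A radial function off the origin, read along the last coordinate axis;
    nonpositive radii get the value 0, so that the profile is measurable and
    nonnegative everywhere. *)
Definition radial_profile k (r : R) : R :=
  ((k \o (fun s : R => s *: e1)) \_ `]0, +oo[) r.

Lemma radial_profileE k h : radial k -> h != 0 -> radial_profile k (enorm h) = k h.
Proof.
move=> rk h0; have eh : 0 < enorm h by rewrite enorm_gt0.
rewrite /radial_profile patchE ifT; last first.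
  by rewrite inE/= in_itv/= eh.
apply: rk => //=; first by rewrite -enorm_eq0 enormZ enorm_delta mulr1 gtr0_norm// gt_eqF.
by rewrite enormZ enorm_delta mulr1 gtr0_norm.
Qed.

Lemma radial_profileP k : measurable_fun [set x : Rn | x != 0] k ->
  (forall x, x != 0 -> 0 <= k x) -> nonneg_profile (radial_profile k).
Proof.
move=> mk k0; have en r : 0 < r -> r *: e1 != 0.
  by move=> r0; rewrite -enorm_eq0 enormZ enorm_delta mulr1 gtr0_norm// gt_eqF.
split.
  apply/(measurable_restrictT _ (@measurable_itv R `]0, +oo[)).
  apply: (@measurable_comp _ _ _ _ _ _ [set x : Rn | x != 0]) => //.
  - rewrite (_ : [set x | _] = [set x : Rn | `]0, +oo[%classic (enorm x)]).
      by apply: measurable_setenorm; exact: measurable_itv.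
    by apply/seteqP; split => x /=; rewrite in_itv/= andbT enorm_gt0.
  - by move=> _ [r r0 <-]; move: r0; rewrite /= in_itv/= andbT; exact: en.
  - apply: measurable_funTS; apply: measurable_fun_rVP => i.
    by under eq_fun do rewrite mxE; apply: measurable_funM => //.
move=> r; rewrite /radial_profile patchE; case: ifPn => [|_//].
by rewrite inE/= in_itv/= andbT => r0; apply: k0; exact: en.
Qed.

Variables (p : R).
Hypothesis p1 : 1 < p.
Let p0 : 0 < p. Proof. exact: lt_trans p1. Qed.
Let p_neq0 : p != 0. Proof. by rewrite gt_eqF. Qed.

Lemma nonlocal_energyE k u : radial k -> nonneg_profile (radial_profile k) -> Lpi p u ->
  nonlocal_energy p k u = profile_energy p u (radial_profile k) 1.
Proof.
move=> rk pk Lu.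
rewrite /profile_energy; under [RHS]eq_integral do rewrite scale1r.
rewrite -(double_integral_diff p1 Lu (measurable_profile pk) (fun h => pk.2 _)).
apply: eq_integral => x _; apply: eq_integral => y _.
have [->|xy] := eqVneq x y; first by rewrite subrr normr0 powR0// !mul0r.
by rewrite radial_profileE// subr_eq0.
Qed.

Lemma profile_mass_kernel k : radial k ->
  @profile_mass _ n p (radial_profile k) = (\int[leb]_h (Num.min 1 (enorm h `^ p) * k h)%:E)%E.
Proof.
move=> rk; apply: eq_integral => h _.
have [->|h0] := eqVneq h 0; last by rewrite radial_profileE.
by rewrite enorm0 powR0// min_r ?ler01// !mul0r.
Qed.

Lemma far_mass_kernel k delta : radial k -> 0 < delta ->
  @far_mass _ n (radial_profile k) delta =
  (\int[leb]_(h in [set h : Rn | (delta < enorm h)%R]) (k h)%:E)%E.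
Proof.
move=> rk d0; rewrite far_massE; apply: eq_integral => h /set_mem/= hd.
by rewrite radial_profileE// -enorm_gt0 (lt_trans d0).
Qed.

Lemma enorm_le_sum h : enorm h <= \sum_i `|h ord0 i|.
Proof.
rewrite -[leRHS]ger0_norm; last by apply: sumr_ge0.
rewrite -sqrtr_sqr ler_wsqrtr//.
have S m (f : 'I_m -> R) : \sum_i f i ^+ 2 <= (\sum_i `|f i|) ^+ 2.
  elim: m f => [|m IH] f; first by rewrite !big_ord0 expr0n.
  rewrite !big_ord_recl sqrrD; have := IH (fun i => f (lift ord0 i)).
  rewrite -normrX (ger0_norm (sqr_ge0 _)) => H.
  have : 0 <= `|f ord0| * \sum_(i < m) `|f (lift ord0 i)| by rewrite mulr_ge0// sumr_ge0.
  by rewrite mulr2n; lra.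
exact: S.
Qed.

Lemma sphere_constant_ge0 : 0 <= sphere_constant n p.
Proof.
rewrite /sphere_constant divr_ge0// fine_ge0//.
by apply: integral_ge0 => x _; rewrite lee_fin powR_ge0.
Qed.

Lemma gradient_energy_fin G : (forall i, Lpi p (fun x => G x ord0 i)) ->
  exists2 L : R, 0 <= L &
    ((sphere_constant n p)%:E * gradient_energy p G = L%:E)%E.
Proof.
move=> LG; have mG : measurable_fun setT G by apply: measurable_fun_rVP => i; exact: (LG i).1.
have [_ iS] : Lpi p (fun x => \sum_i `|G x ord0 i|).
  by apply: Lpi_sum => // i; exact: Lpi_norm.
have iG : intg leb (fun x => enorm (G x) `^ p).
  apply: intg_le iS.
    apply: (measurableT_comp (measurable_powR p)).
    exact: (measurableT_comp (@measurable_enorm R n.+1)).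
  move=> x; rewrite ger0_norm ?powR_ge0//.
  apply: ge0_ler_powR; rewrite ?nnegrE ?enorm_ge0 ?(ltW p0)//.
  by rewrite ger0_norm ?enorm_le_sum// sumr_ge0.
exists (sphere_constant n p * \int[leb]_x (enorm (G x) `^ p)).
  rewrite mulr_ge0 ?sphere_constant_ge0//.
  by apply: Rintegral_ge0 => x _; exact: powR_ge0.
by rewrite [RHS]EFinM; congr (_ * _)%E; rewrite -[LHS](EFin_Rintegral iG).
Qed.

End radial_kernels.

Section rescaling.
Context {R : realType} {n : nat}.
Local Notation Rn := 'rV[R]_n.+1.
Local Notation leb := (@lebesgue_rV R n.+1).
Implicit Types (h x : Rn) (k : Rn -> R).
Variables (p : R) (u : Rn -> R) (tau : R).
Hypothesis p1 : 1 < p.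
Hypothesis cu : Cc_infty u.
Hypothesis tau0 : 0 < tau.

Let Lu : Lpi p u. Proof. exact: Cc_Lpi. Qed.

Lemma Cc_rescale : Cc_infty (rescale u tau).
Proof. exact: (Cc_dilation (tau ^+ n.+1) tau0 cu). Qed.

Lemma grad_rescale x : grad (rescale u tau) x = (tau ^+ n.+1 * tau) *: grad u (tau *: x).
Proof.
apply/rowP => i; rewrite !mxE /rescale.
exact: (partial_dilation tau (tau ^+ n.+1) i x (Cc_smooth cu)).
Qed.

(** The substitution x |-> tau x produces the same volume factor on both sides,
    so that only tau^p distinguishes the gradient from the increments. *)
Lemma rescale_energies : exists2 a : R, 0 < a &
  (forall k, radial k -> nonneg_profile (radial_profile k) ->
     nonlocal_energy p k (rescale u tau) =
       (a%:E * profile_energy p u (radial_profile k) tau)%E) /\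
  gradient_energy p (grad (rescale u tau)) =
    ((a * tau `^ p)%:E * gradient_energy p (grad u))%E.
Proof.
have [c c0 Hc] := lebesgue_dilation (n := n.+1) tau0.
have td : 0 < tau ^+ n.+1 by exact: exprn_gt0.
pose b := (tau ^+ n.+1) `^ p; have b0 : 0 < b by exact: powR_gt0.
exists (b * c); first exact: mulr_gt0.
have Lr : Lpi p (rescale u tau) by apply: Cc_Lpi => //; exact: Cc_rescale.
split.
  move=> k rk pk; rewrite (nonlocal_energyE p1 rk pk Lr).
  have mF : measurable_fun setT (fun h => diff_energy p u (tau *: h)).
    exact: measurable_scaled_energy.
  have bc0 : 0 <= b * c by rewrite mulr_ge0 ?ltW.
  rewrite /profile_energy -(profile_integralZ pk mF (fun=> diff_energy_ge0 _ _ _) bc0).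
  apply: eq_integral => h _; congr (_ * _)%:E; rewrite scale1r.
  apply: EFin_inj; rewrite EFinM (EFin_Rintegral (Lpi_diff p1 Lr h).2).
  rewrite (EFin_Rintegral (Lpi_diff p1 Lu (tau *: h)).2) EFinM -muleA.
  pose f x := (`|u x - u (x - tau *: h)| `^ p)%:E.
  have mf : measurable_fun setT f.
    apply/measurable_EFinP.
    exact: intg_measurable (Lpi_diff p1 Lu (tau *: h)).2.
  have f0 x : (0 <= f x)%E by rewrite lee_fin powR_ge0.
  rewrite -(Hc f mf f0) -ge0_integralZl ?lee_fin ?(ltW b0)//.
  - apply: eq_integral => x _; rewrite -EFinM /rescale -mulrBr normrM powRM//.
    by rewrite (gtr0_norm td) scalerBr.
  - by apply: (measurableT_comp mf); exact: measurable_scaleV.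
pose f x := (enorm (grad u x) `^ p)%:E.
have mf : measurable_fun setT f.
  apply/measurable_EFinP; apply: (measurableT_comp (measurable_powR p)).
  apply: (measurableT_comp (@measurable_enorm R n.+1)).
  apply: measurable_fun_rVP => i; under eq_fun do rewrite mxE.
  exact: (Cc_measurable (Cc_partial i cu)).
have f0 x : (0 <= f x)%E by rewrite lee_fin powR_ge0.
rewrite mulrAC EFinM -muleA -/(gradient_energy _ _).
rewrite -[gradient_energy p (grad u)]/(\int[leb]_x f x)%E -(Hc f mf f0).
have mft : measurable_fun setT (fun x => f (tau *: x)).
  by apply: (measurableT_comp mf); exact: measurable_scaleV.
have bt0 : (0 <= (b * tau `^ p)%:E)%E by rewrite lee_fin mulr_ge0 ?powR_ge0.
rewrite -(ge0_integralZl leb measurableT mft (fun x _ => f0 _) bt0).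
apply: eq_integral => x _; rewrite grad_rescale enormZ (powRM _ (normr_ge0 _) (enorm_ge0 _)).
by rewrite (gtr0_norm (mulr_gt0 td tau0)) (powRM _ (ltW td) (ltW tau0)) EFinM.
Qed.

End rescaling.

(** * The equivalence *)

Section implications.
Context {R : realType} {n : nat}.
Local Notation Rn := 'rV[R]_n.+1.
Local Notation leb := (@lebesgue_rV R n.+1).
Implicit Types (h x : Rn) (u : Rn -> R) (G : Rn -> Rn) (e delta tau : R).
Variables (p : R) (nu : R -> Rn -> R).
Hypothesis p1 : 1 < p.
Hypothesis nu_radial : forall e, 0 < e -> radial (nu e).
Hypothesis nu_measurable : forall e, 0 < e ->
  measurable_fun [set x : Rn | x != 0] (nu e).
Hypothesis nu_ge0 : forall e, 0 < e -> forall x, x != 0 -> 0 <= nu e x.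

Let kap e := radial_profile (nu e).
Local Notation mass e := (@profile_mass R n p (kap e)).
Local Notation near_m delta e := (@near_moment R n p (kap e) delta).
Local Notation far delta e := (@far_mass R n (kap e) delta).
Local Notation energy u tau e := (profile_energy p u (kap e) tau).

Let p0 : 0 < p. Proof. exact: lt_trans p1. Qed.

Let kapP e : 0 < e -> nonneg_profile (kap e).
Proof. by move=> e0; apply: radial_profileP; [exact: nu_measurable | exact: nu_ge0]. Qed.

Lemma right_near (P : R -> Prop) : (forall e, 0 < e -> P e) -> \forall e \near 0^'+, P e.
Proof. by move=> H; apply: filterS (nbhs_right_gt 0); exact: H. Qed.

Lemma right_cvg_eq (f g : R -> \bar R) (l : \bar R) : (forall e, 0 < e -> f e = g e) ->
  f e @[e --> 0^'+] --> l -> g e @[e --> 0^'+] --> l.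
Proof.
move=> fg; apply: cvg_trans; apply: near_eq_cvg; apply: right_near => e e0.
by rewrite fg.
Qed.

Lemma concentratesP : concentrates p nu <->
  mass e @[e --> 0^'+] --> 1%E /\
  forall delta, 0 < delta -> far delta e @[e --> 0^'+] --> 0%E.
Proof.
split=> -[M T]; split.
- apply: right_cvg_eq M => e e0.
  by rewrite profile_mass_kernel//; exact: nu_radial.
- move=> delta d0; apply: right_cvg_eq (T _ d0) => e e0.
  by rewrite far_mass_kernel//; exact: nu_radial.
- apply: right_cvg_eq M => e e0.
  by rewrite profile_mass_kernel//; exact: nu_radial.
- move=> delta d0; apply: right_cvg_eq (T _ d0) => e e0.
  by rewrite far_mass_kernel//; exact: nu_radial.
Qed.

(** For the lower bound the profile is cut at the radius [rho] up to which
    slopes are controlled by increments, and the energy beyond is dropped, hence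
    [c = 0] in [profile_energy_ge]. *)
Lemma concentrates_energy_limit u G : Lpi p u ->
  (forall i, Lpi p (fun x => G x ord0 i)) ->
  (forall phi i, Cc_infty phi ->
    \int[leb]_x (u x * partial i phi x) = - \int[leb]_x (G x ord0 i * phi x)) ->
  concentrates p nu -> energy_limit p nu u G.
Proof.
move=> Lu LG weak /concentratesP[M1 T0].
have [L L0 LE] := gradient_energy_fin p1 LG.
have [C C0 FC] := diff_energy_bounded p1 Lu.
rewrite /energy_limit LE.
have HE e : 0 < e -> energy u 1 e = nonlocal_energy p (nu e) u.
  by move=> e0; rewrite nonlocal_energyE//; [exact: nu_radial | exact: kapP].
apply: (right_cvg_eq HE).
apply: (@concentration_limit _ _ _ _ (fun e => energy u 1 e) (fun e => mass e)
  (fun d e => far d e) L C) => //.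
- by apply: right_near => e e0; apply: profile_energy_ge0; exact: kapP.
- by move=> d; apply: right_near => e e0; apply: far_mass_ge0; exact: kapP.
- apply: right_near => e e0; have pk := kapP e0.
  apply: le_trans (profile_energy_le p1 Lu LG weak LE 1 pk ltr01 C0 FC) _.
  rewrite powR1 mul1r; apply: leeD => //.
  by apply: lee_wpmul2l; rewrite ?lee_fin//; exact: near_moment_le.
- move=> eta eta0.
  have [rho [rho0 rho1 HS]] := slope_energy_small p1 Lu LG weak eta0.
  exists rho => //; apply: right_near => e e0; have pk := kapP e0.
  have Hc h : 0 * Num.min 1 (enorm h `^ p) <= diff_energy p u h.
    by rewrite mul0r; exact: diff_energy_ge0.
  have rr : 1 * rho <= rho by rewrite mul1r.
  have := profile_energy_ge p1 Lu LG LE pk ltr01 rho0 rho1 rr eta0 (lexx 0) HS Hc.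
  rewrite powR1 mul1r mulr1 mul0r mul0e adde0 => H.
  apply: (@le_trans _ _ (L%:E * near_m rho e + L%:E * far rho e)%E).
    rewrite -ge0_muleDr; [|exact: near_moment_ge0|exact: far_mass_ge0].
    by apply: lee_wpmul2l; rewrite ?lee_fin//; exact: profile_mass_le.
  apply: leeD => //; apply: le_trans H _; apply: leeD => //.
  by apply: lee_wpmul2l; rewrite ?lee_fin ?(ltW eta0)//; exact: near_moment_le.
Qed.

(** Positivity comes from the energies themselves. With the unit profile, whose
    moment is the volume B of the unit ball, coercivity and the bound of
    increments by slopes give c B <= L B. *)
Lemma gradient_energy_pos u : Cc_infty u -> (exists x, u x != 0) ->
  exists2 L : R, 0 < L &
    ((sphere_constant n p)%:E * gradient_energy p (grad u) = L%:E)%E.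
Proof.
move=> cu ux; have [Lu' wG] := Cc_weak_gradient p1 cu.
have Lu := Cc_Lpi p1 cu; have [LG weak] := Lp_weak_gradient_real p1 Lu wG.
have [L L0 LE] := gradient_energy_fin p1 LG.
exists L => //.
have [C C0 FC] := diff_energy_bounded p1 Lu.
have [c c0 Hc] := diff_energy_coercive p1 cu ux.
have pk := unit_profileP p.
have H1 := profile_mass_le_energy p1 Lu pk (ltW c0) Hc.
have H2 := profile_energy_le p1 Lu LG weak LE 1 pk ltr01 C0 FC.
have far0 : @far_mass R n (unit_profile p) 1 = 0%E.
  rewrite /far_mass; apply: integral0_eq => h _.
  rewrite /far_profile /unit_profile !indicE.
  case: (boolP (enorm h \in [set r : measurableTypeR R | 1 < r])) => [/set_mem/= h1|_].
    by rewrite memNset/= ?mul0r// => /andP[_ /le_lt_trans/(_ h1)]; rewrite ltxx.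
  by rewrite mulr0.
have massE : @near_moment R n p (unit_profile p) 1 = leb (@punctured_ball R n.+1).
  rewrite /near_moment; transitivity (\int[leb]_h (\1_(@punctured_ball R n.+1) h)%:E)%E.
    apply: eq_integral => h _; rewrite -(unit_profile_norm _ (lt0r_neq0 p0)).
    rewrite /near_profile -mulrA (mulrC (\1_ _ _)) mulrA /unit_profile !indicE.
    case: (boolP (enorm h \in [set r : measurableTypeR R | 0 < r <= 1])) => [/set_mem/= /andP[_ h1]|_].
      by rewrite (mem_set (h1 : [set r : measurableTypeR R | r <= 1] _)) mulr1.
    by rewrite !mul0r.
  rewrite integral_indic; [|exact: measurableT|exact: measurable_punctured_ball].
  by rewrite setIT.
have [B0 Boo] := @punctured_ball_pos R n.
have Bf : leb (@punctured_ball R n.+1) \is a fin_num by rewrite ge0_fin_numE ?(ltW B0).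
have := le_trans H1 H2.
rewrite (profile_mass1 p1 pk) far0 massE mule0 !adde0 powR1 mul1r.
rewrite -(fineK Bf) -!EFinM lee_fin ler_pM2r ?fine_gt0 ?B0//.
exact: lt_le_trans.
Qed.

(** [concentration_converse] handles radii up to 1, where the near moment is at
    most the mass; larger radii follow because the far mass decreases, and the
    mass is the near moment plus the far mass at radius 1. *)
Lemma rescaled_limits_concentrate u : Cc_infty u -> (exists x, u x != 0) ->
  (forall tau, 0 < tau -> energy_limit p nu (rescale u tau) (grad (rescale u tau))) ->
  concentrates p nu.
Proof.
move=> cu ux lim; have [L L0 LE] := gradient_energy_pos cu ux.
have [_ wG] := Cc_weak_gradient p1 cu.
have Lu := Cc_Lpi p1 cu; have [LG weak] := Lp_weak_gradient_real p1 Lu wG.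
have [C C0 FC] := diff_energy_bounded p1 Lu.
have [c c0 Hc] := diff_energy_coercive p1 cu ux.
have Hlim tau : 0 < tau ->
    profile_energy p u (kap e) tau @[e --> 0^'+] --> (tau `^ p * L)%:E.
  move=> tau0; have [a a0 [aE aG]] := rescale_energies p1 cu tau0.
  have := lim tau tau0; rewrite /energy_limit aG muleCA LE -EFinM => H.
  have afin : (a^-1)%:E \is a fin_num by [].
  have := cvgeZl afin H.
  rewrite -EFinM (_ : a^-1 * (a * tau `^ p * L) = tau `^ p * L); last first.
    by rewrite -mulrA mulKf// gt_eqF.
  apply: right_cvg_eq => e e0.
  rewrite aE; [|exact: nu_radial|exact: kapP].
  by rewrite muleA -EFinM mulVf ?mul1e// gt_eqF.
have conv d : 0 < d -> d <= 1 ->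
  (@near_moment R n p (kap e) d @[e --> 0^'+] --> 1%E) /\
  (@far_mass R n (kap e) d @[e --> 0^'+] --> 0%E).
  move=> d0 d1; apply: (@concentration_converse _ _ _ _
    (fun tau e => profile_energy p u (kap e) tau)
    (fun d e => @near_moment R n p (kap e) d)
    (fun d e => @far_mass R n (kap e) d) L C c p) => //.
  - by move=> r; apply: right_near => e e0; apply: near_moment_ge0; exact: kapP.
  - by move=> r; apply: right_near => e e0; apply: far_mass_ge0; exact: kapP.
  - move=> r r0 r1; apply: right_near => e e0; have pk := kapP e0.
    apply: le_trans (profile_mass_le_energy p1 Lu pk (ltW c0) Hc).
    by apply: lee_wpmul2l; rewrite ?lee_fin ?(ltW c0)//; exact: near_moment_le.
  - move=> r r0; apply: right_near => e e0.
    exact: (far_mass_le_energy p1 Lu (kapP e0) r0 (ltW c0) Hc).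
  - move=> r tau r0 tau0; apply: right_near => e e0.
    exact: (profile_energy_le p1 Lu LG weak LE r (kapP e0) tau0 C0 FC).
  - move=> eta eta0; have [rho [rho0 rho1 HS]] := slope_energy_small p1 Lu LG weak eta0.
    exists rho => // r tau r0 tau0 rt; apply: right_near => e e0.
    exact: (profile_energy_ge p1 Lu LG LE (kapP e0) tau0 r0 rho1 rt eta0 (ltW c0) HS Hc).
apply/concentratesP => //; have [S1 T1] := conv _ ltr01 (lexx _).
split.
  have := cvgeD _ S1 T1; rewrite adde0 => /(_ _ isT); apply: right_cvg_eq => e e0.
  by rewrite profile_mass1//; exact: kapP.
move=> d d0; have [d1|d1] := leP d 1; first exact: (conv d d0 d1).2.
apply: (squeeze_cvge _ (cvg_cst 0%E) T1).
apply: right_near => e e0; rewrite far_mass_ge0; last exact: kapP.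
by apply: far_mass_mono; [exact: kapP | exact: ltW].
Qed.

End implications.

(* the dimension is d = n.+1 >= 1 *)
Theorem theorem9p6 (R : realType) (n : nat) (p : R) (p_gt1 : 1 < p)
    (nu : R -> 'rV[R]_n.+1 -> R)
    (nu_radial : forall e : R, 0 < e -> radial (nu e))
    (nu_measurable : forall e : R, 0 < e ->
      measurable_fun [set x : 'rV[R]_n.+1 | x != 0] (nu e))
    (nu_ge0 : forall e : R, 0 < e -> forall x : 'rV[R]_n.+1,
      x != 0 -> 0 <= nu e x) :
  [<-> concentrates p nu;
       forall u, W1p p u ->
         forall G, Lp_weak_gradient p u G -> energy_limit p nu u G;
       forall u, Cc_infty u -> energy_limit p nu u (grad u);
       exists u, [/\ Cc_infty u, exists x, u x != 0 &
         forall tau : R, 0 < tau ->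
           energy_limit p nu (rescale u tau) (grad (rescale u tau))]].
Proof.
have p0 : 0 < p by exact: lt_trans p_gt1.
tfae.
- move=> conc u [/(LfunP _ p0) Lu _] G wG.
  have [LG weak] := Lp_weak_gradient_real p_gt1 Lu wG.
  exact: concentrates_energy_limit conc.
- move=> lim u cu; have [Lu wG] := Cc_weak_gradient p_gt1 cu.
  by apply: lim => //; split => //; exists (grad u).
- move=> lim; exists (cutoff 1); split.
  + exact: Cc_cutoff.
  + by exists 0; rewrite gt_eqF// cutoff_gt0.
  + by move=> tau tau0; apply: lim; apply: Cc_rescale => //; exact: Cc_cutoff.
- by move=> [u [cu ux lim]]; exact: rescaled_limits_concentrate lim.
Qed.
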